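(* Let $n,k,\lambda$ be integers with $n\ge k\ge 3$ and $\lambda=\left\lfloor\frac{kn-2k-1}{k^2-2k-1}\right\rfloor+1$. Then ${\rm ex}_{\mathcal{OP}}(n,C_k)=f(n,k)$, where $$f(n,k)=\begin{cases} 2n-\lambda+2\left\lfloor\frac{\lambda}{k}\right\rfloor-3 & \text{if } k\mid\lambda,\\[2pt] 2n-\lambda+2\left\lfloor\frac{\lambda}{k}\right\rfloor-2 & \text{otherwise.}\end{cases}$$
   Context: All graphs are finite, undirected and simple. $C_k$ denotes the cycle on $k$ vertices. A graph is $H$-free if it contains no (not necessarily induced) subgraph isomorphic to $H$. A graph is outerplanar if it can be embedded in the plane so that all vertices lie on the boundary of the outer face. The outerplanar Turán number ${\rm ex}_{\mathcal{OP}}(n,H)$ is the maximum number of edges in an $H$-free outerplanar graph on $n$ vertices. *)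

(* Defs.v *)
From HB Require Import structures.
From mathcomp Require Import all_boot all_order all_algebra.
From mathcomp Require Import all_classical all_reals all_analysis.

Set Implicit Arguments.
Unset Strict Implicit.
Unset Printing Implicit Defensive.

Import Order.TTheory GRing.Theory Num.Theory.
Import numFieldNormedType.Exports.

Local Open Scope classical_set_scope.
Local Open Scope ring_scope.

Record sgraph := SGraph {
  vertex :> finType;
  adj : rel vertex;
  adj_sym : symmetric adj;
  adj_irr : irreflexive adj }.

Definition edges (G : sgraph) : {set {set G}} :=
  [set [set p.1; p.2]%SET | p : G * G & adj p.1 p.2]%SET.

Definition num_edges (G : sgraph) : nat := #|edges G|.

Definition contains (H G : sgraph) : Prop :=
  exists f : H -> G, injective f /\ forall x y, adj x y -> adj (f x) (f y).

Definition is_free (H G : sgraph) : Prop := ~ contains H G.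

(* The conjunct i != j is redundant for k >= 2; it only keeps the relation
   irreflexive in the degenerate case k = 1. *)
Definition cycle_adj (k : nat) : rel 'I_k := fun i j =>
  (i != j) && ((j == i.+1 %% k :> nat)%N || (i == j.+1 %% k :> nat)%N).

Lemma cycle_adj_sym k : symmetric (@cycle_adj k).
Proof. by move=> i j; rewrite /cycle_adj eq_sym orbC. Qed.

Lemma cycle_adj_irr k : irreflexive (@cycle_adj k).
Proof. by move=> i; rewrite /cycle_adj eqxx. Qed.

Definition cycle_graph (k : nat) : sgraph :=
  SGraph (@cycle_adj_sym k) (@cycle_adj_irr k).

Section PlaneDrawings.
Variables (R : realType) (G : sgraph).
Variables (pos : G -> R * R) (arc : {set G} -> R -> R * R).

(* pos places the vertices in the plane, and arc e parametrizes over [0, 1]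
   the curve representing the edge e; arc e is irrelevant if e is not an edge
   of G. *)
Record plane_embedding : Prop := PlaneEmbedding {
  pos_inj : injective pos;
  arc_continuous : forall e, e \in edges G ->
    {within `[0, 1], continuous (arc e)};
  arc_inj : forall e, e \in edges G -> {in `[0, 1]%R &, injective (arc e)};
  arc_ends : forall e, e \in edges G ->
    [set arc e 0; arc e 1] = pos @` [set` e];
  arc_avoids_vertices : forall e, e \in edges G ->
    arc e @` `]0, 1[ `&` range pos = set0;
  arcs_disjoint : forall e e', e \in edges G -> e' \in edges G -> e != e' ->
    arc e @` `]0, 1[ `&` arc e' @` `]0, 1[ = set0 }.

Definition drawing : set (R * R) :=
  range pos `|` \bigcup_(e in [set` edges G]) (arc e @` `[0, 1]).

Definition face (F : set (R * R)) : Prop :=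
  exists2 p, (~` drawing) p & F = connected_component (~` drawing) p.

Definition outer_face (F : set (R * R)) : Prop := face F /\ ~ bounded_set F.

End PlaneDrawings.

Definition boundary (T : topologicalType) (A : set T) : set T :=
  closure A `\` A°.

Definition outerplanar (R : realType) (G : sgraph) : Prop :=
  exists (pos : G -> R * R) (arc : {set G} -> R -> R * R),
    plane_embedding pos arc /\
    exists2 F, outer_face pos arc F & forall x, boundary F (pos x).

(* The cut-off at 'C(n, 2) loses nothing, as a simple graph on n vertices has
   at most that many edges. *)
Definition ex_OP (R : realType) (n : nat) (H : sgraph) : nat :=
  \max_(m < 'C(n, 2).+1 | `[< exists G : sgraph,
      [/\ #|G| = n, outerplanar R G, is_free H G & num_edges G = m] >]) m.

(* These are integers, so that no subtraction is truncated; (_ %/ _)%Z is the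
   floor of the quotient for a positive divisor. *)
Definition lam (n k : nat) : int :=
  ((k%:Z * n%:Z - 2 * k%:Z - 1) %/ (k%:Z ^+ 2 - 2 * k%:Z - 1))%Z + 1.

Definition turan_value (n k : nat) : int :=
  let l := lam n k in
  if (k%:Z %| l)%Z then 2 * n%:Z - l + 2 * (l %/ k%:Z)%Z - 3
  else 2 * n%:Z - l + 2 * (l %/ k%:Z)%Z - 2.

(* Main.v *)
(* Upper bound.  Van Kampen's parity count excludes K5 and K33: for polygonal
   drawings in general position, the number of crossings of two edges uv and wz
   is congruent mod 2 to a sum of terms up(x, e),
   telling whether e passes above the endpoint x, plus the parity telling whether
   uv and wz interleave in x-order; summed over the independent pairs
   of edges of K5 or K33 the up-terms cancel while the interleavings add up to an
   odd number.  Only edges without common endpoint matter, so arcs may be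
   approximated crudely near vertices, and a point of the outer face joined to all
   vertices shows that an outerplanar graph has no K4 or K23 minor.
   Such a graph has a linear order of its vertices in which no two edges cross:
   split along components and cut vertices.
   In a noncrossing order, with lambda maximal triangulated pieces (single edges
   included) and b inner faces of length > k, the number of edges is at most
   2(n-1) + 2b - lambda, where n - 1 + b <= (k-2) lambda and k b < lambda; faces of
   length 4, ..., k-1 are absorbed into one piece together with their neighbours.
   Optimizing over lambda and b gives the formula.
   Lower bound.  Faces of length k+1 all having the vertex 0, whose other edges
   carry fans with k-2 outer edges, drawn with straight edges on the parabola
   y = x^2, the region below which lies in the outer face. *)
Require Import Defs.
From mathcomp Require Import all_boot zify.

Set Implicit Arguments.
Unset Strict Implicit.
Unset Printing Implicit Defensive.

(** * Connected vertex sets and excluded minors *)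

(** The plane enters only through polygonal chains, whose crossing parity replaces the Jordan curve
    theorem, and minors are given by branch sets, so that no graph is ever contracted. The induction
    that orders the vertices needs two coupled claims: any vertex can come first; and [a], [b] in
    [W] can be made the two ends if a connected set outside [W] is adjacent to both, since that set
    acts as an arc closing the boundary around [W]. K4 and K23 forbid parallel routes from [a] to
    [b], which yields a cut vertex to split at. In the edge count a piece with m path steps has at
    most 2m - 1 edges. A chain of edges with triangles behind them has paths of all lengths in an
    interval; if one more edge joins its ends, the interval must miss k - 1. So the chain with all
    its triangles has at most k - 2 steps, or it has at least k edges. The denominator k^2 - 2k - 1
    = k(k - 2) - 1 is the number of vertices added by one face of length k + 1 with k fans of k - 2
    steps: of these k(k - 2) steps the first, from the vertex 0, leads to a vertex already
    present. *)

Ltac nlia := intros; first [ solve [repeat match goal with H : ?P |- _ =>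
  lazymatch P with
  | is_true (leq _ _) => fail
  | is_true (andb (leq _ _) (leq _ _)) => fail
  | is_true (negb (leq _ _)) => fail
  | @eq nat _ _ => fail
  | @eq bool (leq _ _) _ => fail
  | _ => clear H
  end end; lia] | lia ].

Section Minors.
Variables (T : finType) (e : rel T).
Implicit Types X Y : {set T}.

Definition inner X := [rel u v | [&& e u v, u \in X & v \in X]].

Definition linked X := X != set0 /\ {in X &, forall x y, connect (inner X) x y}.

Definition touch X Y := [exists x in X, exists y in Y, e x y].

Lemma touchP X Y : reflect (exists x y, [/\ x \in X, y \in Y & e x y]) (touch X Y).
Proof.
apply: (iffP exists_inP) => [[x xX /exists_inP[y yY xy]]|[x [y [xX yY xy]]]].
  by exists x, y.
by exists x => //; apply/exists_inP; exists y.
Qed.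

Lemma innerS X Y : X \subset Y -> subrel (inner X) (inner Y).
Proof. by move=> /subsetP XY u v /and3P[uv /XY ux /XY vx]; apply/and3P. Qed.

Lemma connect_innerS X Y : X \subset Y -> subrel (connect (inner X)) (connect (inner Y)).
Proof.
by move=> XY; apply: connect_sub => u v uv; apply: connect1; apply: innerS uv.
Qed.

Hypothesis e_sym : symmetric e.

Lemma connect_inner_sym X : connect_sym (inner X).
Proof. by apply: sym_connect_sym => u v /=; rewrite e_sym andbCA andbC -andbA andbCA. Qed.

Lemma linkedU X Y : linked X -> linked Y -> touch X Y -> linked (X :|: Y).
Proof.
move=> [X0 Xc] [Y0 Yc] /touchP[a [b [aX bY ab]]].
have sX : X \subset X :|: Y by apply: subsetUl.
have sY : Y \subset X :|: Y by apply: subsetUr.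
split; first by apply/set0Pn; exists a; rewrite in_setU aX.
have toa x : x \in X :|: Y -> connect (inner (X :|: Y)) x a.
  rewrite in_setU => /orP[xX|xY]; first exact: connect_innerS (Xc x a xX aX).
  apply: connect_trans (connect_innerS sY (Yc x b xY bY)) _.
  by apply: connect1; rewrite /= !in_setU e_sym ab aX bY orbT.
move=> x y xU yU; apply: connect_trans (toa x xU) _.
by rewrite connect_inner_sym; apply: toa.
Qed.

Definition disj X Y := [disjoint X & Y].

Lemma disjP X Y : reflect (forall v, v \in X -> v \in Y -> False) (disj X Y).
Proof.
apply: (iffP idP) => [d v vX vY|h]; first by rewrite (disjointFr d vX) in vY.
by rewrite /disj disjoint_subset; apply/subsetP => v vX; apply/negP => /(h v vX).
Qed.

(** Position 0 of a list of branch sets is later reserved for a point of the outer face, which has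
    no branch set. *)
Lemma pairwise_disj0 s : pairwise disj (set0 :: s) = pairwise disj s.
Proof. by rewrite pairwise_cons andb_idl // => _; apply/allP => X _; apply/disjP => v; rewrite inE. Qed.

(** Positions beyond the end need no care: the default [set0] has no elements. *)
Lemma disj_nth s i j v : pairwise disj s -> i != j ->
  v \in nth set0 s i -> v \in nth set0 s j -> False.
Proof.
move=> ps; wlog ij : i j / i < j => [h|] ne vi vj.
  have [ij|ji|eij] := ltngtP i j; [exact: h vi vj|apply: h vj vi => //|].
    by rewrite eq_sym.
  by rewrite eij eqxx in ne.
have [js|sj] := ltnP j (size s); last by rewrite nth_default ?inE in vj.
have := (pairwiseP set0 ps) i j (ltn_trans ij js) js ij.
by move/disjP; apply; [exact: vi|exact: vj].
Qed.

Definition K4_free := forall A B C D,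
  [/\ linked A, linked B, linked C & linked D] -> pairwise disj [:: A; B; C; D] ->
  [/\ touch A B, touch A C & touch A D] -> [/\ touch B C, touch B D & touch C D] ->
  False.

Definition K23_free := forall A B X Y Z,
  [/\ linked A, linked B, linked X, linked Y & linked Z] ->
  pairwise disj [:: A; B; X; Y; Z] ->
  [/\ touch A X, touch A Y & touch A Z] -> [/\ touch B X, touch B Y & touch B Z] ->
  False.

End Minors.

(** * Noncrossing orders of K4- and K23-minor-free graphs *)

Section Orders.
Variables (T : finType) (e : rel T).
Hypothesis e_sym : symmetric e.
Implicit Types (X Y S W K C Z : {set T}) (r : T -> nat).

(** [r] is an injective labelling by naturals rather than an enumeration: gaps are allowed, so that
    orders can be shifted, reversed and inserted into one another. *)
Definition noncrossing S r :=
  {in S &, injective r} /\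
  (forall x y z t, x \in S -> y \in S -> z \in S -> t \in S ->
     r x < r y < r z -> r z < r t -> e x z -> e y t -> False).

Definition first_in S r a := forall x, x \in S -> x != a -> r a < r x.
Definition last_in S r b := forall x, x \in S -> x != b -> r x < r b.

Lemma noncrossing_rev S r N : noncrossing S r -> (forall x, x \in S -> r x <= N) ->
  noncrossing S (fun x => N - r x).
Proof.
move=> [inj nc] rN; split=> [x y xS yS|x y z t xS yS zS tS].
  by move: (rN _ xS) (rN _ yS) => ? ? ?; apply: inj => //; nlia.
move: (rN _ xS) (rN _ yS) (rN _ zS) (rN _ tS) => ? ? ? ? h1 h2 xz yt.
by apply: (nc t z y x) => //; rewrite 1?e_sym //; nlia.
Qed.

Lemma rank_bound S r : exists N, forall x, x \in S -> r x < N.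
Proof.
exists (\max_(x in S) r x).+1 => x xS; rewrite ltnS.
exact: (leq_bigmax_cond (P := fun x => x \in S)).
Qed.

Lemma rev_ends S r a b : noncrossing S r -> first_in S r a -> last_in S r b ->
  a \in S -> b \in S ->
  exists r', [/\ noncrossing S r', first_in S r' b & last_in S r' a].
Proof.
move=> nc fa lb aS bS; have [N hN] := rank_bound S r.
exists (fun x => N - r x); split.
- by apply: noncrossing_rev => // x /hN; nlia.
- by move=> x xS xb; move: (lb x xS xb) (hN _ xS) (hN _ bS); nlia.
- by move=> x xS xa; move: (fa x xS xa) (hN _ xS) (hN _ aS); nlia.
Qed.

(** Edges between [K] and [S] end in [b], so the order of [K] fits into the gap right after [b];
    ranks of [S] above [b] move up by [N] to make room. The last two conclusions record this place,
    from which the ends of the new order are read off. *)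
Lemma cut_glue S K b r1 r2 :
  noncrossing S r1 -> noncrossing (b |: K) r2 -> b \in S ->
  (forall x, x \in S -> x \in K -> False) -> first_in (b |: K) r2 b ->
  (forall x y, x \in K -> y \in S -> e x y -> y = b) ->
  exists r, [/\ noncrossing (S :|: K) r,
    forall x y, x \in S -> y \in S -> r1 x < r1 y -> r x < r y,
    forall x y, x \in K -> y \in S -> r1 b < r1 y -> r x < r y &
    forall x y, x \in K -> y \in S -> r1 y <= r1 b -> r y < r x].
Proof.
move=> [inj1 nc1] [inj2 nc2] bS dSK fb Kb.
have [N hN] := rank_bound (b |: K) r2.
pose r x := if x \in K then r1 b + (r2 x - r2 b)
            else if r1 x <= r1 b then r1 x else r1 x + N.
have rK x : x \in K -> r x = r1 b + (r2 x - r2 b) by rewrite /r => ->.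
have rS x : x \in S -> r x = if r1 x <= r1 b then r1 x else r1 x + N.
  by move=> xS; rewrite /r; case: ifP => // xK; case: (dSK x).
have K2 x : x \in K -> [/\ r2 b < r2 x, r2 x < N & x \in b |: K].
  move=> xK; have xbK : x \in b |: K by rewrite inE xK orbT.
  by split; [apply: fb => //; apply/eqP => xb; apply: (dSK x); rewrite ?xb // -xb|apply: hN|].
have bK : b \in b |: K by rewrite setU11.
have SS x y : x \in S -> y \in S -> r1 x < r1 y -> r x < r y.
  by move=> xS yS; rewrite !rS //; case: ifP; case: ifP; nlia.
have KS x y : x \in K -> y \in S -> r1 b < r1 y -> r x < r y.
  by move=> xK yS yb; have [? ? _] := K2 x xK; rewrite (rK x) // (rS y) //; case: ifP; nlia.
have SK x y : x \in K -> y \in S -> r1 y <= r1 b -> r y < r x.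
  by move=> xK yS yb; have [? ? _] := K2 x xK; rewrite (rK x) // (rS y) // yb; nlia.
have SSi x y : x \in S -> y \in S -> r x < r y -> r1 x < r1 y.
  by move=> xS yS; rewrite !rS //; case: ifP; case: ifP; nlia.
have KKi x y : x \in b |: K -> y \in b |: K -> r x < r y -> r2 x < r2 y.
  have rb : r b = r1 b + (r2 b - r2 b) by rewrite rS // leqnn; nlia.
  have rbK z : z \in b |: K -> r z = r1 b + (r2 z - r2 b) /\ r2 b <= r2 z.
    rewrite 2!inE => /orP[/eqP->|zK]; first by rewrite rb.
    by have [? _ _] := K2 z zK; rewrite rK //; split; nlia.
  by move=> /rbK[-> ?] /rbK[-> ?]; nlia.
have KS' x : x \in K -> x \in S -> False by move=> ? ?; apply: (dSK x).
exists r; split=> //; split.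
  move=> x y; rewrite !inE => /orP[xS|xK] /orP[yS|yK] rxy.
  - apply: inj1 => //; case: (ltngtP (r1 x) (r1 y)) => // h.
      by have := SS x y xS yS h; rewrite rxy ltnn.
    by have := SS y x yS xS h; rewrite rxy ltnn.
  - by case: (leqP (r1 x) (r1 b)) => [/(SK _ _ yK xS)|/(KS _ _ yK xS)]; rewrite rxy ltnn.
  - by case: (leqP (r1 y) (r1 b)) => [/(SK _ _ xK yS)|/(KS _ _ xK yS)]; rewrite rxy ltnn.
  - have [? _ ?] := K2 x xK; have [? _ ?] := K2 y yK.
    by apply: inj2 => //; move: rxy; rewrite !rK //; nlia.
have edge x y : x \in S :|: K -> y \in S :|: K -> e x y ->
    (x \in S /\ y \in S) \/ (x \in b |: K /\ y \in b |: K).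
  rewrite !(inE, in_setU) => /orP[xS|xK] /orP[yS|yK] xy; [by left| | |].
  - by right; rewrite (Kb y x yK xS) ?eqxx ?yK ?orbT // e_sym.
  - by right; rewrite (Kb x y xK yS) ?eqxx ?xK ?orbT.
  - by right; rewrite xK yK !orbT.
(* No vertex of [S] lies strictly between two vertices of [b |: K], so an edge of [S] cannot cross
   an edge of [b |: K]. *)
have betw x y z : x \in b |: K -> z \in b |: K -> y \in S -> r x < r y -> r y < r z -> False.
  have rb : r b = r1 b by rewrite rS // leqnn.
  move=> xb zb yS xy yz.
  have xge : r1 b <= r x.
    by move: xb; rewrite 2!inE => /orP[/eqP->|xK]; [rewrite rb|rewrite (rK x xK); lia].
  have yb : r1 b < r1 y by move: xy; rewrite (rS y yS); case: ifP; nlia.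
  move: zb; rewrite 2!inE => /orP[/eqP zE|zK]; last by have := KS z y zK yS yb; nlia.
  by have := SS b y bS yS yb; rewrite -zE; nlia.
move=> x y z t xU yU zU tU /andP[xy yz] zt xz yt.
have [[xS zS]|[xK zK]] := edge x z xU zU xz; have [[yS tS]|[yK tK]] := edge y t yU tU yt.
- by apply: (nc1 x y z t) => //; rewrite ?SSi.
- exact: betw yK tK zS yz zt.
- exact: betw xK zK yS xy yz.
- by apply: (nc2 x y z t) => //; rewrite ?KKi.
Qed.

(** The two sides of the pair [a], [b] close up to a circle: [S1] is run from [a] to [b], then [S2]
    back towards [a]. Cyclically the order of [S2] is only reflected, hence still noncrossing, and
    the circle is cut open at [a]. *)
Lemma edge_glue S1 S2 a b r1 r2 :
  noncrossing S1 r1 -> noncrossing S2 r2 ->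
  first_in S1 r1 a -> last_in S1 r1 b -> first_in S2 r2 a -> last_in S2 r2 b ->
  a != b -> a \in S1 -> b \in S1 -> a \in S2 -> b \in S2 ->
  (forall x, x \in S1 -> x \in S2 -> x = a \/ x = b) ->
  (forall x y, x \in S1 -> y \in S2 -> e x y -> x \in S2 \/ y \in S1) ->
  exists r, noncrossing (S1 :|: S2) r /\ first_in (S1 :|: S2) r a.
Proof.
move=> [inj1 nc1] [inj2 nc2] fa1 lb1 fa2 lb2 ab a1 b1 a2 b2 dis noe.
have [N hN] := rank_bound S2 r2.
pose r x := if x \in S1 then r1 x else r1 b + (N - r2 x).
have rS1 x : x \in S1 -> r x = r1 x by rewrite /r => ->.
have rS2 x : x \in S2 -> x \notin S1 -> [/\ r x = r1 b + (N - r2 x), r2 a < r2 x, r2 x < r2 b & r2 x < N].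
  move=> x2 x1; rewrite /r (negPf x1); split=> //; last exact: hN.
    by apply: fa2 => //; apply: contraNneq x1 => ->.
  by apply: lb2 => //; apply: contraNneq x1 => ->.
have le1 x : x \in S1 -> r1 a <= r1 x <= r1 b.
  move=> x1; have [->|xa] := eqVneq x a; first by rewrite leqnn ltnW // fa1 // eq_sym.
  have [->|xb] := eqVneq x b; first by rewrite leqnn ltnW // lb1.
  by apply/andP; split; apply: ltnW; [apply: fa1|apply: lb1].
have hb : r2 b < N := hN b b2.
exists r; split; first split.
- move=> x y; rewrite !inE.
  have [x1|x1] := boolP (x \in S1); have [y1|y1] := boolP (y \in S1) => /= x2 y2.
  + by rewrite !rS1 //; apply: inj1.
  + by have [-> ? ? ?] := rS2 y y2 y1; rewrite rS1 //; move: (le1 x x1); nlia.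
  + by have [-> ? ? ?] := rS2 x x2 x1; rewrite rS1 //; move: (le1 y y1); nlia.
  + have [-> ? ? ?] := rS2 x x2 x1; have [-> ? ? ?] := rS2 y y2 y1.
    by move=> ?; apply: inj2 => //; nlia.
- have edge x y : x \in S1 :|: S2 -> y \in S1 :|: S2 -> e x y ->
      (x \in S1 /\ y \in S1) \/ (x \in S2 /\ y \in S2).
    rewrite !inE => /orP[x1|x2] /orP[y1|y2] xy; [by left| | |by right].
      by case: (noe x y x1 y2 xy) => ?; [right|left].
    by rewrite e_sym in xy; case: (noe y x y1 x2 xy) => ?; [right|left].
  (* Away from [a] the new order reverses [r2] on [S2]; [a] is first in both orders. *)
  have cmp2 x y : x \in S2 -> y \in S2 -> r x < r y -> x != a -> y != a -> r2 y < r2 x.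
    move=> x2 y2 xy xa ya; have [x1|x1] := boolP (x \in S1); have [y1|y1] := boolP (y \in S1).
    + case: (dis x x1 x2) => xE; first by rewrite xE eqxx in xa.
      case: (dis y y1 y2) => yE; first by rewrite yE eqxx in ya.
      by rewrite xE yE ltnn in xy.
    + case: (dis x x1 x2) => xE; first by rewrite xE eqxx in xa.
      by have [_ ? ? ?] := rS2 y y2 y1; rewrite xE.
    + case: (dis y y1 y2) => yE; first by rewrite yE eqxx in ya.
      by have [E ? ? ?] := rS2 x x2 x1; move: xy; rewrite yE E rS1 //; nlia.
    + by have [E ? ? ?] := rS2 x x2 x1; have [E' ? ? ?] := rS2 y y2 y1; nlia.
  move=> x y z t xU yU zU tU /andP[xy yz] zt xz yt.
  have rae w : w \in S1 :|: S2 -> r a <= r w.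
    rewrite inE (rS1 a) // => /orP[w1|]; first by rewrite rS1 //; move: (le1 w w1); nlia.
    have [w1 _|w1 w2] := boolP (w \in S1); first by rewrite rS1 //; move: (le1 w w1); nlia.
    by have [-> ? ? ?] := rS2 w w2 w1; move: (le1 b b1); nlia.
  have na u w : u \in S1 :|: S2 -> r u < r w -> w != a.
    by move=> uU uw; apply/eqP => wa; move: (rae u uU); rewrite -wa; nlia.
  have ya := na x y xU xy; have za := na y z yU yz; have ta := na z t zU zt.
  have up w : w \in S1 :|: S2 -> r b < r w -> w \in S2 /\ w \notin S1.
    rewrite inE => /orP[w1|w2] bw; first by move: bw; rewrite !rS1 //; move: (le1 w w1); nlia.
    split=> //; apply/negP => w1; move: bw; rewrite !rS1 //; move: (le1 w w1); nlia.
  have [[x1 z1]|[x2 z2]] := edge x z xU zU xz; have [[y1 t1]|[y2 t2]] := edge y t yU tU yt.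
  + by apply: (nc1 x y z t) => //; rewrite -?rS1 // ?xy.
  + have [y1|y1] := boolP (y \in S1).
      case: (dis y y1 y2) => yE; first by rewrite yE eqxx in ya.
      by move: yz; rewrite yE !rS1 //; move: (le1 z z1); nlia.
    have [E ? ? ?] := rS2 y y2 y1; move: yz; rewrite E rS1 //; move: (le1 z z1); nlia.
  + have [z1|z1] := boolP (z \in S1).
      case: (dis z z1 z2) => zE; first by rewrite zE eqxx in za.
      by move: zt; rewrite zE !rS1 //; move: (le1 t t1); nlia.
    by have [E ? ? ?] := rS2 z z2 z1; move: zt; rewrite E rS1 //; move: (le1 t t1); nlia.
  + have zy := cmp2 y z y2 z2 yz ya za; have tz := cmp2 z t z2 t2 zt za ta.
    have [xa|xa] := eqVneq x a.
      apply: (nc2 a t z y) => //; rewrite ?tz ?zy ?andbT //.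
      - exact: fa2.
      - by rewrite -xa.
      - by rewrite e_sym.
    have yx := cmp2 x y x2 y2 xy xa ya.
    by apply: (nc2 t z y x) => //; rewrite ?tz // e_sym.
- move=> x; rewrite inE; have [x1 _ xa|x1 /= x2 _] := boolP (x \in S1).
    by rewrite !rS1 //; apply: fa1.
  have [-> ? ? ?] := rS2 x x2 x1; rewrite rS1 //; move: (le1 b b1); nlia.
Qed.

(** Concatenation at the common vertex [c]. The only edge that may join the two parts away from [c]
    is [ab], which spans everything and so crosses nothing. *)
Lemma path_glue S1 S2 a b c r1 r2 :
  noncrossing S1 r1 -> noncrossing S2 r2 ->
  first_in S1 r1 a -> last_in S1 r1 c -> first_in S2 r2 c -> last_in S2 r2 b ->
  a \in S1 -> c \in S1 -> c \in S2 -> b \in S2 -> a != c -> b != c ->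
  (forall x, x \in S1 -> x \in S2 -> x = c) ->
  (forall x y, x \in S1 -> y \in S2 -> e x y -> [\/ x = c, y = c | x = a /\ y = b]) ->
  exists r, [/\ noncrossing (S1 :|: S2) r, first_in (S1 :|: S2) r a
    & last_in (S1 :|: S2) r b].
Proof.
move=> [inj1 nc1] [inj2 nc2] fa lc fc lb a1 c1 c2 b2 ac bc dis noe.
pose r x := if x \in S1 then r1 x else r1 c + (r2 x - r2 c).
have rS1 x : x \in S1 -> r x = r1 x by rewrite /r => ->.
have rS2 x : x \in S2 -> r x = r1 c + (r2 x - r2 c).
  by move=> x2; rewrite /r; case: ifP => // x1; rewrite (dis x x1 x2); nlia.
have le1 x : x \in S1 -> r1 a <= r1 x <= r1 c.
  move=> x1; have [->|xa] := eqVneq x a; first by rewrite leqnn ltnW // lc.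
  have [->|xc] := eqVneq x c; first by rewrite leqnn ltnW // lc.
  by apply/andP; split; apply: ltnW; [apply: fa|apply: lc].
have le2 x : x \in S2 -> r2 c <= r2 x <= r2 b.
  move=> x2; have [->|xc] := eqVneq x c; first by rewrite leqnn ltnW // lb // eq_sym.
  have [->|xb] := eqVneq x b; first by rewrite leqnn ltnW // lb // eq_sym.
  by apply/andP; split; apply: ltnW; [apply: fc|apply: lb].
have cmp1 x y : x \in S1 -> y \in S1 -> r x < r y -> r1 x < r1 y.
  by move=> x1 y1; rewrite !rS1.
have cmp2 x y : x \in S2 -> y \in S2 -> r x < r y -> r2 x < r2 y.
  by move=> x2 y2; rewrite !rS2 //; move: (le2 x x2) (le2 y y2); nlia.
have ra x : x \in S1 :|: S2 -> r a <= r x.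
  rewrite inE (rS1 a) // => /orP[x1|x2]; first by rewrite rS1 //; move: (le1 x x1); nlia.
  by rewrite rS2 //; move: (le1 c c1); nlia.
have rb x : x \in S1 :|: S2 -> r x <= r b.
  rewrite inE (rS2 b) // => /orP[x1|x2]; first by rewrite rS1 //; move: (le1 x x1); nlia.
  by rewrite rS2 //; move: (le2 x x2); nlia.
have rinj : {in S1 :|: S2 &, injective r}.
  move=> x y; rewrite !inE => /orP[x1|x2] /orP[y1|y2] rxy.
  + by apply: inj1; rewrite // -!rS1.
  + have yc : y = c.
      apply/eqP; apply: contraT => yc; move: (fc y y2 yc) rxy.
      by rewrite rS1 // rS2 //; move: (le1 x x1); nlia.
    by rewrite yc in y2 rxy *; apply: inj1; rewrite // -!rS1.
  + have xc : x = c.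
      apply/eqP; apply: contraT => xc; move: (fc x x2 xc) rxy.
      by rewrite rS2 // rS1 //; move: (le1 y y1); nlia.
    by rewrite xc in x2 rxy *; apply: inj1; rewrite // -!rS1.
  + by apply: inj2 => //; move: rxy; rewrite !rS2 //; move: (le2 x x2) (le2 y y2); nlia.
have aU : a \in S1 :|: S2 by rewrite inE a1.
have bU : b \in S1 :|: S2 by rewrite inE b2 orbT.
exists r; split; first split=> //.
- have edge x y : x \in S1 :|: S2 -> y \in S1 :|: S2 -> e x y ->
      [\/ x \in S1 /\ y \in S1, x \in S2 /\ y \in S2, x = a /\ y = b | x = b /\ y = a].
    rewrite !inE => /orP[x1|x2] /orP[y1|y2] xy; [by constructor 1| | |by constructor 2].
      by case: (noe x y x1 y2 xy) => [->|->|[-> ->]]; [constructor 2|constructor 1|constructor 3].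
    rewrite e_sym in xy.
    by case: (noe y x y1 x2 xy) => [->|->|[-> ->]]; [constructor 2|constructor 1|constructor 4].
  move=> x y z t xU yU zU tU /andP[xy yz] zt xz yt.
  have [[x1 z1]|[x2 z2]|[xa zb]|[xb za]] := edge x z xU zU xz.
  + have [[y1 t1]|[y2 t2]|[ya tb]|[yb ta]] := edge y t yU tU yt.
    * by apply: (nc1 x y z t) => //; rewrite ?cmp1.
    * by move: yz; rewrite rS2 // rS1 //; move: (le1 z z1); nlia.
    * by move: (ra x xU); rewrite -ya; nlia.
    * by move: (ra x xU); rewrite -ta; nlia.
  + have [[y1 t1]|[y2 t2]|[ya tb]|[yb ta]] := edge y t yU tU yt.
    * by move: zt; rewrite rS2 // rS1 //; move: (le1 t t1); nlia.
    * by apply: (nc2 x y z t) => //; rewrite ?cmp2.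
    * by move: (ra x xU); rewrite -ya; nlia.
    * by move: (ra x xU); rewrite -ta; nlia.
  + by move: (rb t tU); rewrite -zb; nlia.
  + by move: (ra x xU); rewrite -za; nlia.
- move=> x xU xa; rewrite ltn_neqAle ra // andbT; apply: contra_neq xa => h.
  by apply: rinj.
- move=> x xU xb; rewrite ltn_neqAle rb // andbT; apply: contra_neq xb => h.
  by apply: rinj.
Qed.
End Orders.

(** * Components of induced subgraphs and a separating neighbour *)

Section Outerplane.
Variables (T : finType) (e : rel T).
Hypothesis e_sym : symmetric e.
Implicit Types (X Y S W K C Z : {set T}) (r : T -> nat).
Notation linked := (linked e).
Notation touch := (touch e).

Lemma linked1 a : linked [set a].
Proof.
split; first by apply/set0Pn; exists a; rewrite set11.
by move=> x y /set1P-> /set1P->; apply: connect0.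
Qed.

Lemma touchC X Y : touch X Y = touch Y X.
Proof. by apply/touchP/touchP => -[x [y [? ? xy]]]; exists y, x; rewrite e_sym. Qed.

Lemma touch1P a X : reflect (exists2 x, x \in X & e a x) (touch [set a] X).
Proof.
apply: (iffP (touchP _ _ _)) => [[x [y [/set1P-> yX xy]]]|[x xX ax]]; first by exists y.
by exists a, x; rewrite set11.
Qed.

Lemma touchS X Y X' Y' : X \subset X' -> Y \subset Y' -> touch X Y -> touch X' Y'.
Proof.
move=> /subsetP XX /subsetP YY /touchP[x [y [/XX ? /YY ? ?]]].
by apply/touchP; exists x, y.
Qed.

Definition comp X x := [set y in X | connect (inner e X) x y].

Lemma compP X x y : y \in comp X x = (y \in X) && connect (inner e X) x y.
Proof. by rewrite inE. Qed.

Lemma comp_sub X x : comp X x \subset X.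
Proof. by apply/subsetP => y; rewrite compP => /andP[]. Qed.

Lemma comp_refl X x : x \in X -> x \in comp X x.
Proof. by move=> xX; rewrite compP xX connect0. Qed.

Lemma comp_closed X x y z : y \in comp X x -> z \in X -> e y z -> z \in comp X x.
Proof.
rewrite !compP => /andP[yX xy] zX yz; rewrite zX; apply: connect_trans xy _.
by apply: connect1; rewrite /= yz yX.
Qed.

Lemma linked_closed X S x : linked X -> x \in X -> x \in S ->
  (forall y z, y \in S -> y \in X -> z \in X -> e y z -> z \in S) -> X \subset S.
Proof.
move=> [_ lX] xX xS clS; apply/subsetP => y yX.
have /connectP[p pp ->] := lX x y xX yX; elim: p x xX xS pp => //= z p IH x xX xS.
by move=> /andP[/and3P[xz _ zX]]; apply: IH => //; apply: clS xz.
Qed.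

Lemma comp_linked X x : x \in X -> linked (comp X x).
Proof.
move=> xX; split; first by apply/set0Pn; exists x; apply: comp_refl.
suff h y : y \in comp X x -> connect (inner e (comp X x)) x y.
  move=> y z /h xy /h; apply: connect_trans.
  by rewrite (connect_inner_sym e_sym).
rewrite compP => /andP[_ /connectP[p pp ->]].
elim: p x xX pp => [|z p IH] x xX /=; first by rewrite connect0.
move=> /andP[xz zp]; have /and3P[exz _ zX] := xz.
have zx : z \in comp X x by rewrite compP zX connect1.
have sub : comp X z \subset comp X x.
  apply/subsetP => w; rewrite !compP => /andP[-> zw] /=.
  by apply: connect_trans zw; apply: connect1.
apply: connect_trans (connect_innerS sub (IH z zX zp)).
by apply: connect1; rewrite /= exz comp_refl.
Qed.

Lemma linked_in_comp X Y x : linked Y -> Y \subset X -> x \in Y -> Y \subset comp X x.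
Proof.
move=> lY YX xY; have xX := subsetP YX x xY.
apply: (linked_closed lY xY (comp_refl xX)) => y z yx yY zY.
exact/comp_closed/(subsetP YX).
Qed.

Lemma comp_eq X x y : y \in comp X x -> comp X y = comp X x.
Proof.
rewrite compP => /andP[yX xy]; apply/setP => z; rewrite !compP; case: (z \in X) => //=.
apply/idP/idP; first exact: connect_trans.
by apply: connect_trans; rewrite (connect_inner_sym e_sym).
Qed.

Lemma comp_disj X x y : x \in X -> y \in X -> y \notin comp X x -> disj (comp X x) (comp X y).
Proof.
move=> xX yX yx; apply/disjP => v /comp_eq ex /comp_eq ey.
by move: yx; rewrite -ex ey comp_refl.
Qed.

(** Otherwise the component would be closed under the edges of [X] and, [X] being connected, would
    contain [c]. *)
Lemma comp_touch X c x : linked X -> c \in X -> x \in X -> x != c ->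
  touch [set c] (comp (X :\ c) x).
Proof.
move=> lX cX xX xc; apply: contraT => /touch1P nt.
have xXc : x \in X :\ c by rewrite !inE xc.
suff /subsetP/(_ c cX) : X \subset comp (X :\ c) x by rewrite compP !inE eqxx.
apply: (linked_closed lX xX); first exact: comp_refl.
move=> y z yx yX zX yz; have [zc|zc] := eqVneq z c.
  by case: nt; exists y; rewrite // -zc e_sym.
by apply: comp_closed yx _ yz; rewrite !inE zc.
Qed.

Hypothesis K23f : K23_free e.

(** If every neighbour [c] of [a] in [C] left a component touching both [a] and [b], take such a
    component [Y] of least size. A neighbour [c'] of [a] in [Y] has such a component [Y'] too, and
    the position of [Y'] gives a smaller choice, two sets forbidden by [NX], or a K23 minor. [Z]
    stands for a detour from [a] to [b] outside [C] and may be empty when [ab] is an edge. *)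
Lemma cut_vertex C a b Z : linked C -> a \notin C -> b \notin C -> a != b ->
  (forall v, v \in Z -> v \in C -> False) -> a \notin Z ->
  linked (b |: Z) -> touch [set a] (b |: Z) ->
  (forall X1 X2, linked X1 -> linked X2 -> X1 \subset C -> X2 \subset C ->
     disj X1 X2 -> touch X1 X2 -> touch [set a] X1 -> touch [set b] X1 ->
     touch [set a] X2 -> touch [set b] X2 -> False) ->
  touch [set a] C ->
  exists c, [/\ c \in C, e a c & forall y, y \in C :\ c ->
    touch [set a] (comp (C :\ c) y) -> touch [set b] (comp (C :\ c) y) -> False].
Proof.
move=> lC aC bC ab dZC aZ lbZ abZ NX /touch1P[c0 c0C ac0].
pose bad c y := [&& y \in C :\ c, touch [set a] (comp (C :\ c) y) & touch [set b] (comp (C :\ c) y)].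
case: (boolP [exists c in C, e a c && [forall y, ~~ bad c y]]).
  case/exists_inP => c cC /andP[ac /forallP h]; exists c; split=> // y yC ta tb.
  by move: (h y); rewrite /bad yC ta tb.
move=> allbad; exfalso.
have getbad c : c \in C -> e a c -> exists y, bad c y.
  move=> cC ac; apply/existsP; apply: contraNT allbad => /existsPn h.
  by apply/exists_inP; exists c => //; rewrite ac; apply/forallP.
suff claim n c y : c \in C -> e a c -> bad c y -> #|comp (C :\ c) y| < n -> False.
  by have [y by'] := getbad c0 c0C ac0; apply: claim by' (ltnSn _).
elim: n c y => // n IH c y cC ac /and3P[yCc tay tby] szY.
set Y := comp (C :\ c) y in tay tby szY.
have lY : linked Y := comp_linked yCc.
have YC : Y \subset C by apply: subset_trans (comp_sub _ _) (subsetDl _ _).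
have cY : c \notin Y by rewrite /Y compP !inE eqxx.
have yC : y \in C by move: yCc; rewrite !inE => /andP[].
have yc : y != c by move: yCc; rewrite !inE => /andP[].
have tcY : touch [set c] Y := comp_touch lC cC yC yc.
(* [D] reaches [a] through [c], so next to [Y] it would be a second, touching route from [a] to
   [b]. *)
have noX D : linked D -> D \subset C -> c \in D -> disj D Y -> touch [set b] D -> False.
  move=> lD DC cD dDY tbD; apply: (NX D Y) => //.
    by apply: touchS tcY; rewrite ?sub1set.
  by apply/touch1P; exists c.
have [c' c'Y ac'] : exists2 c', c' \in Y & e a c' by apply/touch1P.
have c'C : c' \in C := subsetP YC c' c'Y.
have [y' bady'] := getbad c' c'C ac'; have /and3P[y'Cc' tay' tby'] := bady'.
set Y' := comp (C :\ c') y' in tay' tby'.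
have lY' : linked Y' := comp_linked y'Cc'.
have Y'C : Y' \subset C by apply: subset_trans (comp_sub _ _) (subsetDl _ _).
have c'Y' : c' \notin Y' by rewrite /Y' compP !inE eqxx.
(* If [c] is not in [Y'], then [Y'] lies in one component of [C :\ c]: inside [Y] it contradicts
   minimality, inside another one it makes a second route through [c]. *)
have [cY'|cY'] := boolP (c \in Y'); last first.
  have Y'Cc : Y' \subset C :\ c by rewrite subsetD1 Y'C.
  have y'Y' : y' \in Y' by apply: comp_refl.
  have sub := linked_in_comp lY' Y'Cc y'Y'.
  have [y'Y|y'Y] := boolP (y' \in Y).
    apply: (IH c' y') => //; apply: leq_trans (_ : #|Y| <= n) => //.
    apply: proper_card; apply/properP; split; last by exists c'.
    by rewrite (comp_eq y'Y) in sub.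
  have y'Cc := subsetP Y'Cc y' y'Y'.
  have dYY' : disj Y Y' .
    apply/disjP => v vY /(subsetP sub) vY'.
    by have /disjP/(_ v vY vY') := comp_disj yCc y'Cc y'Y.
  have y'c : y' != c by move: y'Cc; rewrite !inE => /andP[].
  pose D := comp (C :\ c) y'.
  have tcD : touch [set c] D by apply: comp_touch => //; apply: (subsetP Y'C).
  have lD : linked (c |: D) by apply: linkedU => //; [exact: linked1|exact: comp_linked].
  have DC : D \subset C by apply: subset_trans (comp_sub _ _) (subsetDl _ _).
  apply: (noX (c |: D)) => //; rewrite ?setU11 ?subUset ?sub1set ?cC //.
    apply/disjP => v; rewrite 2!inE => /orP[/eqP->|vD] vY; first by rewrite vY in cY.
    by have /disjP/(_ v vY vD) := comp_disj yCc y'Cc y'Y.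
  apply: touchS tby' => //; apply: subset_trans sub _; exact: subsetUr.
have [d dY' bd] : exists2 d, d \in Y' & e b d by apply/touch1P.
have dC := subsetP Y'C d dY'.
have [dc|dc] := eqVneq d c.
  apply: (noX [set c]); rewrite ?sub1set ?set11 //; first exact: linked1.
    by apply/disjP => v /set1P->; rewrite (negPf cY).
  by apply/touch1P; exists c; rewrite ?set11 // -dc.
have dCc : d \in C :\ c by rewrite !inE dc.
have [dY|dY] := boolP (d \in Y); last first.
  pose D := comp (C :\ c) d.
  have tcD : touch [set c] D by apply: comp_touch.
  have lD : linked (c |: D) by apply: linkedU => //; [exact: linked1|exact: comp_linked].
  have DC : D \subset C by apply: subset_trans (comp_sub _ _) (subsetDl _ _).
  apply: (noX (c |: D)) => //; rewrite ?setU11 ?subUset ?sub1set ?cC //.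
    apply/disjP => v; rewrite 2!inE => /orP[/eqP->|vD] vY; first by rewrite vY in cY.
    by have /disjP/(_ v vY vD) := comp_disj yCc dCc dY.
  by apply/touch1P; exists d; rewrite // inE comp_refl ?orbT.
have dc' : d != c' by apply: contraNneq c'Y' => <-.
have dYc' : d \in Y :\ c' by rewrite in_setD1 dc'.
(* A walk in [Y'] from [d] to [c] avoids [c'], so the part [Y0] of [Y] around [d] still reaches [c].
   With [a] it forms the side of two of a K23; [c], [c'] and [b |: Z] form the other side. *)
pose Y0 := comp (Y :\ c') d.
have Y0Y : Y0 \subset Y by apply: subset_trans (comp_sub _ _) (subsetDl _ _).
have c'Y0 : c' \notin Y0 by rewrite /Y0 compP !inE eqxx.
have tcY0 : touch [set c] Y0.
  apply: contraT => /touch1P nt.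
  suff /subsetP/(_ c cY')/(subsetP Y0Y) : Y' \subset Y0 by rewrite (negPf cY).
  apply: (linked_closed lY' dY'); first exact: comp_refl.
  move=> u v uY0 uY' vY' uv.
  have vc : v != c.
    by apply/eqP => vc; case: nt; exists u; rewrite // e_sym -vc.
  have vc' : v != c' by apply: contraNneq c'Y' => <-.
  apply: (comp_closed uY0 _ uv); rewrite in_setD1 vc' /=.
  apply: (comp_closed (subsetP Y0Y u uY0) _ uv).
  by rewrite in_setD1 vc (subsetP Y'C).
have aN S : S \subset C -> a \notin S by move=> /subsetP SC; apply: contra aC; apply: SC.
have bN S : S \subset C -> b \notin S by move=> /subsetP SC; apply: contra bC; apply: SC.
have ZN S v : S \subset C -> v \in S -> v \in Z -> False.
  by move=> /subsetP SC /SC vC vZ; apply: dZC vC.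
have Y0C := subset_trans Y0Y YC.
apply: (K23f (A := [set a]) (B := Y0) (X := [set c]) (Y := [set c']) (Z := b |: Z)).
- by split=> //; [exact: linked1|exact: comp_linked|exact: linked1|exact: linked1].
- rewrite /= !andbT; apply/and4P; split; first apply/and4P; first split.
  + by apply/disjP => v /set1P->; rewrite (negPf (aN _ Y0C)).
  + by apply/disjP => v /set1P-> /set1P ac1; rewrite ac1 cC in aC.
  + by apply/disjP => v /set1P-> /set1P ac1; rewrite ac1 c'C in aC.
  + by apply/disjP => v /set1P->; rewrite !inE (negPf ab) (negPf aZ).
  + apply/and3P; split.
    * by apply/disjP => v /(subsetP Y0Y) vY /set1P vc; rewrite -vc vY in cY.
    * by apply/disjP => v vY /set1P vc; rewrite -vc vY in c'Y0.
    * apply/disjP => v vY; rewrite !inE => /orP[/eqP vb|]; last exact: ZN vY.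
      by move: (bN _ Y0C); rewrite -vb vY.
  + apply/andP; split.
    * by apply/disjP => v /set1P-> /set1P cc'; rewrite cc' c'Y in cY.
    * apply/disjP => v /set1P->; rewrite !inE => /orP[/eqP vb|]; last by move=> h; apply: dZC h cC.
      by rewrite -vb cC in bC.
  + apply/disjP => v /set1P->; rewrite !inE => /orP[/eqP vb|]; last by move=> h; apply: dZC h c'C.
    by rewrite -vb c'C in bC.
- by split=> //; apply/touch1P; [exists c|exists c']; rewrite ?set11.
- split; first by rewrite touchC.
    by rewrite touchC; apply: comp_touch.
  by apply/touchP; exists d, b; rewrite setU11 e_sym comp_refl.
Qed.

End Outerplane.

(** * Existence of a noncrossing order *)

Section OuterplaneOrder.
Variables (T : finType) (e : rel T).
Hypothesis e_sym : symmetric e.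
Implicit Types (X Y S W K C Z : {set T}) (r : T -> nat).
Notation linked := (linked e).
Notation touch := (touch e).
Notation comp := (comp e).
Notation noncrossing := (noncrossing e).
Hypotheses (K4f : K4_free e) (K23f : K23_free e).

Definition outside W a b Z :=
  [/\ linked Z, forall v, v \in Z -> v \in W -> False,
      touch [set a] Z & touch [set b] Z].

Definition spans W a b :=
  exists r, [/\ noncrossing W r, first_in W r a & last_in W r b].

(** The cut vertex [c] splits the order into a stretch from [a] to [c], with the components of
    [C :\ c] that touch [a], and a stretch from [c] to [b] with the others. No component touches
    both [a] and [b], so away from [c] only the edge [ab] can join the stretches. *)
Lemma split_step C a b Z :
  linked C -> a \notin C -> b \notin C -> a != b ->
  (forall v, v \in Z -> v \in C -> False) -> a \notin Z -> b \notin Z ->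
  linked (b |: Z) -> linked (a |: Z) ->
  touch [set a] (b |: Z) -> touch [set b] (a |: Z) ->
  (forall X1 X2, linked X1 -> linked X2 -> X1 \subset C -> X2 \subset C ->
     disj X1 X2 -> touch X1 X2 -> touch [set a] X1 -> touch [set b] X1 ->
     touch [set a] X2 -> touch [set b] X2 -> False) ->
  touch [set a] C -> touch [set b] C ->
  (forall W a' b' Z', #|W| < #|a |: (b |: C)| -> a' \in W -> b' \in W -> a' != b' ->
     outside W a' b' Z' -> spans W a' b') ->
  spans (a |: (b |: C)) a b.
Proof.
move=> lC aC bC ab dZC aZ bZ lbZ laZ abZ baZ NX taC tbC IH.
have [c [cC ac hc]] := cut_vertex e_sym K23f lC aC bC ab dZC aZ lbZ abZ NX taC.
pose L := [set y in C :\ c | touch [set a] (comp (C :\ c) y)].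
pose R := (C :\ c) :\: L.
have LE y : y \in L = [&& y != c, y \in C & touch [set a] (comp (C :\ c) y)].
  by rewrite inE in_setD1 andbA.
have RE y : y \in R = [&& y \notin L, y != c & y \in C] by rewrite in_setD in_setD1.
have ca : c != a by apply: contraNneq aC => <-.
have cb : c != b by apply: contraNneq bC => <-.
have cL : c \notin L by rewrite LE eqxx.
have cR : c \notin R by rewrite RE eqxx andbF.
have LC y : y \in L -> y \in C by rewrite LE => /and3P[].
have RC y : y \in R -> y \in C by rewrite RE => /and3P[].
have aL : a \notin L by apply: contra aC; apply: LC.
have aR : a \notin R by apply: contra aC; apply: RC.
have bL : b \notin L by apply: contra bC; apply: LC.
have bR : b \notin R by apply: contra bC; apply: RC.
pose W1 := a |: (c |: L); pose W2 := c |: (b |: R).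
have W1E y : y \in W1 = [|| y == a, y == c | y \in L] by rewrite !in_setU1.
have W2E y : y \in W2 = [|| y == c, y == b | y \in R] by rewrite !in_setU1.
have bW1 : b \notin W1 by rewrite W1E eq_sym (negPf ab) eq_sym (negPf cb).
have aW2 : a \notin W2 by rewrite W2E eq_sym (negPf ca) (negPf ab).
have WU : W1 :|: W2 = a |: (b |: C).
  apply/setP => y; rewrite in_setU W1E W2E !in_setU1 RE.
  have [->|yc] := eqVneq y c; first by rewrite cC !orbT.
  rewrite /= orbCA; case: (y == a) => //=; case: (y == b); rewrite ?orbT //=.
  by have [/LC->|] := boolP (y \in L).
have sub1 : #|W1| < #|a |: (b |: C)|.
  apply: proper_card; apply/properP; split; first by rewrite -WU subsetUl.
  by exists b; rewrite // !inE eqxx orbT.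
have sub2 : #|W2| < #|a |: (b |: C)|.
  apply: proper_card; apply/properP; split; first by rewrite -WU subsetUr.
  by exists a; rewrite // !inE eqxx.
have ZW1 v : v \in Z -> v \in W1 -> False.
  move=> vZ; rewrite W1E => /or3P[/eqP va|/eqP vc|/LC]; last exact: dZC.
    by rewrite -va vZ in aZ.
  by apply: (dZC v vZ); rewrite vc.
have ZW2 v : v \in Z -> v \in W2 -> False.
  move=> vZ; rewrite W2E => /or3P[/eqP vc|/eqP vb|/RC]; last exact: dZC.
    by apply: (dZC v vZ); rewrite vc.
  by rewrite -vb vZ in bZ.
have [r1 [nc1 f1 l1]] : spans W1 a c.
  (* The detour for the first stretch leads from [a] by [b |: Z] to [c], directly or through the
     component [D] of a neighbour [d] of [b]; [D] does not touch [a], hence misses [L]. *)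
  have [Z1 o1] : exists Z1, outside W1 a c Z1.
    have [d dC bd] : exists2 d, d \in C & e b d by apply/touch1P.
    have [dc|dc] := eqVneq d c.
      exists (b |: Z); split=> //.
        by move=> v; rewrite in_setU1 => /orP[/eqP->|/ZW1//]; rewrite (negPf bW1).
      by apply/touch1P; exists b; rewrite ?setU11 // -dc e_sym.
    have dCc : d \in C :\ c by rewrite in_setD1 dc.
    pose D := comp (C :\ c) d.
    have lD : linked D by apply: comp_linked.
    have dD : d \in D by apply: comp_refl.
    exists ((b |: Z) :|: D); split.
    - apply: linkedU => //; apply/touchP; exists b, d; split=> //; exact: setU11.
    - move=> v; rewrite in_setU in_setU1 => /orP[/orP[/eqP->|/ZW1//]|vD].
        by rewrite (negPf bW1).
      have := subsetP (comp_sub _ _ _) v vD; rewrite in_setD1 => /andP[vc vC].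
      rewrite W1E (negPf vc) /= => /orP[/eqP va|]; first by rewrite -va vC in aC.
      rewrite LE (comp_eq e_sym vD) => /and3P[_ _ tav].
      by apply: (hc d dCc) => //; apply/touch1P; exists d.
    - by apply: touchS abZ => //; apply: subsetUl.
    - apply: touchS (comp_touch e_sym lC cC dC dc) => //; exact: subsetUr.
  apply: (IH W1 a c Z1) => //; rewrite ?W1E ?eqxx ?orbT //.
  by rewrite eq_sym.
have [r2 [nc2 f2 l2]] : spans W2 c b.
  (* Here [a |: Z] is the detour, since [a] is adjacent to [c]. *)
  apply: (IH W2 c b (a |: Z)) => //; rewrite ?W2E ?eqxx ?orbT //; split=> //.
    by move=> v; rewrite in_setU1 => /orP[/eqP->|/ZW2//]; rewrite (negPf aW2).
  by apply/touch1P; exists a; rewrite ?setU11 // e_sym.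
rewrite -WU.
apply: (path_glue e_sym nc1 nc2 f1 l1 f2 l2); rewrite ?W1E ?W2E ?eqxx ?orbT //.
- by rewrite eq_sym.
- by rewrite eq_sym.
- move=> x; rewrite W1E W2E => /or3P[/eqP->|/eqP//|xL].
    by rewrite eq_sym (negPf ca) (negPf ab) (negPf aR).
  move=> /or3P[/eqP//|/eqP xb|]; first by rewrite -xb xL in bL.
  by rewrite RE xL.
- move=> x y; rewrite W1E W2E => /or3P[/eqP->|/eqP->|xL]; [|by constructor 1|].
    move=> /or3P[/eqP->|/eqP->|yR] ay; [by constructor 2|by constructor 3|].
    move: yR; rewrite RE LE => /and3P[nL yc yC]; exfalso; move/negP: nL; apply.
    rewrite yc yC; apply/touch1P; exists y => //.
    by apply: comp_refl; rewrite in_setD1 yc.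
  move: (xL); rewrite LE => /and3P[xc xC tax].
  have xCc : x \in C :\ c by rewrite in_setD1 xc.
  move=> /or3P[/eqP->|/eqP->|yR] xy; first by constructor 2.
    exfalso; apply: (hc x xCc tax); apply/touch1P; exists x; last by rewrite e_sym.
    exact: comp_refl.
  exfalso; move: yR; rewrite RE LE => /and3P[nL yc yC]; move/negP: nL; apply.
  have yx : y \in comp (C :\ c) x.
    by apply: (comp_closed (comp_refl e xCc) _ xy); rewrite in_setD1 yc.
  by rewrite yc yC (comp_eq e_sym yx).
Qed.

Lemma spans2 a b : a != b -> spans [set a; b] a b.
Proof.
move=> ab; exists (fun x => (x == b) : nat); split.
- split=> [x y|x y z t].
    by rewrite !inE => /orP[]/eqP-> /orP[]/eqP->; rewrite ?eqxx ?(negPf ab).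
  by case: (x == b); case: (y == b); case: (z == b); case: (t == b).
- by move=> x; rewrite !inE => /orP[]/eqP->; rewrite ?eqxx ?(negPf ab).
- by move=> x; rewrite !inE => /orP[]/eqP->; rewrite ?eqxx ?(negPf ab).
Qed.

Lemma spans_sym W a b : a \in W -> b \in W -> spans W a b -> spans W b a.
Proof. by move=> aW bW [r [nc f l]]; apply: (rev_ends e_sym nc f l). Qed.

Definition rooted S a := exists r, noncrossing S r /\ first_in S r a.

(** A component that hangs on a single vertex is glued there. If all components reach both [a] and
    [b], a single one is split at a cut vertex; several serve each other as detours, or form a K23
    minor with a detour that is already given. *)
Lemma order_exists n :
  (forall S a, #|S| < n -> a \in S -> rooted S a) /\
  (forall W a b Z, #|W| < n -> a \in W -> b \in W -> a != b -> outside W a b Z ->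
     spans W a b).
Proof.
elim: n => [|n [IHU IHR]]; first by split.
have glue W a b Z K : #|W| < n.+1 -> a \in W -> b \in W -> a != b -> outside W a b Z ->
    K \subset W :\ a :\ b -> K != set0 ->
    (forall x y, x \in K -> y \in W -> e x y -> y \in a |: K) -> spans W a b.
  move=> Wn aW bW ab [lZ dZ ta tb] KW K0 hK.
  have KW' x : x \in K -> [/\ x \in W, x != a & x != b].
    by move=> /(subsetP KW); rewrite !in_setD1 => /and3P[].
  have aK : a \notin K by apply/negP => /KW'[_]; rewrite eqxx.
  have bK : b \notin K by apply/negP => /KW'[_ _]; rewrite eqxx.
  have WE : W = (W :\: K) :|: K.
    apply/setP => x; rewrite in_setU in_setD; case: (boolP (x \in K)) => [/KW'[->]//|].
    by rewrite orbF.
  have [k kK] := set0Pn _ K0.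
  have card1 : #|W :\: K| < n.
    rewrite -ltnS; apply: leq_trans Wn; rewrite ltnS; apply: proper_card.
    by apply/properP; split; [apply: subsetDl|exists k; [case: (KW' k kK)|rewrite in_setD kK]].
  have card2 : #|a |: K| < n.
    rewrite -ltnS; apply: leq_trans Wn; rewrite ltnS; apply: proper_card.
    apply/properP; split; last by exists b; rewrite // in_setU1 eq_sym (negPf ab).
    by apply/subsetP => x; rewrite in_setU1 => /orP[/eqP->//|/KW'[]].
  have aW' : a \in W :\: K by rewrite in_setD aK.
  have bW' : b \in W :\: K by rewrite in_setD bK.
  have [r1 [nc1 f1 l1]] : spans (W :\: K) a b.
    apply: (IHR _ a b Z) => //; split=> // v vZ; rewrite in_setD => /andP[_].
    exact: dZ.
  have [r2 [nc2 f2]] := IHU _ a card2 (setU11 a K).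
  have dis x : x \in W :\: K -> x \in K -> False by rewrite in_setD => /andP[/negP].
  have hKa x y : x \in K -> y \in W :\: K -> e x y -> y = a.
    rewrite in_setD => xK /andP[yK yW] /(hK x y xK yW).
    by rewrite in_setU1 (negPf yK) orbF => /eqP.
  have [r [nc SS KS SK]] := cut_glue e_sym nc1 nc2 aW' dis f2 hKa.
  exists r; rewrite WE; split=> // x; rewrite in_setU => /orP[xS|xK] xa.
  - by apply: SS => //; apply: f1.
  - exact: SK.
  - by apply: SS => //; apply: l1.
  - by apply: KS => //; apply: f1 => //; rewrite eq_sym.
have glueU S a b K : #|S| < n.+1 -> a \in S -> b \in S -> a \notin K -> b \notin K ->
    K \subset S -> K != set0 -> (exists2 x, x \in S & x \notin b |: K) ->
    (forall x y, x \in K -> y \in S -> e x y -> y \in b |: K) -> rooted S a.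
  move=> Sn aS bS aK bK KS K0 [s sS sbK] hK.
  have SE : S = (S :\: K) :|: K.
    apply/setP => x; rewrite in_setU in_setD.
    by case: (boolP (x \in K)) => [/(subsetP KS)->//|]; rewrite orbF.
  have [k kK] := set0Pn _ K0.
  have card1 : #|S :\: K| < n.
    rewrite -ltnS; apply: leq_trans Sn; rewrite ltnS; apply: proper_card.
    by apply/properP; split; [apply: subsetDl|exists k; [apply: (subsetP KS)|rewrite in_setD kK]].
  have card2 : #|b |: K| < n.
    rewrite -ltnS; apply: leq_trans Sn; rewrite ltnS; apply: proper_card.
    apply/properP; split; last by exists s.
    by apply/subsetP => x; rewrite in_setU1 => /orP[/eqP->//|/(subsetP KS)].
  have aS' : a \in S :\: K by rewrite in_setD aK.
  have bS' : b \in S :\: K by rewrite in_setD bK.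
  have [r1 [nc1 f1]] := IHU _ a card1 aS'.
  have [r2 [nc2 f2]] := IHU _ b card2 (setU11 b K).
  have dis x : x \in S :\: K -> x \in K -> False by rewrite in_setD => /andP[/negP].
  have hKb x y : x \in K -> y \in S :\: K -> e x y -> y = b.
    rewrite in_setD => xK /andP[yK yS] /(hK x y xK yS).
    by rewrite in_setU1 (negPf yK) orbF => /eqP.
  have [r [nc SS _ SK]] := cut_glue e_sym nc1 nc2 bS' dis f2 hKb.
  exists r; rewrite SE; split=> // x; rewrite in_setU => /orP[xS|xK] xa.
    by apply: SS => //; apply: f1.
  apply: SK => //; have [->//|ba] := eqVneq b a.
  by apply: ltnW; apply: f1.
split.
- move=> S a Sn aS.
  have [Sa|[d dSa]] := set_0Vmem (S :\ a).
    exists (fun=> 0); split.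
      have eqa z : z \in S -> z = a.
        by move=> zS; apply/eqP; apply: contraT => za; move: (in_set0 z); rewrite -Sa in_setD1 za zS.
      by split=> // x y xS yS _; rewrite (eqa x xS) (eqa y yS).
    by move=> x xS xa; move: (in_set0 x); rewrite -Sa in_setD1 xa xS.
  move: (dSa); rewrite in_setD1 => /andP[da dS].
  pose C := comp (S :\ a) d.
  have lC : linked C by apply: comp_linked.
  have dC : d \in C by apply: comp_refl.
  have CS x : x \in C -> x != a /\ x \in S.
    by move=> /(subsetP (comp_sub _ _ _)); rewrite in_setD1 => /andP.
  have aC : a \notin C by apply/negP => /CS[]; rewrite eqxx.
  have Cd x y : x \in C -> y \in S -> e x y -> y \in a |: C.
    move=> xC yS xy; rewrite in_setU1; have [//|ya] /= := eqVneq y a.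
    by apply: (comp_closed xC _ xy); rewrite in_setD1 ya.
  have [/subsetP SaC|/subsetPn[s sS saC]] := boolP (S \subset a |: C); last first.
    apply: (glueU S a a C) => //; first by apply/subsetP => x /CS[].
      by apply/set0Pn; exists d.
    by exists s.
  have SE : S = a |: C.
    apply/eqP; rewrite eqEsubset; apply/andP; split; apply/subsetP => // x.
    by rewrite in_setU1 => /orP[/eqP->//|/CS[]].
  have Cn : #|C| < n by move: Sn; rewrite SE cardsU1 aC.
  have [/touch1P[b bC ab]|nt] := boolP (touch [set a] C); last first.
    have [r [[inj nc] f]] := IHU C d Cn dC.
    have noa x : x \in C -> e a x -> False.
      by move=> xC ax; move/negP: nt; apply; apply/touch1P; exists x.
    pose r' x := if x == a then 0 else (r x).+1.
    have r'C x : x \in C -> r' x = (r x).+1.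
      by rewrite /r' => /CS[/negPf->].
    have r'a : r' a = 0 by rewrite /r' eqxx.
    exists r'; rewrite SE; split.
      split.
        move=> x y; rewrite !in_setU1 => /orP[/eqP->|xC] /orP[/eqP->|yC] //.
        - by rewrite r'a r'C.
        - by rewrite r'a r'C.
        - by rewrite !r'C // => -[]; apply: inj.
      move=> x y z t; rewrite !in_setU1 => xU yU zU tU /andP[xy yz] zt xz yt.
      have inC u v : r' u < r' v -> (v == a) || (v \in C) -> v \in C.
        by move=> uv /orP[/eqP va|//]; move: uv; rewrite va r'a.
      have yC := inC x y xy yU; have zC := inC y z yz zU; have tC := inC z t zt tU.
      case/orP: xU => [/eqP xa|xC]; first by rewrite xa in xz; apply: noa xz.
      have lt u v : u \in C -> v \in C -> r' u < r' v -> r u < r v.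
        by move=> uC vC; rewrite !r'C.
      by apply: (nc x y z t) => //; rewrite ?lt.
    move=> x; rewrite in_setU1 => /orP[/eqP->|xC]; first by rewrite eqxx.
    by rewrite r'a r'C.
  have abn : a != b by apply: contraNneq aC => ->.
  have [ba bS] := CS b bC.
  have [/forall_inP allt|] := boolP [forall y in C :\ b, touch [set a] (comp (C :\ b) y)]; last first.
    case/forall_inPn => y yCb nt.
    pose K := comp (C :\ b) y.
    have KC x : x \in K -> x != b /\ x \in C.
      by move=> /(subsetP (comp_sub _ _ _)); rewrite in_setD1 => /andP.
    apply: (glueU S a b K) => //.
    - by apply/negP => /KC[_]; rewrite (negPf aC).
    - by apply/negP => /KC[]; rewrite eqxx.
    - by apply/subsetP => x /KC[_ /CS[]].
    - by apply/set0Pn; exists y; apply: comp_refl.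
    - exists a => //; rewrite in_setU1 (negPf abn) /=.
      by apply/negP => /KC[_]; rewrite (negPf aC).
    - move=> x z xK; rewrite SE !in_setU1 => /orP[/eqP->|zC] xz.
        by case/touch1P: nt; exists x; rewrite // e_sym.
      have [//|zb] /= := eqVneq z b.
      by apply: (comp_closed xK _ xz); rewrite in_setD1 zb.
  have CE : C = b |: (C :\ b) by rewrite setD1K.
  suff [r [nc f]] : rooted (a |: (b |: (C :\ b))) a by rewrite SE CE; exists r.
  have [->|[y yCb]] := set_0Vmem (C :\ b).
    by rewrite setU0; have [r [nc f _]] := spans2 abn; exists r.
  move: (yCb); rewrite in_setD1 => /andP[yb yC].
  pose K := comp (C :\ b) y.
  have lK : linked K by apply: comp_linked.
  have KC x : x \in K -> x != b /\ x \in C.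
    by move=> /(subsetP (comp_sub _ _ _)); rewrite in_setD1 => /andP.
  have aK : a \notin K by apply/negP => /KC[_]; rewrite (negPf aC).
  have bK : b \notin K by apply/negP => /KC[]; rewrite eqxx.
  have taK : touch [set a] K := allt y yCb.
  have tbK : touch [set b] K by apply: comp_touch.
  (* For a single component the edge [ab] takes the place of the detour: two touching routes would
     make a K4 with [a] and [b]. *)
  have [KE|[y' y'K]] := set_0Vmem ((C :\ b) :\: K).
    have {}KE : C :\ b = K.
      by apply/eqP; rewrite eqEsubset comp_sub andbT -setD_eq0 KE.
    rewrite KE; have [] := @split_step K a b set0; rewrite ?setU0 ?in_set0 //.
    - by move=> v; rewrite inE.
    - exact: linked1.
    - exact: linked1.
    - by apply/touch1P; exists b; rewrite ?set11.
    - by apply/touch1P; exists a; rewrite ?set11 // e_sym.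
    - move=> X1 X2 l1 l2 /subsetP X1K /subsetP X2K d12 t12 ta1 tb1 ta2 tb2.
      apply: (K4f (A := [set a]) (B := [set b]) (C := X1) (D := X2)) => //.
      + by split=> //; apply: linked1.
      + have d1 c X : c \notin X -> disj [set c] X.
          by move=> cX; apply/disjP => v /set1P->; rewrite (negPf cX).
        have sub X x : {subset X <= K} -> x \notin K -> x \notin X.
          by move=> XK; apply: contra; apply: XK.
        by rewrite /= d12 !d1 ?in_set1 ?(sub _ _ X1K) ?(sub _ _ X2K).
      + by split=> //; apply/touch1P; exists b; rewrite ?set11.
    - move=> W a' b' Z' WK; apply: IHR; rewrite -ltnS; apply: leq_trans Sn.
      by rewrite ltnS (leq_trans WK) // SE CE KE.
    - by move=> r [nc f _]; exists r.
  move: (y'K); rewrite in_setD => /andP[y'nK y'Cb].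
  pose K' := (C :\ b) :\: K.
  have K'E x : x \in K' = [&& x \notin K, x != b & x \in C] by rewrite in_setD in_setD1.
  have aK' : a \notin K' by rewrite K'E (negPf aC) !andbF.
  have bK' : b \notin K' by rewrite K'E eqxx andbF.
  have cardK X x : X \subset C :\ b -> x \in C :\ b -> x \notin X -> #|a |: (b |: X)| < n.
    move=> /subsetP XC xC xX; rewrite -ltnS; apply: leq_trans Sn; rewrite ltnS SE.
    apply: proper_card; apply/properP; split.
      apply/subsetP => z; rewrite !in_setU1 => /or3P[->//|/eqP->|/XC]; first by rewrite bC orbT.
      by rewrite in_setD1 => /andP[_ ->]; rewrite orbT.
    move: xC; rewrite in_setD1 => /andP[xb xC]; exists x; first by rewrite in_setU1 xC orbT.
    by rewrite !in_setU1 (negPf xb) (negPf xX) !orbF; have [] := CS x xC.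
  have disab X Z : a \notin Z -> b \notin Z -> (forall v, v \in Z -> v \in X -> False) ->
      forall v, v \in Z -> v \in a |: (b |: X) -> False.
    move=> aZ bZ dZ v vZ; rewrite !in_setU1 => /or3P[/eqP va|/eqP vb|]; last exact: dZ.
      by rewrite -va vZ in aZ.
    by rewrite -vb vZ in bZ.
  pose Ky' := comp (C :\ b) y'.
  have KK' v : v \in Ky' -> v \in K -> False.
    by move=> vy' vK; have /disjP/(_ v vK vy') := comp_disj e_sym yCb y'Cb y'nK.
  have Ky'C x : x \in Ky' -> x != b /\ x \in C.
    by move=> /(subsetP (comp_sub _ _ _)); rewrite in_setD1 => /andP.
  have [r1 [nc1 f1 l1]] : spans (a |: (b |: K)) a b.
    apply: (IHR _ a b Ky'); rewrite ?setU11 ?in_setU1 ?eqxx ?orbT //.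
      by apply: (cardK K y') => //; exact: comp_sub.
    split; first exact: comp_linked.
    - apply: disab => //; first by apply/negP => /Ky'C[_]; rewrite (negPf aC).
      by apply/negP => /Ky'C[]; rewrite eqxx.
    - exact: allt.
    - by apply: comp_touch => //; move: y'Cb; rewrite in_setD1 => /andP[].
  have [r2 [nc2 f2 l2]] : spans (a |: (b |: K')) a b.
    apply: (IHR _ a b K); rewrite ?setU11 ?in_setU1 ?eqxx ?orbT //.
      apply: (cardK K' y) => //; first exact: subsetDl.
      by rewrite K'E comp_refl.
    split=> //; apply: disab => // v vK; by rewrite K'E vK.
  have -> : a |: (b |: (C :\ b)) = (a |: (b |: K)) :|: (a |: (b |: K')).
    apply/setP => x; rewrite !in_setU !in_set1 K'E in_setD1.
    case: (x == a) => //=; case: (boolP (x == b)) => //= xb.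
    by have [/KC[_ ->]|] := boolP (x \in K).
  apply: (edge_glue e_sym nc1 nc2 f1 l1 f2 l2); rewrite ?setU11 ?in_setU1 ?eqxx ?orbT //.
    move=> x; rewrite !in_setU1 K'E => /or3P[/eqP->|/eqP->|xK]; [by left|by right|].
    by rewrite xK /= orbF => /orP[]/eqP; [left|right].
  move=> x z; rewrite !in_setU1 => /or3P[->|->|xK]; [by left|by left; rewrite orbT|].
  move=> /or3P[->|->|zK'] xz; [by right|by right; rewrite orbT|right].
  move: zK'; rewrite K'E => /and3P[zK zb zC]; rewrite (comp_closed xK _ xz) ?orbT //.
  by rewrite in_setD1 zb.
- move=> W a b Z Wn aW bW ab out; have [lZ dZ ta tb] := out.
  pose I := W :\ a :\ b.
  have IE x : x \in I = [&& x != b, x != a & x \in W] by rewrite !in_setD1.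
  have Icl y x z : x \in comp I y -> z \in W -> e x z -> z \in a |: (b |: comp I y).
    move=> xI zW xz; rewrite !in_setU1; have [//|za] /= := eqVneq z a.
    have [//|zb] /= := eqVneq z b; apply: (comp_closed xI _ xz).
    by rewrite IE za zb.
  have compN y : y \in I -> comp I y != set0.
    by move=> yI; apply/set0Pn; exists y; apply: comp_refl.
  have [/forall_inP alla|] := boolP [forall y in I, touch [set a] (comp I y)]; last first.
    case/forall_inPn => y yI nt; apply: spans_sym => //.
    apply: (glue W b a Z (comp I y)) => //; first by rewrite eq_sym.
    - by rewrite !setDDl [[set b] :|: _]setUC -setDDl; exact: comp_sub.
    - exact: compN.
    move=> x z xI zW xz; move: (Icl y x z xI zW xz); rewrite in_setU1 => /orP[/eqP za|//].
    by case/touch1P: nt; exists x; rewrite // -za e_sym.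
  have [/forall_inP allb|] := boolP [forall y in I, touch [set b] (comp I y)]; last first.
    case/forall_inPn => y yI nt.
    apply: (glue W a b Z (comp I y)) => //; first exact: comp_sub.
      exact: compN.
    move=> x z xI zW xz; move: (Icl y x z xI zW xz); rewrite setUCA in_setU1 => /orP[/eqP zb|//].
    by case/touch1P: nt; exists x; rewrite // -zb e_sym.
  have WE : W = a |: (b |: I).
    apply/setP => x; rewrite !in_setU1 IE; have [->|xa] //= := eqVneq x a.
    by have [->|xb] := eqVneq x b.
  have [I0|[y yI]] := set_0Vmem I.
    by rewrite WE I0 setU0; exact: spans2.
  have aX X : X \subset I -> a \notin X.
    by move=> /subsetP XI; apply/negP => /XI; rewrite IE eqxx andbF.
  have bX X : X \subset I -> b \notin X.
    by move=> /subsetP XI; apply/negP => /XI; rewrite IE eqxx.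
  have aZ : a \notin Z by apply/negP => /dZ; apply.
  have bZ : b \notin Z by apply/negP => /dZ; apply.
  (* Two disjoint routes and the detour [Z] are three routes from [a] to [b], a K23 minor. *)
  have NX X1 X2 : linked X1 -> linked X2 -> X1 \subset I -> X2 \subset I ->
     disj X1 X2 -> touch [set a] X1 -> touch [set b] X1 ->
     touch [set a] X2 -> touch [set b] X2 -> False.
    move=> l1 l2 X1I X2I d12 ta1 tb1 ta2 tb2.
    have dXZ X : X \subset I -> disj X Z.
      by move=> /subsetP XI; apply/disjP => v /XI; rewrite IE => /and3P[_ _ vW] vZ; apply: dZ vZ vW.
    have d1 c X : c \notin X -> disj [set c] X.
      by move=> cX; apply/disjP => v /set1P->; rewrite (negPf cX).
    apply: (K23f (A := [set a]) (B := [set b]) (X := X1) (Y := X2) (Z := Z)) => //.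
    + by split=> //; apply: linked1.
    + by rewrite /= d12 (dXZ _ X1I) (dXZ _ X2I) !d1 ?in_set1 ?(aX _ X1I) ?(aX _ X2I) ?(bX _ X1I) ?(bX _ X2I).
  pose K := comp I y.
  have lK : linked K by apply: comp_linked.
  have [KI|[y' y'K]] := set_0Vmem (I :\: K); last first.
    move: (y'K); rewrite in_setD => /andP[y'nK y'I]; exfalso.
    apply: (NX K (comp I y')); rewrite ?comp_sub ?alla ?allb //.
      exact: comp_linked.
    exact: comp_disj.
  have KE : I = K.
    by apply/eqP; rewrite eqEsubset comp_sub andbT -setD_eq0 KI.
  have lI : linked I by rewrite KE.
  have taI : touch [set a] I by have := alla y yI; rewrite -/K -KE.
  have tbI : touch [set b] I by have := allb y yI; rewrite -/K -KE.
  rewrite WE; apply: (split_step (Z := Z)) => //.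
  + exact: aX.
  + exact: bX.
  + by move=> v vZ; rewrite IE => /and3P[_ _]; apply: dZ.
  + by apply: linkedU => //; exact: linked1.
  + by apply: linkedU => //; exact: linked1.
  + by apply: touchS ta => //; apply: subsetUr.
  + by apply: touchS tb => //; apply: subsetUr.
  + by move=> X1 X2 l1 l2 s1 s2 d _; apply: NX.
  + move=> W' a' b' Z' W'W; apply: IHR; rewrite -ltnS; apply: leq_trans Wn.
    by rewrite ltnS WE.
Qed.

Lemma noncrossing_order : exists r : T -> nat, noncrossing setT r.
Proof.
have [t|T0] := pickP (mem [set: T]); last first.
  by exists (fun=> 0); split=> x; move: (T0 x); rewrite !inE.
move=> tT; have [U _] := order_exists #|T|.+1.
have [r [nc _]] : rooted setT t by apply: U; rewrite // cardsT.
by exists r.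
Qed.

End OuterplaneOrder.

(** * Counting edges of noncrossing ordered graphs without a k-cycle *)

Section EdgeCount.
Variables (n k : nat) (g : rel nat).
Hypothesis k3 : 2 < k.

Definition up x y := (x < y) && g x y.

Hypothesis nocross : forall a b c d, a < b -> b < c -> c < d -> d < n ->
  g a c -> g b d -> False.
(** Cycles are taken in the order of their vertices: an increasing path and one closing edge. *)
Hypothesis nocycle : forall a p, path up a p -> last a p < n -> g a (last a p) ->
  size p <> k.-1.

Definition edge_cnt a b := \sum_(i < n) \sum_(j < n) [&& a <= i, i < j, j <= b & g i j].

Lemma edge_cnt_split a b c : a < c -> c < b -> b < n ->
  (forall i j, a <= i -> i < j -> j <= b -> g i j ->
     [\/ i = a /\ j = b, j <= c | c <= i]) ->
  edge_cnt a b <= g a b + edge_cnt a c + edge_cnt c b.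
Proof.
move=> ac cb bn h; rewrite /edge_cnt.
have -> : (g a b : nat) = \sum_(i < n) \sum_(j < n) [&& i == a :> nat, j == b :> nat & g i j].
  have an : a < n by lia.
  rewrite (bigD1 (Ordinal an)) //= (bigD1 (Ordinal bn)) //= !eqxx /= !big1 ?addn0 //.
    move=> i ia; rewrite big1 // => j _; case: eqP => // ia'.
    by case/eqP: ia; apply: val_inj.
  move=> j jb; case: eqP => // jb'.
  by case/eqP: jb; apply: val_inj.
rewrite -!big_split /=; apply: leq_sum => i _; rewrite -!big_split /=.
apply: leq_sum => j _; case: (boolP [&& a <= i, _, _ & _]) => // /and4P[ai ij jb gij].
case: (h i j ai ij jb gij) => [[ia jb']|jc|ci].
- by rewrite ia jb' !eqxx -ia -jb' gij.
- by rewrite ai ij jc gij /=; lia.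
- by rewrite ci ij jb gij /= !addn1.
Qed.

(* The interval [a, b] is a chain of [s] edges and [gap] missing edges; [tau]
   is the number of triangles in the triangulated pieces behind the [s] edges.
   The other pieces, [lam] of them, have [mc] path steps altogether and
   [bf] is the number of faces with more than [k] sides. *)
Definition chain (a b s gap tau mc lam bf : nat) :=
  [/\ b - a + bf = tau + s + mc + gap,
      edge_cnt a b + lam <= tau.*2 + s + mc.*2,
      [/\ mc <= (k - 2) * lam, k * bf <= lam & tau + s <= (k - 2) * s],
      0 < s + gap &
      gap = 0 -> forall w, w <= tau ->
        exists p, [/\ path up a p, last a p = b & size p = s + w]].

(** The interval is cut at the last neighbour [c] of [a] before [b]; as no edges cross, every edge
    other than [ab] stays on one side. If [ab] is an edge, it replaces the whole chain, and the
    length of the chain decides what becomes of the pieces behind it. *)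
Lemma chain_exists a b : a < b -> b < n ->
  exists s gap tau mc lam bf, chain a b s gap tau mc lam bf /\
    (g a b -> s = 1 /\ gap = 0).
Proof.
have [m] := ubnP (b - a); elim: m => // m IH in a b * => bam ab bn.
have edge_path : g a b -> forall w, w = 0 ->
    exists p, [/\ path up a p, last a p = b & size p = 1 + w].
  by move=> gab w ->; exists [:: b]; rewrite /= /up ab gab.
have [b1|ba1] := eqVneq b a.+1.
  have cnt1 : edge_cnt a b <= g a b.
    rewrite /edge_cnt (bigD1 (Ordinal (ltn_trans ab bn))) //= (bigD1 (Ordinal bn)) //=.
    rewrite !big1 ?addn0.
    - by rewrite leqnn ab leqnn.
    - move=> i ia; rewrite big1 // => j _.
      apply/eqP; rewrite eqb0; apply/negP => /and4P[ai ij jb _].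
      by case/eqP: ia; apply: val_inj => /=; lia.
    - move=> j jb; apply/eqP; rewrite eqb0; apply/negP => /and4P[_ ij jb' _].
      by case/eqP: jb; apply: val_inj => /=; lia.
  have [gab|ngab] := boolP (g a b).
    exists 1, 0, 0, 0, 0, 0; split=> //; split=> //; rewrite ?gab in cnt1 *.
    - by lia.
    - by lia.
    - by split; rewrite ?muln0 //; lia.
    - by move=> _ w; rewrite leqn0 => /eqP; apply: edge_path.
  exists 0, 1, 0, 0, 0, 0; split=> //; split=> //; rewrite ?(negPf ngab) in cnt1 *.
  - by lia.
  - by lia.
  - by split; rewrite ?muln0.
have [c [ac cb edges_c gac]] : exists c, [/\ a < c, c < b,
    forall i j, a <= i -> i < j -> j <= b -> g i j -> [\/ i = a /\ j = b, j <= c | c <= i]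
    & g a c \/ c = a.+1].
  pose P c := (c == a.+1) || [&& a < c, c < b & g a c].
  have exP : exists c, P c by exists a.+1; rewrite /P eqxx.
  have boundP c : P c -> c <= b by rewrite /P => /orP[/eqP->|/and3P[]]; lia.
  have [c Pc maxc] := ex_maxnP exP boundP.
  have acb : a < c < b by move: Pc; rewrite /P => /orP[/eqP->|/and3P[]]; lia.
  have [ac cb] := andP acb.
  have ac1 : a.+1 <= c by [].
  exists c; split=> //; last by move: Pc => /orP[/eqP|/and3P[]]; [right|left].
  move=> i j ai ij jb gij.
  have [ci|ic] := leqP c i; first by constructor 3.
  have [jc|cj] := leqP j c; first by constructor 2.
  have [ia|ia] := eqVneq i a.
    constructor 1; split=> //; apply/eqP; apply: contraT => jb'.
    have : j <= c by apply: maxc; rewrite /P -ia gij; apply/orP; right; lia.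
    by lia.
  have : P c := Pc; rewrite /P => /orP[/eqP|/and3P[_ _ gac]]; first by lia.
  by case: (@nocross a i c j _ ic cj _ gac gij); lia.
have [|||s1 [gap1 [t1 [mc1 [lam1 [bf1 [[E1 C1 [M1 B1 T1] S1 P1] G1]]]]]]] := IH a c; try lia.
have [|||s2 [gap2 [t2 [mc2 [lam2 [bf2 [[E2 C2 [M2 B2 T2] S2 P2] G2]]]]]]] := IH c b; try lia.
have C := edge_cnt_split ac cb bn edges_c.
set s := s1 + s2; set gap := gap1 + gap2; set tau := t1 + t2.
set mc := mc1 + mc2; set lam := lam1 + lam2; set bf := bf1 + bf2.
have E : b - a + bf = tau + s + mc + gap by rewrite /bf /tau /s /mc /gap; lia.
have {C C1 C2}C : edge_cnt a b + lam <= g a b + (tau.*2 + s + mc.*2).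
  by rewrite /lam /tau /s /mc; lia.
have {M1 M2}M : mc <= (k - 2) * lam by rewrite /lam mulnDr /mc leq_add.
have {B1 B2}B : k * bf <= lam by rewrite /bf mulnDr /lam leq_add.
have {T1 T2}TS : tau + s <= (k - 2) * s by rewrite /tau /s mulnDr; lia.
have S : 1 < s + gap by rewrite /s /gap; lia.
have P : gap = 0 -> forall w, w <= tau ->
    exists p, [/\ path up a p, last a p = b & size p = s + w].
  rewrite /gap => gap0 w wt.
  have [w1 [w2 [-> w1t w2t]]] : exists w1 w2, [/\ w = w1 + w2, w1 <= t1 & w2 <= t2].
    by rewrite /tau in wt; exists (minn w t1), (w - minn w t1); split; lia.
  have [||p [pp lp zp]] := P1 _ w1; try lia.
  have [||q [pq lq zq]] := P2 _ w2; try lia.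
  exists (p ++ q); rewrite cat_path last_cat size_cat pp lp; split=> //.
  by rewrite /s; lia.
have [gab|ngab] := boolP (g a b); last first.
  exists s, gap, tau, mc, lam, bf; split=> //; split=> //; last by lia.
  by move: C; rewrite (negPf ngab).
rewrite gab in C; clearbody s gap tau mc lam bf.
(* Behind [ab] the chain is broken, so no inner face is closed. Its edges end their pieces, one
   missing edge is offset by [ab], and each further one counts as a piece of one step. *)
case: gap => [|gap] in E S P *; last first.
  exists 1, 0, 0, (mc + tau + s + gap), (lam + s + gap), bf; split=> //; split=> //; try lia.
    split; try lia.
    have ? : gap <= (k - 2) * gap by rewrite leq_pmull //; lia.
    by rewrite !mulnDr; lia.
  by move=> _ w; rewrite leqn0 => /eqP; apply: edge_path.
(* All lengths [s], ..., [s + tau] occur, and none may close up to a [k]-cycle with [ab]: the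
   interval lies below or above [k.-1]. *)
have nk w : w <= tau -> s + w <> k.-1.
  by move=> wt; have [p [pp lp <-]] := P erefl w wt; apply: (nocycle pp); rewrite lp.
have [sk|ks] := leqP (s + tau) (k - 2).
  (* A triangle merely enlarges the piece of [ab]. A longer face, of at most [k - 1] sides, lacks a
     diagonal, and this missing edge pays for counting everything behind it as one finished
     piece. *)
  have [s2'|s2'] := eqVneq s 2.
    exists 1, 0, tau.+1, mc, lam, bf; split=> //; split=> //; try lia.
      by split=> //; lia.
    move=> _ [|w] wt; first exact: edge_path.
    have [p [pp lp zp]] := P erefl w wt; exists p; split=> //.
    by rewrite zp s2'; lia.
  exists 1, 0, 0, (mc + tau + s.-1), lam.+1, bf; split=> //; split=> //; try lia.
    by split; try lia; rewrite mulnS; lia.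
  by move=> _ w; rewrite leqn0 => /eqP; apply: edge_path.
have ks' : k <= s.
  rewrite leqNgt; apply/negP => sk.
  by apply: (nk (k.-1 - s)); lia.
(* A face of more than [k] sides: its [s >= k] other edges end their pieces, which preserves
   [k * bf <= lam]. The new edge [ab] is an additional step, balanced by [bf.+1]. *)
exists 1, 0, 0, (mc + tau + s), (lam + s), bf.+1; split=> //; split=> //; try lia.
  by split; try lia; rewrite ?mulnDr ?mulnS; lia.
by move=> _ w; rewrite leqn0 => /eqP; apply: edge_path.
Qed.

(** The outermost chain is treated as if one last face ended all its pieces, each missing edge
    counting as a piece of one step. Since the chain is not empty, the last inequality is strict. *)
Theorem edge_count_bound : 1 < n ->
  exists lam bf, [/\ edge_cnt 0 n.-1 + lam <= n.-1.*2 + bf.*2,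
    n.-1 + bf <= (k - 2) * lam & k * bf < lam].
Proof.
move=> n1; have [||s [gap [tau [mc [lam [bf [[E C [M B TS] S _] _]]]]]]] :=
  @chain_exists 0 n.-1; try lia.
exists (lam + s + gap), bf; split; try lia.
have ? : gap <= (k - 2) * gap by rewrite leq_pmull //; lia.
by rewrite !mulnDr; lia.
Qed.

End EdgeCount.

(** * The extremal graphs *)

Section CycleCut.
Variables (T : eqType) (k : nat) (h : nat -> T) (adj : rel T) (S : pred T).
Hypotheses (k0 : 0 < k) (hk : forall i, h (i + k) = h i)
  (hinj : forall i j, i < j -> j < i + k -> h i != h j)
  (hadj : forall i, adj (h i) (h i.+1)) (adj_sym : symmetric adj).

Lemma cycle_mod i : h i = h (i %% k).
Proof.
have hkm m j : h (m * k + j) = h j.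
  by elim: m => [|m IH]; rewrite // mulSn -addnA addnC hk.
by rewrite {1}(divn_eq i k) hkm.
Qed.

Definition visited := [seq h i | i <- iota 0 k].

Lemma mem_visited i : h i \in visited.
Proof. by rewrite cycle_mod; apply: map_f; rewrite mem_iota ltn_mod. Qed.

Lemma visitedP v : v \in visited -> exists i, h i = v.
Proof. by case/mapP => i _ ->; exists i. Qed.

Lemma size_visited : size visited = k.
Proof. by rewrite size_map size_iota. Qed.

Lemma uniq_visited : uniq visited.
Proof.
rewrite map_inj_in_uniq ?iota_uniq // => i j; rewrite !mem_iota /= => ik jk hij.
have [ij|ji|//] := ltngtP i j.
  by have /eqP := hinj ij (ltn_addl i jk); rewrite hij.
by have /eqP := hinj ji (ltn_addl j ik); rewrite hij.
Qed.

Lemma cycle_shift i0 j : h j != h i0 -> exists2 j', i0 < j' < i0 + k & h j' = h j.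
Proof.
move=> ji0.
pose r := (j + (k - i0 %% k)) %% k; have rk : r < k by rewrite ltn_mod.
have e : h (i0 + r) = h j.
  rewrite [LHS]cycle_mod [RHS]cycle_mod /r modnDmr addnCA -modnDmr.
  have -> : i0 + (k - i0 %% k) = (i0 %/ k).+1 * k.
    have := divn_eq i0 k; have : i0 %% k < k by rewrite ltn_mod.
    by rewrite mulSn; nlia.
  by rewrite modnMl addn0.
exists (i0 + r) => //; case: r rk e => [|r] rk e; last by nlia.
by move: ji0; rewrite -e addn0 eqxx.
Qed.

(** The cycle, unrolled to a periodic sequence, is read from [i0]: [b1] is the first vertex outside
    [S], entered from [s1], and [b2] the last one before the return, left towards [s2]. They differ
    because at least two vertices lie outside. *)
Lemma cycle_cut i0 j1 j2 : S (h i0) -> ~~ S (h j1) -> ~~ S (h j2) -> h j1 != h j2 ->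
  exists b1 b2 s1 s2, [/\ h b1 != h b2, ~~ S (h b1) /\ ~~ S (h b2),
    S (h s1) /\ S (h s2), adj (h b1) (h s1) & adj (h b2) (h s2)].
Proof.
move=> Si0 Sj1 Sj2 j12.
have nS j : ~~ S (h j) -> exists2 j', (i0 < j' < i0 + k) && ~~ S (h j') & h j' = h j.
  move=> Sj; have [|j' b e] := @cycle_shift i0 j.
    by apply: contraNneq Sj => ->.
  by exists j'; rewrite // b e Sj.
have [p Pp ep] := nS j1 Sj1; have [q Pq eq] := nS j2 Sj2.
pose P i := (i0 < i < i0 + k) && ~~ S (h i).
have exP : exists i, P i by exists p.
have bP i : P i -> i <= i0 + k by case/andP => /andP[_ /ltnW].
have [i1 P1 min1] := ex_minnP exP; have [i2 P2 max2] := ex_maxnP exP bP.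
have [/andP[i01 i1k] Si1] := andP P1; have [/andP[i02 i2k] Si2] := andP P2.
have i12 : i1 < i2.
  have := min1 p Pp; have := max2 p Pp; have := min1 q Pq; have := max2 q Pq.
  case: (ltngtP i1 i2) => // i12; try nlia.
  by move=> *; have pq : p = q; [nlia|move: j12; rewrite -ep -eq pq eqxx].
exists i1, i2, i1.-1, i2.+1; split.
- by apply: hinj => //; nlia.
- by [].
- split; apply: contraT => nSs.
    have [e|ne] := eqVneq i1.-1 i0; first by rewrite e Si0 in nSs.
    have : i1 <= i1.-1 by apply: min1; rewrite /P nSs andbT; nlia.
    by nlia.
  have [e|ne] := eqVneq i2.+1 (i0 + k); first by rewrite e hk Si0 in nSs.
  have : i2.+1 <= i2 by apply: max2; rewrite /P nSs andbT; nlia.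
  by nlia.
- by rewrite adj_sym -{2}(prednK (leq_ltn_trans (leq0n _) i01)).
- exact: hadj.
Qed.
End CycleCut.

(** * The periodic graph of fans *)

Section Construction.
Variables (n k : nat).
Hypotheses (k3 : 2 < k) (kn : k <= n).
Let kap := k - 2.
Let D := k * kap - 1.

(* The vertices [j > 0] repeat with period [D]. The first [kap] of each period
   form with [0] a fan centred at [0]; the others form [k - 1] fans, the last of
   which ends at the first vertex of the next period and closes a face of length
   [k + 1]. The last disjunct of [ext_edge] closes such a face inside the last fan. *)
Definition fan_start i := (0 < i) && (kap %| ((i - 1) %% D).+1).
Definition root_pos j := (j - 1) %% D < kap.

Definition ext_edge i j := [|| j == i.+1, (i == 0) && root_pos j, fan_start i && (j <= i + kap)
  | [&& i == 0, j == n.-1 & (k - 1) * kap <= (n - 2) %% D]].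

Definition ext_adj i j := (i < j) && ext_edge i j || (j < i) && ext_edge j i.

Lemma ext_adj_sym : symmetric ext_adj.
Proof. by move=> i j; rewrite /ext_adj orbC. Qed.

Lemma kap0 : 0 < kap. Proof. by rewrite /kap subn_gt0. Qed.

Lemma D_def : D.+1 = k * kap.
Proof. by rewrite /D subn1 prednK // muln_gt0 kap0 andbT; nlia. Qed.

Lemma k1_kap : (k - 1) * kap + kap = D.+1.
Proof. by rewrite D_def -mulSnr subn1 prednK //; lia. Qed.

Lemma D2 : 1 < D.
Proof.
have := D_def; have := kap0; move: (kap) => x x0 h.
have : 3 * x <= k * x by rewrite leq_mul2r k3 orbT.
by nlia.
Qed.

Lemma posP j : 0 < j -> exists u v, [/\ j = u * D + v.+1, v < D & (j - 1) %% D = v].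
Proof.
move=> j0; exists ((j - 1) %/ D), ((j - 1) %% D); have := D2 => D2.
split=> //; last by rewrite ltn_mod; nlia.
by have := divn_eq (j - 1) D; nlia.
Qed.

Lemma modD u v : v < D -> (u * D + v.+1 - 1) %% D = v.
Proof. by move=> vD; rewrite addnS subn1 /= modnMDl modn_small. Qed.

Lemma fan_startP i : fan_start i -> exists u c, [/\ i = u * D + c * kap, 0 < c & c < k].
Proof.
case/andP=> i0; have [u [v [ie vD ->]]] := posP i0; case/dvdnP => c cE.
exists u, c; split; first by rewrite ie cE.
  by case: c cE.
have := D_def; have := kap0 => kap0 DE.
have : c * kap < k * kap by rewrite -cE -DE ltnS.
by rewrite ltn_mul2r kap0.
Qed.

Lemma fan_start_mk u c : 0 < c -> c < k -> fan_start (u * D + c * kap).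
Proof.
move=> c0 ck; have := D_def; have := kap0 => kap0 DE.
have ck0 : 0 < c * kap by rewrite muln_gt0 c0.
have cD : (c * kap).-1 < D.
  by have : c * kap < k * kap by [rewrite ltn_mul2r kap0]; nlia.
rewrite /fan_start -(prednK ck0) modD // prednK // dvdn_mull // andbT.
by rewrite addn_gt0 ck0 orbT.
Qed.

(** Within a period the fans start at multiples of [kap], and the last one ends at offset
    [k * kap = D + 1], the first vertex of the next period. *)
Lemma fan_inside i x : fan_start i -> i < x -> x < i + kap ->
  ~~ fan_start x /\ ~~ root_pos x.
Proof.
move=> /fan_startP[u [c [-> c0 ck]]] ix xi.
have [d [dE d0 dk]] : exists d, [/\ x = u * D + c * kap + d, 0 < d & d < kap].
  by exists (x - (u * D + c * kap)); split; nlia.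
have cdD : (c * kap + d).-1 < D.
  have : c.+1 * kap <= k * kap by rewrite leq_mul2r ck orbT.
  by have := D_def; rewrite mulSn; nlia.
have xE : x = u * D + (c * kap + d).-1.+1 by rewrite dE prednK ?addn_gt0 ?d0 ?orbT // addnA.
rewrite /fan_start /root_pos xE modD // prednK ?addn_gt0 ?d0 ?orbT //; split.
  by rewrite negb_and; apply/orP; right; rewrite dvdn_addr ?dvdn_mull // gtnNdvd.
have : 1 * kap <= c * kap by rewrite leq_mul2r c0 orbT.
by rewrite mul1n; nlia.
Qed.

(** An edge from [b > 0] that skips a vertex belongs to the fan of [b], and the interior of a fan
    contains neither a fan start nor a root position. *)
Lemma ext_edge_nocross a b c d : a < b -> b < c -> c < d -> d < n -> ext_edge a c -> ext_edge b d -> False.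
Proof.
move=> ab bc cd dn gac gbd.
have [fb db] : fan_start b /\ d <= b + kap.
  by case/or4P: gbd => [/eqP|/andP[/eqP]|/andP[]|/and3P[/eqP]]; try nlia.
case/or4P: gac => [/eqP|/andP[/eqP a0 rc]|/andP[fa ca]|/and3P[_ /eqP]]; try nlia.
- have [|_] := @fan_inside b c fb bc; first nlia.
  by rewrite rc.
- have [|+ _] := @fan_inside a b fa ab; first nlia.
  by rewrite fb.
Qed.

(** Together with 0, such an [x] separates the positive vertices below it from those above. *)
Lemma fan_cut x i j : fan_start x || root_pos x -> 0 < i -> i < x -> x < j -> ~~ ext_edge i j.
Proof.
move=> fx i0 ix xj; apply/negP.
case/or4P => [/eqP|/andP[/eqP]|/andP[fi ji]|/and3P[/eqP]]; try nlia.
have xi : x < i + kap by nlia.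
by have [/negPf f /negPf r] := fan_inside fi ix xi; rewrite f r in fx.
Qed.

(** Separators are so dense that a cycle avoiding 0 is confined to [k - 1] consecutive vertices. *)
Lemma cut_dense y : 0 < y -> exists2 x, y <= x < y + kap & fan_start x || root_pos x.
Proof.
move=> y0; have [u [v [ye vD yv]]] := posP y0; have := D_def; have := kap0 => kap0 DE.
have [Dv|vD'] := leqP D (v + kap).-1.
  exists (u.+1 * D + 1).
    by rewrite ye mulSn; nlia.
  by apply/orP; right; rewrite /root_pos modD ?kap0 //; nlia.
have := divn_eq v kap; have := ltn_mod v kap; rewrite kap0.
set q := v %/ kap; set r := v %% kap => rk vE.
exists (u * D + q.+1 * kap); first by rewrite ye mulSn; nlia.
apply/orP; left; apply: fan_start_mk => //.
have : q.+1 * kap < k * kap by rewrite -DE mulSn; nlia.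
by rewrite ltn_mul2r kap0.
Qed.

(** * Absence of cycles of length k *)

Section NoCycle.
Variable h : nat -> nat.
Hypotheses (hk : forall i, h (i + k) = h i)
  (hinj : forall i j, i < j -> j < i + k -> h i != h j)
  (hadj : forall i, ext_adj (h i) (h i.+1)) (hn : forall i, h i < n).

Let k0 : 0 < k. Proof. exact: leq_trans k3. Qed.

Lemma ext_adj_cut x a b : fan_start x || root_pos x -> 0 < a -> a < x -> x < b -> ~~ ext_adj a b.
Proof.
move=> fx a0 ax xb; rewrite /ext_adj (ltn_trans ax xb) /= negb_or (fan_cut fx a0 ax xb) /=.
by rewrite ltnNge ltnW // (ltn_trans ax xb).
Qed.

(** Each side of [x] is bordered by 0 and [x] only, and a cycle meeting both sides needs two border
    vertices for each; hence it passes both, and 0 has a neighbour on the cycle on either side. *)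
Lemma visit_cut x i0 i1 : fan_start x || root_pos x -> 0 < h i0 -> h i0 < x -> x < h i1 ->
  [/\ exists j, h j = 0, exists j, h j = x,
      exists j, [/\ 0 < h j, h j < x & ext_adj 0 (h j)] &
      exists j, x < h j /\ ext_adj 0 (h j)].
Proof.
move=> fx h0 hx xh.
have neS i : h i != h i.+1 by apply: hinj => //; nlia.
have [b1 [b2 [s1 [s2 [b12 [nb1 nb2] [/andP[s10 s1x] /andP[s20 s2x]] a1 a2]]]]] :
    exists b1 b2 s1 s2, [/\ h b1 != h b2, ~~ (0 < h b1 < x) /\ ~~ (0 < h b2 < x),
    (0 < h s1 < x) /\ (0 < h s2 < x), ext_adj (h b1) (h s1) & ext_adj (h b2) (h s2)].
  apply: (@cycle_cut _ k h ext_adj (fun v => 0 < v < x) k0 hk hinj hadj ext_adj_sym i0 i1 i1.+1).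
  - by rewrite h0 hx.
  - by nlia.
  - apply/negP => /andP[p0 px]; move: (hadj i1); rewrite ext_adj_sym.
    by apply/negP; apply: ext_adj_cut p0 px xh.
  - exact: neS.
have out1 b s : ~~ (0 < b < x) -> 0 < s -> s < x -> ext_adj b s -> b = 0 \/ b = x.
  move=> nb s0 sx; rewrite ext_adj_sym => bs.
  have [xb|bx] := ltnP x b; last by nlia.
  by have := ext_adj_cut fx s0 sx xb; rewrite bs.
have [c1 [c2 [t1 [t2 [c12 [nc1 nc2] [t1x t2x] d1 d2]]]]] :
    exists b1 b2 s1 s2, [/\ h b1 != h b2, ~~ (x < h b1) /\ ~~ (x < h b2),
    x < h s1 /\ x < h s2, ext_adj (h b1) (h s1) & ext_adj (h b2) (h s2)].
  apply: (@cycle_cut _ k h ext_adj (fun v => x < v) k0 hk hinj hadj ext_adj_sym i1 i0 i0.+1) => //.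
  - by nlia.
  - apply/negP => px; move: (hadj i0).
    by apply/negP; apply: ext_adj_cut h0 hx px.
have out2 b s : ~~ (x < b) -> x < s -> ext_adj b s -> b = 0 \/ b = x.
  move=> nb xs bs; have [->|b0] := posnP b; first by left.
  have [bx|xb] := ltnP b x; last by nlia.
  by have := ext_adj_cut fx b0 bx xs; rewrite bs.
have ob1 := out1 _ _ nb1 s10 s1x a1; have ob2 := out1 _ _ nb2 s20 s2x a2.
have oc1 := out2 _ _ nc1 t1x d1; have oc2 := out2 _ _ nc2 t2x d2.
split.
- by case: ob1 => e1; [exists b1|case: ob2 => e2; [exists b2|move: b12; rewrite e1 e2 eqxx]].
- by case: ob1 => e1; [case: ob2 => e2; [move: b12; rewrite e1 e2 eqxx|exists b2]|exists b1].
- case: ob1 => e1; first by rewrite e1 in a1; exists s1.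
  by case: ob2 => e2; [rewrite e2 in a2; exists s2|move: b12; rewrite e1 e2 eqxx].
- case: oc1 => e1; first by rewrite e1 in d1; exists t1.
  by case: oc2 => e2; [rewrite e2 in d2; exists t2|move: c12; rewrite e1 e2 eqxx].
Qed.

(** A cycle avoiding 0 has room for [k - 1] vertices only. A cycle through 0 lies between its least
    and its greatest neighbour of 0: either both are in the same fan at 0, which leaves [k - 1]
    vertices, or the cycle goes around a face of length [k + 1] and has at least [k + 1]
    vertices. *)
Lemma no_k_cycle : False.
Proof.
have mv := mem_visited k0 hk; have vP := @visitedP _ k h.
have kE : kap.+2 = k by rewrite /kap; nlia.
have pigeon s : (forall i, h i \in s) -> k <= size s.
  move=> hs; rewrite -(size_visited k h); apply: uniq_leq_size.
    exact: uniq_visited.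
  by move=> v /vP[i <-].
have ex_max (P : pred nat) : (exists i, P (h i)) -> exists2 i, P (h i) & forall j, P (h j) -> h j <= h i.
  move=> [i Pi]; have exP : exists v, (v \in visited k h) && P v by exists (h i); rewrite mv.
  have bP v : (v \in visited k h) && P v -> v <= n by case/andP => /vP[j <-] _; rewrite ltnW.
  have [v /andP[/vP[j jv] Pv] mx] := ex_maxnP exP bP.
  by exists j; rewrite jv // => l Pl; apply: mx; rewrite mv.
have ex_min (P : pred nat) : (exists i, P (h i)) -> exists2 i, P (h i) & forall j, P (h j) -> h i <= h j.
  move=> [i Pi]; have exP : exists v, (v \in visited k h) && P v by exists (h i); rewrite mv.
  have [v /andP[/vP[j jv] Pv] mn] := ex_minnP exP.
  by exists j; rewrite jv // => l Pl; apply: mn; rewrite mv.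
have [/mapP[i0 _ zi0]|no0] := boolP (0 \in visited k h); last first.
  have hpos i : 0 < h i by rewrite lt0n; apply: contraNneq no0 => <-.
  have [m _ hm] := ex_min predT (ex_intro _ 0 isT).
  have [x /andP[mx xm] fx] := cut_dense (ltn0Sn (h m)).
  have hx i : h i <= x.
    rewrite leqNgt; apply/negP => xi.
    have [[j j0] _ _ _] := visit_cut fx (hpos m) mx xi.
    by move: (hpos j); rewrite j0.
  suff : k <= size (iota (h m) kap.+1) by rewrite size_iota; nlia.
  by apply: pigeon => i; rewrite mem_iota; move: (hm i isT) (hx i); nlia.
have nb0 : ext_adj 0 (h i0.+1) by rewrite zi0.
have nb0' : ext_adj 0 (h (i0 + k.-1)).
  by have := hadj (i0 + k.-1); rewrite -addnS prednK // hk -zi0 ext_adj_sym.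
have nbne : h i0.+1 != h (i0 + k.-1) by apply: hinj; nlia.
pose N v := ext_adj 0 v.
have Npos v : N v -> 0 < v by rewrite /N /ext_adj ltn0 orbF => /andP[].
have Ngl v : N v -> root_pos v \/ (v = n.-1 /\ (k - 1) * kap <= (n - 2) %% D).
  rewrite /N /ext_adj ltn0 orbF => /andP[v0 /or4P[/eqP->|/andP[_]|/andP[]//|/and3P[_ /eqP ? ?]]].
  - by left; rewrite /root_pos mod0n kap0.
  - by left.
  - by right.
have [iy Ny miny] := ex_min N (ex_intro _ i0.+1 nb0).
have [iz Nz maxz] := ex_max N (ex_intro _ i0.+1 nb0).
have yz : h iy < h iz.
  move: (miny _ nb0) (maxz _ nb0) (miny _ nb0') (maxz _ nb0'); nlia.
have ry : root_pos (h iy) by case: (Ngl _ Ny) => // -[yn _]; move: (hn iz); nlia.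
have lo i : 0 < h i -> h iy <= h i.
  move=> i0'; rewrite leqNgt; apply/negP => iy'.
  have cy : fan_start (h iy) || root_pos (h iy) by rewrite ry orbT.
  have [_ _ [j [_ jy jN]] _] := visit_cut cy i0' iy' yz.
  by have := miny j jN; nlia.
have hi i : h i <= h iz.
  rewrite leqNgt; apply/negP => zi.
  have rz : root_pos (h iz) by case: (Ngl _ Nz) => // -[zn _]; move: (hn i); nlia.
  have cz : fan_start (h iz) || root_pos (h iz) by rewrite rz orbT.
  have [_ _ _ [j [jz jN]]] := visit_cut cz (Npos _ Ny) yz zi.
  by have := maxz j jN; nlia.
have [u [v [yE vD yv]]] := posP (Npos _ Ny); have [u' [v' [zE vD' zv]]] := posP (Npos _ Nz).
have vk : v < kap by rewrite -yv.
have := D_def; have := kap0 => kap0 DE.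
have kkap := k1_kap.
have uu' : u <= u'.
  rewrite leqNgt; apply/negP => h'; have : u'.+1 * D <= u * D by rewrite leq_mul2r h' orbT.
  by rewrite mulSn; nlia.
have [/andP[/eqP uu vk']|far] := boolP ((u == u') && (v' < kap)).
  suff : k <= size (0 :: iota (h iy) kap) by rewrite /= size_iota; nlia.
  apply: pigeon => i; rewrite inE mem_iota; have [//|i0'] := posnP (h i).
  by move: (lo i i0') (hi i); rewrite yE zE uu; nlia.
(* Either the greatest neighbour lies in a later period, or it is [n.-1], joined to 0 by the closing
   edge; both are past the last fan start of period [u]. *)
have xz : u * D + (k - 1) * kap < h iz.
  move: far; rewrite negb_and; have [eu|nu] := eqVneq u u' => /= far.
    case: (Ngl _ Nz) => [|[zn]]; first by rewrite /root_pos zv (negPf far).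
    have -> : n - 2 = h iz - 1 by nlia.
    by rewrite zv zE -eu; nlia.
  have : u.+1 * D <= u' * D by rewrite leq_mul2r ltn_neqAle nu uu' orbT.
  by rewrite mulSn zE; nlia.
have xc c : 0 < c -> c < k -> u * D + c * kap \in visited k h.
  move=> c0 ck.
  have xcz : u * D + c * kap < h iz.
    apply: leq_ltn_trans xz; rewrite leq_add2l leq_mul2r; apply/orP; right; nlia.
  have kc : kap <= c * kap by rewrite leq_pmull.
  have [<-|ne] := eqVneq (h iy) (u * D + c * kap); first exact: mv.
  have yx : h iy < u * D + c * kap by rewrite ltn_neqAle ne yE; nlia.
  have cx : fan_start (u * D + c * kap) || root_pos (u * D + c * kap).
    by rewrite fan_start_mk.
  by have [_ [j <-] _ _] := visit_cut cx (Npos _ Ny) yx xcz; exact: mv.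
have us : uniq (0 :: h iz :: [seq u * D + c * kap | c <- iota 1 (k - 1)]).
  rewrite /= !inE negb_or; apply/and3P; split.
  - rewrite neq_ltn (Npos _ Nz) /=; apply/negP => /mapP[c]; rewrite mem_iota => /andP[c1 _].
    by have : kap <= c * kap by [rewrite leq_pmull]; nlia.
  - apply/negP => /mapP[c]; rewrite mem_iota => /andP[c1 ck] zc.
    have : c * kap <= (k - 1) * kap by rewrite leq_mul2r; apply/orP; right; nlia.
    by move: xz; rewrite zc; nlia.
  - rewrite map_inj_uniq ?iota_uniq // => c d /addnI /eqP.
    by rewrite eqn_mul2r (gtn_eqF kap0) => /eqP.
suff sub : {subset 0 :: h iz :: [seq u * D + c * kap | c <- iota 1 (k - 1)] <= visited k h}.
  by have := uniq_leq_size us sub; rewrite size_visited /= size_map size_iota; nlia.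
move=> w; rewrite !inE => /or3P[/eqP->|/eqP->|/mapP[c + ->]].
- by rewrite zi0 mv.
- exact: mv.
- by rewrite mem_iota => /andP[c1 ck]; apply: xc; nlia.
Qed.
End NoCycle.

(** * Counting the edges of the construction *)

Lemma sum_ge (P : pred nat) j (s : seq nat) : uniq s -> all (fun i => (i < j) && P i) s ->
  size s <= \sum_(i < j) P i.
Proof.
move=> us /allP ss; rewrite -(big_mkord xpredT (fun i => P i : nat)) /index_iota subn0.
rewrite -big_mkcond /= sum1_count -size_filter.
apply: uniq_leq_size => // i /ss /andP[ij Pi].
by rewrite mem_filter Pi mem_iota.
Qed.

Lemma leq_sum_last (F G : nat -> nat) m c : 0 < m -> (forall j, F j <= G j) ->
  F m.-1 + c <= G m.-1 -> \sum_(j < m) F j + c <= \sum_(j < m) G j.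
Proof.
case: m => // m _ FG FGm; rewrite !big_ord_recr /= -addnA leq_add //.
by apply: leq_sum.
Qed.

Lemma leq_sum_first (F G : nat -> nat) m c : 0 < m -> (forall j, F j <= G j) ->
  F 0 + c <= G 0 -> \sum_(j < m) F j + c <= \sum_(j < m) G j.
Proof.
case: m => // m _ FG FG0; rewrite !big_ord_recl /= addnAC leq_add //.
by apply: leq_sum => i _.
Qed.

(** [ext_edge] without the closing edge from 0 to [n.-1], which is added at the end of the count. *)
Definition base_edge i j := [|| j == i.+1, (i == 0) && root_pos j | fan_start i && (j <= i + kap)].

Definition back_deg j := \sum_(i < j) base_edge i j.

Lemma back_deg1 j : 0 < j -> 1 <= back_deg j.
Proof.
move=> j0; apply: (@sum_ge (fun i => base_edge i _) _ [:: j.-1]) => //=.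
by rewrite andbT /base_edge prednK // eqxx andbT; nlia.
Qed.

(** Within a fan, a vertex is joined to its predecessor and to the centre; equal quotients by [kap]
    mean that both vertices belong to the same fan. *)
Lemma back_deg_inner u v : v.+1 < D -> v.+1 %/ kap = v %/ kap -> 2 <= back_deg (u * D + v.+2).
Proof.
move=> vD vE; have := kap0 => kap0; set j := u * D + v.+2.
have jE : j = u * D + v.+1.+1 by [].
have [w0|w0] := posnP (v.+1 %/ kap).
  have vk : v.+1 < kap by rewrite ltnNge -divn_gt0 // w0.
  apply: (@sum_ge (fun i => base_edge i _) _ [:: j.-1; 0]) => /=.
    by rewrite inE andbT; apply/eqP; nlia.
  rewrite /base_edge prednK ?eqxx /=; last by nlia.
  by rewrite /root_pos jE modD // vk orbT andbT; nlia.
set c := v.+1 %/ kap in w0 vE.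
have := divn_eq v.+1 kap; have := ltn_mod v.+1 kap; rewrite kap0 -/c.
set m := v.+1 %% kap => mk vm.
have := divn_eq v kap; have := ltn_mod v kap; rewrite kap0 -vE.
set m' := v %% kap => mk' vm'.
have ck : c < k.
  have : c * kap < k * kap by rewrite -D_def; nlia.
  by rewrite ltn_mul2r kap0.
have kc : kap <= c * kap by rewrite leq_pmull.
apply: (@sum_ge (fun i => base_edge i _) _ [:: j.-1; u * D + c * kap]) => /=.
  by rewrite inE andbT; apply/eqP; nlia.
rewrite /base_edge prednK ?eqxx /=; last by nlia.
by rewrite fan_start_mk //=; apply/and3P; split; rewrite ?andbT; try nlia; rewrite (_ : _ <= _) ?orbT //; nlia.
Qed.

(** The first vertex of a period is joined to its predecessor, to 0 and to the last fan start before
    it. For [k = 3] the predecessor is that fan start; as [D.-1 %/ kap] is [k - 1] for [k > 3] but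
    [k - 2] for [k = 3], one inequality covers both cases. *)
Lemma back_deg_close u : k + back_deg (u.+1 * D + 1) >= 4 + (D.-1 %/ kap).
Proof.
have := kap0 => kap0; have := D_def => DE; have := D2 => D2; set j := u.+1 * D + 1.
have r0 : root_pos j by rewrite /root_pos /j modD //; nlia.
have jE : j = u * D + D + 1 by rewrite /j mulSn; nlia.
clearbody j.
have j1 : D < j by nlia.
have [k1|k1] := leqP kap 1.
  have kE : k = 3 by rewrite /kap in k1; nlia.
  have kap1 : kap = 1 by rewrite /kap kE.
  have -> : D = 2 by rewrite /D kap1 kE.
  have : 2 <= back_deg j.
    apply: (@sum_ge (fun i => base_edge i _) _ [:: j.-1; 0]) => /=.
      by rewrite inE andbT; apply/eqP; nlia.
    by rewrite /base_edge prednK ?eqxx /= ?r0 ?orbT ?andbT; nlia.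
  by rewrite kap1 kE divn1; nlia.
have -> : D.-1 %/ kap = k - 1.
  have -> : D.-1 = (k - 1) * kap + (kap - 2).
    by have := k1_kap; nlia.
  by rewrite divnMDl // divn_small ?addn0 //; nlia.
have : 3 <= back_deg j.
  have kk := k1_kap; have kx : kap <= (k - 1) * kap by rewrite leq_pmull //; nlia.
  apply: (@sum_ge (fun i => base_edge i _) _ [:: j.-1; 0; u * D + (k - 1) * kap]) => /=.
    rewrite !inE !negb_or /= andbT -!andbA.
    by apply/and3P; split; apply/eqP; nlia.
  rewrite /base_edge prednK ?eqxx /= ?r0 ?orbT ?andbT; last by nlia.
  have -> : fan_start (u * D + (k - 1) * kap) by apply: fan_start_mk; nlia.
  have -> : j <= u * D + (k - 1) * kap + kap by nlia.
  by rewrite !orbT !andbT; apply/and3P; split; nlia.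
by nlia.
Qed.

(** This is 2(m - 1) + 2b - lambda with b = [(m - 2) %/ D] faces and lambda = b k +
    [((m - 2) %% D) %/ kap] + 1 pieces. The offset is [m - 2] because the last vertex is [m - 1] and
    periods start at vertex 1. *)
Lemma back_deg_total m : 1 < m ->
  m.-1.*2 + ((m - 2) %/ D).*2 <=
  (\sum_(j < m) back_deg j) + 1 + ((m - 2) %/ D) * k + ((m - 2) %% D) %/ kap.
Proof.
have := D2 => D2; elim: m => // m IH; rewrite ltnS leq_eqVlt => /predU1P[<-|m1].
  rewrite /= !big_ord_recr big_ord0 /= div0n mod0n div0n; have := @back_deg1 1 isT; nlia.
have {}IH := IH m1; rewrite big_ord_recr /=.
have mE := divn_eq (m - 2) D; have vD := ltn_mod (m - 2) D.
move: IH mE vD; set u := (m - 2) %/ D; set v := (m - 2) %% D => IH mE vD.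
have {}vD : v < D by rewrite vD; nlia.
have m2 : m.+1 - 2 = u * D + v.+1 by nlia.
have [vD1|Dv] := ltnP v.+1 D.
  rewrite m2 divnMDl ?modnMDl ?(divn_small vD1) ?(modn_small vD1) ?addn0; last by nlia.
  have [e|ne] := eqVneq (v.+1 %/ kap) (v %/ kap).
    have := back_deg_inner u vD1 e; have -> : u * D + v.+2 = m by nlia.
    move: IH; rewrite e; move: (v %/ kap) (u * k) (\sum_(j < m) _) (back_deg m) => a b c d.
    by clear e; nlia.
  have le : v %/ kap < v.+1 %/ kap by rewrite ltn_neqAle eq_sym ne leq_div2r.
  have := @back_deg1 m (ltnW m1); move: IH le.
  by move: (v %/ kap) (v.+1 %/ kap) (u * k) (\sum_(j < m) _) (back_deg m) => a a' b c d; nlia.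
have vE : v.+1 = D by nlia.
have -> : m.+1 - 2 = u.+1 * D by rewrite m2 vE mulSn addnC.
rewrite mulnK ?modnMl ?div0n; last by nlia.
have := back_deg_close u; have -> : u.+1 * D + 1 = m by rewrite mulSn; nlia.
have -> : D.-1 = v by nlia.
move: IH; rewrite mulSn.
by move: (v %/ kap) (u * k) (\sum_(j < m) _) (back_deg m) => a b c d; nlia.
Qed.

(** The closing edge exists once the last vertex is past the last fan start of its period. It is not
    counted in [back_deg] and is singled out as the term with [j = n.-1] and [i = 0]. *)
Lemma edge_total : 2 < n ->
  n.-1.*2 + ((n - 2) %/ D).*2 + ((k - 1) * kap <= (n - 2) %% D) <=
  \sum_(j < n) \sum_(i < j) ext_edge i j + 1 + ((n - 2) %/ D) * k + ((n - 2) %% D) %/ kap.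
Proof.
move=> n2; have := @back_deg_total n (ltnW n2).
suff : \sum_(j < n) back_deg j + ((k - 1) * kap <= (n - 2) %% D) <= \sum_(j < n) \sum_(i < j) ext_edge i j.
  by nlia.
have base_ext i j : base_edge i j <= ext_edge i j.
  by rewrite /base_edge /ext_edge; case: (j == _); case: (_ && root_pos j); case: (fan_start i && _).
have sub j : back_deg j <= \sum_(i < j) ext_edge i j by apply: leq_sum => i _.
have [cl|_] := boolP (_ <= _ %% _); last by rewrite addn0; apply: leq_sum.
apply: (@leq_sum_last back_deg (fun j => \sum_(i < j) ext_edge i j)) => //; first by nlia.
apply: (@leq_sum_first (fun i => base_edge i n.-1) (fun i => ext_edge i n.-1)) => [|i|];
  [by nlia|exact: base_ext|].
rewrite /ext_edge cl !eqxx !orbT.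
have -> : base_edge 0 n.-1 = false; last by [].
have r : n.-1 - 1 = n - 2 by nlia.
have kk : kap <= (k - 1) * kap by rewrite leq_pmull //; nlia.
rewrite /base_edge /fan_start /root_pos /= orbF r ltnNge (leq_trans kk cl) orbF.
by apply/negP => /eqP; nlia.
Qed.
End Construction.

(** * Parity of crossings of polygonal drawings *)

(* [ring] is captured here as the Stdlib tactic, which knows the ring of
   booleans; the import below rebinds it. *)
From Stdlib Require Import Ring.

Lemma addb_xorb a b : a (+) b = xorb a b.
Proof. by case: a; case: b. Qed.

Ltac bool_ring := rewrite -?[~~ _]addTb !addb_xorb; ring.

From mathcomp Require Import all_order all_algebra ring lra.
Import Order.TTheory GRing.Theory Num.Theory.
Local Open Scope ring_scope.

Lemma addb_eqF a b c : b = false -> c = false -> a = b (+) c -> a = false.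
Proof. by move=> -> -> ->. Qed.

Section Parity.
Variable R : realFieldType.
Notation pt := (R * R)%type.

Definition on_seg (p q x : pt) : Prop :=
  exists a : R, [/\ 0 <= a, a <= 1, x.1 = p.1 + a * (q.1 - p.1)
                  & x.2 = p.2 + a * (q.2 - p.2)].

Definition lt_x (p q : pt) : bool := p.1 < q.1.

Definition under (p r s : pt) : bool :=
  ((r.1 < p.1 < s.1) && ((s.1 - r.1) * (p.2 - r.2) < (s.2 - r.2) * (p.1 - r.1)))
  || ((s.1 < p.1 < r.1) && ((r.1 - s.1) * (p.2 - s.2) < (r.2 - s.2) * (p.1 - s.1))).

Lemma underC p r s : under p r s = under p s r.
Proof. by rewrite /under orbC. Qed.

Lemma on_segC p q x : on_seg p q x -> on_seg q p x.
Proof.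
case=> a [a0 a1 e1 e2]; exists (1 - a); split; [lra|lra| |].
  by rewrite e1; ring.
by rewrite e2; ring.
Qed.

Lemma on_seg_x p q t : p.1 < q.1 -> p.1 <= t <= q.1 ->
  on_seg p q (t, p.2 + (q.2 - p.2) * (t - p.1) / (q.1 - p.1)).
Proof.
move=> pq /andP[pt tq]; have d0 : 0 < q.1 - p.1 by lra.
exists ((t - p.1) / (q.1 - p.1)); split.
- by rewrite divr_ge0 //; lra.
- by rewrite ler_pdivrMr //; lra.
- by rewrite /=; field; lra.
- by rewrite /=; field; lra.
Qed.

(** The difference of two affine functions that changes sign vanishes at the point dividing the
    interval in the ratio of its two values, so the argument stays within ordered fields. *)
Lemma segs_cross_aux p q r s (x y : R) : p.1 < q.1 -> r.1 < s.1 ->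
  x <= y -> p.1 <= x -> y <= q.1 -> r.1 <= x -> y <= s.1 ->
  let lpq z := p.2 + (q.2 - p.2) * (z - p.1) / (q.1 - p.1) in
  let lrs z := r.2 + (s.2 - r.2) * (z - r.1) / (s.1 - r.1) in
  (lpq x - lrs x) * (lpq y - lrs y) <= 0 ->
  exists z, on_seg p q z /\ on_seg r s z.
Proof.
move=> pq rs xy px yq rx ys lpq lrs.
set dx := lpq x - lrs x; set dy := lpq y - lrs y => dxy.
have [dd|dd] := eqVneq dx dy.
  have dx0 : dx = 0 by apply/eqP; rewrite -sqrf_eq0 eq_le sqr_ge0 andbT expr2 {2}dd.
  exists (x, lpq x); split; first by apply: on_seg_x => //; lra.
  have -> : lpq x = lrs x by rewrite /dx in dx0; lra.
  by apply: on_seg_x => //; lra.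
pose th := dx / (dx - dy).
have th01 : 0 <= th <= 1.
  have [dp|dn] := ltrP 0 (dx - dy).
    by rewrite divr_ge0 ?ler_pdivrMr //=; nra.
  have dn' : 0 < dy - dx by rewrite lt_neqAle eq_sym subr_eq0 eq_sym dd /=; lra.
  have -> : th = (- dx) / (dy - dx) by rewrite /th; field; lra.
  by rewrite divr_ge0 ?ler_pdivrMr //=; nra.
pose t := x + th * (y - x).
have tb : x <= t <= y by rewrite /t; nra.
have z0 : dx + th * (dy - dx) = 0 by rewrite /th; field; rewrite subr_eq0.
have E : lpq t = lrs t.
  suff -> : lpq t = lrs t + (dx + th * (dy - dx)) by rewrite z0 addr0.
  rewrite /dx /dy /lpq /lrs /t; clearbody th; field.
  by apply/andP; split; rewrite subr_eq0 gt_eqF.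
exists (t, lpq t); split; first by apply: on_seg_x => //; lra.
by rewrite E; apply: on_seg_x => //; lra.
Qed.

Lemma underE p r s : r.1 < s.1 ->
  under p r s = (r.1 < p.1 < s.1) &&
    (p.2 < r.2 + (s.2 - r.2) * (p.1 - r.1) / (s.1 - r.1)).
Proof.
move=> rs; rewrite /under.
have -> : (s.1 < p.1 < r.1) = false by apply/negP => /andP[]; lra.
rewrite orbF -ltrBlDl ltr_pdivlMr ?subr_gt0 //.
by rewrite [(_ - _) * (_ - r.2)]mulrC.
Qed.

(** For distinct x-coordinates the four comparisons add up to 1 exactly when the two pairs
    interleave. *)
Definition cross_parity (p q r s : pt) : bool :=
  under p r s (+) under q r s (+) under r p q (+) under s p q
  (+) (lt_x p r (+) lt_x q r (+) lt_x p s (+) lt_x q s).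

Lemma cross_parityCl p q r s : cross_parity p q r s = cross_parity q p r s.
Proof.
rewrite /cross_parity [under r q p]underC [under s q p]underC.
by bool_ring.
Qed.

Lemma cross_parityCr p q r s : cross_parity p q r s = cross_parity p q s r.
Proof.
rewrite /cross_parity [under p s r]underC [under q s r]underC.
by bool_ring.
Qed.

Lemma lt_xN p q : p.1 != q.1 -> lt_x q p = ~~ lt_x p q.
Proof. by move=> pq; rewrite /lt_x -leNgt le_eqVlt eq_sym (negPf pq). Qed.

Lemma cross_parityC p q r s : p.1 != r.1 -> p.1 != s.1 -> q.1 != r.1 ->
  q.1 != s.1 -> cross_parity p q r s = cross_parity r s p q.
Proof.
move=> /lt_xN pr /lt_xN ps /lt_xN qr /lt_xN qs.
rewrite /cross_parity pr ps qr qs.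
by bool_ring.
Qed.

Lemma cross_parity_refl p r s : cross_parity p p r s = false.
Proof.
rewrite /cross_parity /under.
have E t : (p.1 < t.1 < p.1) = false by apply/negP => /andP[]; lra.
by rewrite !E /=; bool_ring.
Qed.

Lemma cross_parity_aux p q r s : p.1 < q.1 -> r.1 < s.1 -> p.1 < r.1 ->
  q.1 != r.1 -> q.1 != s.1 -> cross_parity p q r s ->
  exists z, on_seg p q z /\ on_seg r s z.
Proof.
move=> pq rs pr qr qs; rewrite /cross_parity !underE // /lt_x pr.
have -> : (r.1 < p.1 < s.1) = false by apply/negP => /andP[]; lra.
have -> /= : p.1 < s.1 by lra.
case: (ltgtP q.1 r.1) qr => // [qr|rq] _.
  have [-> ->] : (q.1 < s.1) = true /\ (s.1 < q.1) = false.
    by split; [|apply/negP]; lra.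
  by [].
case: (ltgtP q.1 s.1) qs => // [qs|sq] _ /=; rewrite ?andbF => H.
  apply: (@segs_cross_aux p q r s r.1 q.1) => //; try lra.
  rewrite subrr mulr0 mul0r addr0 mulfK ?subr_eq0 ?gt_eqF //.
  set A := p.2 + _ in H *; set B := r.2 + _ in H *.
  by move: H; have [h1|h1] := ltP q.2 B; have [h2|h2] := ltP r.2 A => //= _; nra.
apply: (@segs_cross_aux p q r s r.1 s.1) => //; try lra.
rewrite subrr mulr0 mul0r addr0 mulfK ?subr_eq0 ?gt_eqF //.
set A := p.2 + _ in H *; set B := p.2 + _ in H *.
by move: H; have [h1|h1] := ltP r.2 A; have [h2|h2] := ltP s.2 B => //= _; nra.
Qed.

Lemma cross_parity_lt p q r s :
  p.1 != r.1 -> p.1 != s.1 -> q.1 != r.1 -> q.1 != s.1 ->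
  p.1 < q.1 -> r.1 < s.1 -> cross_parity p q r s ->
  exists z, on_seg p q z /\ on_seg r s z.
Proof.
move=> pr ps qr qs pq rs; have [h|h] := ltP p.1 r.1.
  exact: cross_parity_aux.
rewrite cross_parityC // => H.
have rp : r.1 < p.1 by rewrite lt_neqAle eq_sym pr.
have sp : s.1 != p.1 by rewrite eq_sym.
have sq : s.1 != q.1 by rewrite eq_sym.
by have [z [? ?]] := cross_parity_aux rs pq rp sp sq H; exists z.
Qed.

(** Odd parity forces a common point. The conditions on x-coordinates exclude vertical segments but
    admit single points, as a chain may repeat a vertex. *)
Lemma disjoint_segs_parity p q r s :
  p.1 != r.1 -> p.1 != s.1 -> q.1 != r.1 -> q.1 != s.1 ->
  (p.1 = q.1 -> p = q) -> (r.1 = s.1 -> r = s) ->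
  (forall z, on_seg p q z -> on_seg r s z -> False) ->
  cross_parity p q r s = false.
Proof.
move=> pr ps qr qs pq rs dis; apply/negP => H.
suff [z [z1 z2]] : exists z, on_seg p q z /\ on_seg r s z by exact: dis z1 z2.
case: (ltgtP p.1 q.1) => [lpq|lqp|/pq e]; last by rewrite e cross_parity_refl in H.
- case: (ltgtP r.1 s.1) => [lrs|lsr|/rs e].
  + exact: cross_parity_lt.
  + rewrite cross_parityCr in H.
    have [z [z1 z2]] := cross_parity_lt ps pr qs qr lpq lsr H.
    by exists z; split=> //; apply: on_segC.
  + by rewrite cross_parityC // e cross_parity_refl in H.
- rewrite cross_parityCl in H; case: (ltgtP r.1 s.1) => [lrs|lsr|/rs e].
  + have [z [z1 z2]] := cross_parity_lt qr qs pr ps lqp lrs H.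
    by exists z; split=> //; apply: on_segC.
  + rewrite cross_parityCr in H.
    have [z [z1 z2]] := cross_parity_lt qs qr ps pr lqp lsr H.
    by exists z; split; apply: on_segC.
  + by rewrite cross_parityC // e cross_parity_refl in H.
Qed.

(** * Parity for polygonal chains *)

Fixpoint segs (u : pt) (P : seq pt) : seq (pt * pt) :=
  if P is v :: P' then (u, v) :: segs v P' else [::].

Definition on_chain u P x := exists2 e, e \in segs u P & on_seg e.1 e.2 x.

Definition under_chain p u P := \big[addb/false]_(e <- segs u P) under p e.1 e.2.

Lemma under_chain_nil p u : under_chain p u [::] = false.
Proof. by rewrite /under_chain big_nil. Qed.

Lemma under_chain_cons p u v P :
  under_chain p u (v :: P) = under p u v (+) under_chain p v P.
Proof. by rewrite /under_chain big_cons. Qed.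

(** In the sum over the segments every inner vertex of the chain occurs twice and cancels. *)
Lemma chain_seg_parity (u : pt) (P : seq pt) (r s : pt) :
  {in u :: P, forall p, p.1 != r.1 /\ p.1 != s.1} ->
  {in u :: P &, forall p q, p.1 = q.1 -> p = q} -> (r.1 = s.1 -> r = s) ->
  (forall z, on_chain u P z -> on_seg r s z -> False) ->
  under u r s (+) under (last u P) r s (+) under_chain r u P (+) under_chain s u P
  (+) (lt_x u r (+) lt_x (last u P) r (+) lt_x u s (+) lt_x (last u P) s) = false.
Proof.
move=> + + rs; elim: P u => [|v P IH] u ne inj dis /=.
  by rewrite !under_chain_nil; bool_ring.
have [vP Pm] : v \in u :: v :: P /\ {subset v :: P <= u :: v :: P}.
  by split; [rewrite !inE eqxx orbT|move=> x xP; rewrite inE xP orbT].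
have uP : u \in u :: v :: P by rewrite inE eqxx.
have [ur us] := ne u uP; have [vr vs] := ne v vP.
have E1 : cross_parity u v r s = false.
  apply: disjoint_segs_parity => //; first exact: inj.
  by move=> z hz; apply: dis; exists (u, v) => //; rewrite inE eqxx.
have dis' z : on_chain v P z -> on_seg r s z -> False.
  by move=> [e eP ez]; apply: dis; exists e => //; rewrite inE eP orbT.
have E2 := IH v (fun p hp => ne p (Pm p hp))
  (fun p q hp hq => inj p q (Pm p hp) (Pm q hq)) dis'.
apply: (addb_eqF E1 E2); rewrite !under_chain_cons /cross_parity.
by bool_ring.
Qed.

Lemma chains_parity (u : pt) (P : seq pt) (w : pt) (Q : seq pt) :
  {in u :: P & w :: Q, forall p q, p.1 != q.1} ->
  {in u :: P &, forall p q, p.1 = q.1 -> p = q} ->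
  {in w :: Q &, forall p q, p.1 = q.1 -> p = q} ->
  (forall z, on_chain u P z -> on_chain w Q z -> False) ->
  under_chain u w Q (+) under_chain (last u P) w Q
  (+) under_chain w u P (+) under_chain (last w Q) u P
  (+) (lt_x u w (+) lt_x (last u P) w (+) lt_x u (last w Q)
       (+) lt_x (last u P) (last w Q)) = false.
Proof.
move=> + injP; elim: Q w => [|v Q IH] w ne inj dis /=.
  by rewrite !under_chain_nil; bool_ring.
have [vQ Qm] : v \in w :: v :: Q /\ {subset v :: Q <= w :: v :: Q}.
  by split; [rewrite !inE eqxx orbT|move=> x xP; rewrite inE xP orbT].
have wQ : w \in w :: v :: Q by rewrite inE eqxx.
have dis1 z : on_chain u P z -> on_seg w v z -> False.
  by move=> hz hz'; apply: dis hz _; exists (w, v) => //; rewrite inE eqxx.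
have E1 := chain_seg_parity (fun p hp => conj (ne p w hp wQ) (ne p v hp vQ))
  injP (inj _ _ wQ vQ) dis1.
have dis2 z : on_chain u P z -> on_chain v Q z -> False.
  by move=> hz [e eP ez]; apply: dis hz _; exists e => //; rewrite inE eP orbT.
have E2 := IH v (fun p q hp hq => ne p q hp (Qm q hq))
  (fun p q hp hq => inj p q (Qm p hp) (Qm q hq)) dis2.
apply: (addb_eqF E1 E2).
by rewrite !under_chain_cons; bool_ring.
Qed.

Definition shear (t : R) (p : pt) : pt := (p.1 + t * p.2, p.2).

(** A shear keeps segments straight; with [t] larger than every [|dx / dy|] it makes the
    x-coordinates of distinct points distinct. *)
Lemma generic_shear (s : seq pt) :
  exists t, {in s &, forall p q, (shear t p).1 = (shear t q).1 -> p = q}.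
Proof.
pose b (e : pt * pt) := `|(e.1.1 - e.2.1) / (e.1.2 - e.2.2)|.
pose t := 1 + \sum_(e <- [seq (p, q) | p <- s, q <- s]) b e.
exists t => p q ps qs /= pq.
have bt : b (p, q) < t.
  have m : (p, q) \in [seq (p, q) | p <- s, q <- s] by apply/allpairsP; exists (p, q).
  rewrite /t (big_rem _ m) /= addrA ltr_wpDr ?sumr_ge0 // => [e _|].
    exact: normr_ge0.
  by rewrite addrC ltrDl.
have [e|ne] := eqVneq p.2 q.2.
  by move: pq; rewrite e => /addIr e1; apply: injective_projections.
have d0 : p.2 - q.2 != 0 by rewrite subr_eq0.
have et : t = - ((p.1 - q.1) / (p.2 - q.2)).
  clearbody t; have -> : p.1 - q.1 = - t * (p.2 - q.2) by lra.
  by rewrite mulfK // opprK.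
by move: bt; rewrite {1}et /b /= -normrN => /(le_lt_trans (ler_norm _)); rewrite ltxx.
Qed.

Lemma on_seg_shear t p q z : on_seg (shear t p) (shear t q) z ->
  on_seg p q (shear (- t) z).
Proof.
case=> a [a0 a1 e1 e2]; exists a; split=> //=.
by rewrite e1 e2 /=; ring.
Qed.

Lemma segs_map (f : pt -> pt) u P :
  segs (f u) (map f P) = [seq (f e.1, f e.2) | e <- segs u P].
Proof. by elim: P u => //= v P IH u; rewrite IH. Qed.

Lemma on_chain_shear t u P z : on_chain (shear t u) (map (shear t) P) z ->
  on_chain u P (shear (- t) z).
Proof.
case=> e; rewrite segs_map => /mapP[d dP ->] /= /on_seg_shear h.
by exists d.
Qed.

Definition indep (e f : nat * nat) :=
  [&& e.1 != f.1, e.1 != f.2, e.2 != f.1 & e.2 != f.2].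

Definition chains_apart (u : pt) (P : seq pt) (w : pt) (Q : seq pt) :=
  {in u :: P & w :: Q, forall p q, p != q} /\
  (forall z, on_chain u P z -> on_chain w Q z -> False).

(** After a shear, [un i e] is the parity of the segments of chain [e] above vertex [i], and [h]
    orders vertices from left to right. For [i < j] the value [h j i] is defined as the negation of
    [h i j]: ties are excluded only between vertices of independent edges. *)
Lemma drawing_parity (E : seq (nat * nat)) (c : nat -> pt)
    (ch : nat * nat -> seq pt) :
  (forall e, e \in E -> last (c e.1) (ch e) = c e.2) ->
  (forall e f, e \in E -> f \in E -> indep e f ->
     chains_apart (c e.1) (ch e) (c f.1) (ch f)) ->
  exists (un : nat -> nat * nat -> bool) (h : nat -> nat -> bool),
    (forall i j, (i < j)%N -> h j i = ~~ h i j) /\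
    (forall e f, e \in E -> f \in E -> indep e f ->
    un e.1 f (+) un e.2 f (+) un f.1 e (+) un f.2 e
    (+) (h e.1 f.1 (+) h e.2 f.1 (+) h e.1 f.2 (+) h e.2 f.2) = false).
Proof.
move=> ends apart.
have [t tP] := generic_shear (flatten [seq c e.1 :: ch e | e <- E]).
have mem e p : e \in E -> p \in c e.1 :: ch e ->
    p \in flatten [seq c e.1 :: ch e | e <- E].
  by move=> eE pe; apply/flattenP; exists (c e.1 :: ch e) => //; apply: map_f.
pose sc i := shear t (c i); pose sch e := map (shear t) (ch e).
have mapc e : sc e.1 :: sch e = map (shear t) (c e.1 :: ch e) by [].
have send e : e \in E -> last (sc e.1) (sch e) = sc e.2.
  by move=> eE; rewrite /sc /sch last_map ends.
have inj e : e \in E -> {in sc e.1 :: sch e &, forall p q, p.1 = q.1 -> p = q}.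
  move=> eE p q; rewrite mapc => /mapP[p' p'e ->] /mapP[q' q'e ->] pq.
  by congr shear; apply: tP pq; apply: mem eE _.
have ne e f : e \in E -> f \in E -> indep e f ->
    {in sc e.1 :: sch e & sc f.1 :: sch f, forall p q, p.1 != q.1}.
  move=> eE fE ef p q; rewrite !mapc => /mapP[p' p'e ->] /mapP[q' q'f ->].
  apply/negP => /eqP /tP pq.
  have [/(_ p' q' p'e q'f)/eqP + _] := apart e f eE fE ef.
  by apply; apply: pq; [apply: mem p'e|apply: mem q'f].
exists (fun i e => under_chain (sc i) (sc e.1) (sch e)).
exists (fun i j => if (i < j)%N then lt_x (sc i) (sc j) else ~~ lt_x (sc j) (sc i)).
split=> [i j ij|e f eE fE ef]; first by rewrite ij ltnNge ltnW.
have e1 : sc e.1 \in sc e.1 :: sch e by rewrite inE eqxx.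
have f1 : sc f.1 \in sc f.1 :: sch f by rewrite inE eqxx.
have e2 : sc e.2 \in sc e.1 :: sch e by rewrite -(send e eE) mem_last.
have f2 : sc f.2 \in sc f.1 :: sch f by rewrite -(send f fE) mem_last.
rewrite -!lt_xN ?if_same; try by rewrite eq_sym; apply: (ne e f eE fE ef).
have := @chains_parity (sc e.1) (sch e) (sc f.1) (sch f) (ne e f eE fE ef) (inj e eE) (inj f fE).
rewrite !send // => -> // z /on_chain_shear h1 /on_chain_shear h2.
by have [_] := apart e f eE fE ef; apply; [exact: h1|exact: h2].
Qed.

(** There are 15 independent pairs. A vertex and an edge avoiding it occur together in two of them,
    one for each remaining vertex, so the [un] terms cancel; the order terms add up to 1 whatever
    the order. *)
Lemma K5_not_planar (c : nat -> pt) (ch : nat * nat -> seq pt) :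
  let E := [:: (0, 1); (0, 2); (0, 3); (0, 4); (1, 2); (1, 3); (1, 4); (2, 3); (2, 4); (3, 4)]%N in
  (forall e, e \in E -> last (c e.1) (ch e) = c e.2) ->
  (forall e f, e \in E -> f \in E -> indep e f ->
     chains_apart (c e.1) (ch e) (c f.1) (ch f)) ->
  False.
Proof.
move=> E ends apart; have [un [h [hN H]]] := drawing_parity ends apart.
pose x e f := un e.1 f (+) un e.2 f (+) un f.1 e (+) un f.2 e
    (+) (h e.1 f.1 (+) h e.2 f.1 (+) h e.1 f.2 (+) h e.2 f.2).
have x0 e f : [&& e \in E, f \in E & indep e f] -> x e f = false.
  by case/and3P; apply: H.
have : (x (0, 1) (2, 3) (+) x (0, 1) (2, 4) (+) x (0, 1) (3, 4) (+)
  x (0, 2) (1, 3) (+) x (0, 2) (1, 4) (+) x (0, 2) (3, 4) (+)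
  x (0, 3) (1, 2) (+) x (0, 3) (1, 4) (+) x (0, 3) (2, 4) (+)
  x (0, 4) (1, 2) (+) x (0, 4) (1, 3) (+) x (0, 4) (2, 3) (+)
  x (1, 2) (3, 4) (+) x (1, 3) (2, 4) (+) x (1, 4) (2, 3))%N = false.
  by rewrite !x0.
rewrite /x /= ?(hN 0%N 1%N) ?(hN 0%N 2%N) ?(hN 0%N 3%N) ?(hN 0%N 4%N)
  ?(hN 1%N 2%N) ?(hN 1%N 3%N) ?(hN 1%N 4%N) ?(hN 2%N 3%N) ?(hN 2%N 4%N)
  ?(hN 3%N 4%N) //.
set b := (X in X = false); suff -> : b = true by [].
by rewrite /b; bool_ring.
Qed.

(** Among the 18 independent pairs, a vertex and an edge avoiding it again occur together twice. *)
Lemma K33_not_planar (c : nat -> pt) (ch : nat * nat -> seq pt) :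
  let E := [:: (0, 3); (0, 4); (0, 5); (1, 3); (1, 4); (1, 5); (2, 3); (2, 4); (2, 5)]%N in
  (forall e, e \in E -> last (c e.1) (ch e) = c e.2) ->
  (forall e f, e \in E -> f \in E -> indep e f ->
     chains_apart (c e.1) (ch e) (c f.1) (ch f)) ->
  False.
Proof.
move=> E ends apart; have [un [h [hN H]]] := drawing_parity ends apart.
pose x e f := un e.1 f (+) un e.2 f (+) un f.1 e (+) un f.2 e
    (+) (h e.1 f.1 (+) h e.2 f.1 (+) h e.1 f.2 (+) h e.2 f.2).
have x0 e f : [&& e \in E, f \in E & indep e f] -> x e f = false.
  by case/and3P; apply: H.
have : (x (0, 3) (1, 4) (+) x (0, 3) (1, 5) (+) x (0, 3) (2, 4) (+)
  x (0, 3) (2, 5) (+) x (0, 4) (1, 3) (+) x (0, 4) (1, 5) (+)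
  x (0, 4) (2, 3) (+) x (0, 4) (2, 5) (+) x (0, 5) (1, 3) (+)
  x (0, 5) (1, 4) (+) x (0, 5) (2, 3) (+) x (0, 5) (2, 4) (+)
  x (1, 3) (2, 4) (+) x (1, 3) (2, 5) (+) x (1, 4) (2, 3) (+)
  x (1, 4) (2, 5) (+) x (1, 5) (2, 3) (+) x (1, 5) (2, 4))%N = false.
  by rewrite !x0.
rewrite /x /= ?(hN 0%N 1%N) ?(hN 0%N 2%N) ?(hN 0%N 3%N) ?(hN 0%N 4%N)
  ?(hN 0%N 5%N) ?(hN 1%N 2%N) ?(hN 1%N 3%N) ?(hN 1%N 4%N) ?(hN 1%N 5%N)
  ?(hN 2%N 3%N) ?(hN 2%N 4%N) ?(hN 2%N 5%N) ?(hN 3%N 4%N) ?(hN 3%N 5%N)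
  ?(hN 4%N 5%N) //.
set b := (X in X = false); suff -> : b = true by [].
by rewrite /b; bool_ring.
Qed.
End Parity.

(** * Comparison with the closed formula *)

Section Arithmetic.
Variables n k : nat.
Hypotheses (k3 : (3 <= k)%N) (kn : (k <= n)%N).

(** The floor becomes two linear inequalities for [l], and the two cases of the formula merge into
    the term [(r == 0)]. *)
Lemma turan_valueE : exists l q r : nat,
  [/\ (l = k * q + r)%N, (r < k)%N, (1 < l)%N &
   [/\ (l.-1 * (k * (k - 2) - 1) + 2 * k + 1 <= k * n)%N,
      (k * n <= l * (k * (k - 2) - 1) + 2 * k)%N &
      turan_value n k = (2 * n + 2 * q)%:Z - (l + 2 + (r == 0))%:Z]].
Proof.
pose D := (k * (k - 2) - 1)%N.
have D2 : (2 <= D)%N by rewrite /D; nia.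
pose x := (k * n - 2 * k - 1)%N.
have hx : (D <= x)%N by rewrite /x /D; nia.
have lamE : lam n k = (x %/ D).+1%:Z.
  rewrite /lam -[(x %/ D).+1]addn1 PoszD; congr (_ + _).
  have -> : k%:Z * n%:Z - 2 * k%:Z - 1 = x%:Z by rewrite /x; nia.
  have -> : k%:Z ^+ 2 - 2 * k%:Z - 1 = D%:Z by rewrite /D expr2; nia.
  by rewrite divz_nat.
set l := (x %/ D).+1 in lamE.
have l2 : (1 < l)%N by rewrite /l ltnS divn_gt0 ?(leq_trans _ D2).
have xlo : (l.-1 * D <= x)%N by rewrite /l /= leq_divM.
have xhi : (x < l * D)%N by rewrite /l ltn_ceil ?(leq_trans _ D2).
exists l, (l %/ k)%N, (l %% k)%N; split => //; last split.
- by rewrite mulnC -divn_eq.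
- by rewrite ltn_mod; lia.
- by rewrite -/D; move: xlo hx; rewrite /x; lia.
- by rewrite -/D; move: xhi hx; rewrite /x; lia.
- rewrite /turan_value lamE divz_nat.
  have -> : (k%:Z %| l%:Z)%Z = (k %| l)%N by [].
  by rewrite /dvdn; case: (_ == 0%N); lia.
Qed.

(** It remains to compare 2B - L with 2q - l. With j + 1 pieces fewer than l, the size of n leaves
    room for at most q - (j + 1) large faces; with more pieces, each face beyond q costs k >= 3 of
    them, up to the remainder r. *)
Lemma turan_upper (c L B : nat) : (c + L <= n.-1.*2 + B.*2)%N ->
  (n.-1 + B <= (k - 2) * L)%N -> (k * B < L)%N -> c%:Z <= turan_value n k.
Proof.
have Dk : (k - 1 <= k * (k - 2) - 1)%N.
  by rewrite leq_sub2r // leq_pmulr // subn_gt0.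
have [l [q [r [lE rk l2 [lo hi ->]]]]] := turan_valueE.
move=> cL nB BL.
suff : (2 * B + l + (r == 0) <= 2 * q + L)%N by lia.
have [Ll|lL] := ltnP L l.
  have [j jE] : exists j, l = (L + j.+1)%N by exists (l - L).-1; lia.
  (* [k] times the bound on [n.-1 + B], with [k * (k - 2)] written as that denominator plus 1, is
     set against the lower bound on [k * n]. *)
  have h1 : (j * (k * (k - 2) - 1) + k + 1 + k * B <= L)%N.
    have : (k * (n.-1 + B) <= k * ((k - 2) * L))%N by rewrite leq_mul2l nB orbT.
    have -> : (k * ((k - 2) * L) = (k * (k - 2) - 1) * L + L)%N.
      by rewrite mulnA -{1}(@subnK 1 (k * (k - 2))) ?mulnDl ?mul1n //; nia.
    move: lo; rewrite jE; set D := (k * (k - 2) - 1)%N.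
    have -> : (L + j.+1).-1 = (L + j)%N by lia.
    rewrite mulnDl mulnDr [(D * L)%N]mulnC.
    have -> : (k * n = k * n.-1 + k)%N by nia.
    lia.
  have h2 : (j * (k - 1) <= j * (k * (k - 2) - 1))%N by rewrite leq_mul2l Dk orbT.
  have h3 : (k * (B + j.+1) + 1 <= k * q + r)%N.
    have e1 : (j * (k - 1) + j = k * j)%N by rewrite -mulnSr -subSn ?subSS ?subn0 1?mulnC //; lia.
    by rewrite mulnDr mulnS -e1 -lE jE; lia.
  have h4 : (B + j.+1 <= q)%N.
    rewrite leqNgt; apply/negP => h; have : (k * q.+1 <= k * (B + j.+1))%N by rewrite leq_mul2l h orbT.
    by rewrite mulnS; lia.
  case: eqP => [r0|_]; last by lia.
  have h5 : (B + j.+1 < q)%N.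
    rewrite ltnNge; apply/negP => h; have : (k * q <= k * (B + j.+1))%N by rewrite leq_mul2l h orbT.
    by lia.
  lia.
have [i iE] : exists i, L = (l + i)%N by exists (L - l)%N; lia.
have [Bq|qB] := ltnP B q; first by case: (r == 0)%N; lia.
have [c' cE] : exists c', B = (q + c')%N by exists (B - q)%N; lia.
move: BL; rewrite cE mulnDr iE lE => BL.
have h : (3 * c' <= k * c')%N by rewrite leq_mul2r k3 orbT.
case: eqP => r0; first by lia.
clear cE iE; case: c' BL h => [|c'] BL h; first by rewrite muln0 in BL; lia.
have h' : (3 * c' <= k * c')%N by rewrite leq_mul2r k3 orbT.
by rewrite mulnS in BL; lia.
Qed.

(** With v = w(k - 2) + v' and k(k - 2) = D + 1 one gets kn = (ku + w)D + y + 2k for y = w + kv' <=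
    D, so lambda is ku + w, plus one unless y = 0. The closing edge belongs to w = k - 1, where k
    divides lambda. *)
Lemma turan_lower (u v c : nat) : let D := (k * (k - 2) - 1)%N in
  (n - 2 = u * D + v)%N -> (v < D)%N ->
  (n.-1.*2 + u.*2 + ((k - 1) * (k - 2) <= v) <= c + 1 + u * k + v %/ (k - 2))%N ->
  turan_value n k <= c%:Z.
Proof.
move=> D nE vD hc.
have kap0 : (0 < k - 2)%N by rewrite subn_gt0.
have DE : (D.+1 = k * (k - 2))%N by rewrite /D; have : (0 < k * (k - 2))%N; [rewrite muln_gt0; lia|lia].
have [l [q [r [lE rk l2 [lo hi ->]]]]] := turan_valueE.
rewrite -/D in lo hi.
have := divn_eq v (k - 2); have := ltn_mod v (k - 2); rewrite kap0.
set w := (v %/ (k - 2))%N in hc *; set v' := (v %% (k - 2))%N => v'k vE.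
have wk : (w < k)%N.
  have : (w * (k - 2) < k * (k - 2))%N by rewrite -DE; lia.
  by rewrite ltn_mul2r kap0.
have clE : ((k - 1) * (k - 2) <= v)%N = (w == k - 1)%N.
  rewrite -leq_divRL // -/w; apply/idP/eqP => [|->//]; lia.
rewrite clE in hc.
pose y := (w + k * v')%N.
have yD : (y <= D)%N.
  have : (k * v'.+1 <= k * (k - 2))%N by rewrite leq_mul2l v'k orbT.
  by rewrite -DE mulnS /y; lia.
have knE : (k * n = (k * u + w) * D + y + 2 * k)%N.
  have -> : n = (u * D + (w * (k - 2) + v') + 2)%N by lia.
  rewrite !mulnDr !mulnDl /y [(k * (w * _))%N]mulnCA -DE mulnS mulnA [(k * 2)%N]mulnC; lia.
set X := (k * u + w)%N in knE.
have lX : l = (X + (y != 0))%N.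
  have h1 : (l.-1 * D < (X + (y != 0)) * D)%N by rewrite mulnDl; case: eqP knE => /= [->|_]; lia.
  have h2 : (X * D + y <= l * D)%N by lia.
  have D0 : (0 < D)%N by lia.
  rewrite ltn_mul2r D0 /= in h1.
  case: eqP h1 h2 => [->|/eqP y0] h1 h2.
    by rewrite addn0 leq_mul2r in h2; move: h2 h1; rewrite (gtn_eqF D0) /=; lia.
  have : (X * D < l * D)%N by lia.
  by rewrite ltn_mul2r D0 /=; lia.
have qr : q = (l %/ k)%N /\ r = (l %% k)%N.
  by rewrite lE [(k * q)%N]mulnC divnMDl ?modnMDl ?(divn_small rk) ?(modn_small rk) ?addn0; lia.
have [y0|y0] := eqVneq y 0%N.
  have [w0 v0] : w = 0%N /\ v' = 0%N.
    by move: y0; rewrite /y; case: (w) => // /eqP; rewrite muln_eq0 => /orP[/eqP|/eqP->//]; lia.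
  have lku : l = (u * k)%N by rewrite lX y0 /X w0 mulnC !addn0.
  move: qr; rewrite lku mulnK ?modnMl; last by lia.
  by case=> -> ->; move: hc; rewrite w0; lia.
rewrite y0 in lX.
have [w1|w1] := eqVneq w (k - 1)%N.
  have lku : l = (u.+1 * k)%N by rewrite lX /X w1 mulSn mulnC; lia.
  move: qr; rewrite lku mulnK ?modnMl; last by lia.
  by case=> -> ->; move: hc; rewrite w1 eqxx mulSn; lia.
have wk1 : (w.+1 < k)%N by lia.
have lku : l = (u * k + w.+1)%N by rewrite lX /X mulnC; lia.
move: qr; rewrite lku divnMDl ?modnMDl ?(divn_small wk1) ?(modn_small wk1) ?addn0; last by lia.
by case=> -> ->; move: hc; rewrite (negPf w1) /=; lia.
Qed.

End Arithmetic.

From mathcomp Require Import all_classical all_reals all_analysis.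
Import numFieldNormedType.Exports.
Local Open Scope classical_set_scope.

(** * From plane embeddings to excluded minors *)

(** The points related to [x] form a subset open and closed in [A]. This turns local straight steps
    into polygonal chains. *)
Lemma connected_related (T : topologicalType) (A : set T) (E : T -> T -> Prop) :
  connected A -> (forall x y z, E x y -> E y z -> E x z) ->
  (forall y, A y -> \forall z \near y, A z -> E y z /\ E z y) ->
  forall x y, A x -> A y -> E x y.
Proof.
move=> Ac tr loc x y Ax Ay.
pose B := A `&` [set z | E x z].
suff: B y by case.
suff -> : B = A by [].
apply: Ac.
- exists x; split=> //=.
  by have [] := nbhs_singleton (loc x Ax) Ax.
- exists [set z | A z -> E x z]°; first exact: open_interior.
  apply/seteqP; split=> z [Az]; last by move=> /interior_subset /(_ Az).
  move=> /= xz; split=> //; apply: filterS (loc z Az) => w /= h Aw.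
  by apply: tr xz _; case: (h Aw).
- exists (~` [set z | A z -> ~ E x z]°).
    by apply: open_closedC; exact: open_interior.
  apply/seteqP; split=> z [Az] /=.
    by move=> xz; split=> // /interior_subset /(_ Az).
  move=> h; split=> //=; apply: contrapT => nxz; apply: h.
  apply: filterS (loc z Az) => w /= h Aw xw; apply: nxz.
  by apply: tr xw _; case: (h Aw).
Qed.

(** Stated for all small [d], so that finitely many such requirements can be met at once. *)
Lemma compact_apart (R : realType) (T : pseudoMetricType R) (K L : set T) :
  compact K -> closed L -> K `&` L = set0 ->
  \forall d \near (0 : R)^'+, forall x y, K x -> L y -> ~ ball x d y.
Proof.
move=> /compact_near_coveringP Kc Lc KL.
suff H : \forall d \near (0 : R)^'+, K `<=` (fun x => forall y, L y -> ~ ball x d y).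
  by apply: filterS H => d h x y Kx; apply: h.
apply: Kc => x Kx.
have nLx : nbhs x (~` L).
  apply: open_nbhs_nbhs; split; first exact: closed_openC.
  by move=> Lx; have : (K `&` L) x by []; rewrite KL.
have [e /= e0 he] := (nbhs_ballP _ _).1 nLx.
exists (ball x (e / 2), [set d : R | d < e / 2]) => /=.
  split; first by apply: nbhsx_ballx; rewrite divr_gt0.
  by apply: nbhs_right_lt; rewrite divr_gt0.
move=> [z d] /= [xz de] y Ly zy; apply: (he y) => //.
rewrite [e]splitr; apply: ball_triangle xz _.
by apply: le_ball zy; rewrite ltW.
Qed.

Lemma continuous_pair (X Y Z : topologicalType) (f : X -> Y) (g : X -> Z) :
  continuous f -> continuous g -> continuous (fun x => (f x, g x)).
Proof. by move=> cf cg x; apply: cvg_pair; [exact: cf|exact: cg]. Qed.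

(** * Polygonal chains in open sets and along connected sets *)

Section PlaneChains.
Variable R : realType.
Notation pt := (R * R)%type.
Implicit Types (p q x y z u v w : pt) (P Q : seq pt).

Lemma on_segl p q : on_seg p q p.
Proof. by exists 0; split; rewrite ?mul0r ?addr0 //; lra. Qed.

Lemma on_segr p q : on_seg p q q.
Proof. by exists 1; split; rewrite ?mul1r ?subrKC //; lra. Qed.

Lemma ball_seg p q z (r : R) : ball p r q -> on_seg p q z -> ball p r z.
Proof.
move=> [/= h1 h2] [a [a0 a1 e1 e2]]; split=> /=; rewrite -ball_normE /= in h1 h2 *.
  rewrite e1 opprD addNKr normrN normrM ger0_norm // distrC.
  apply: le_lt_trans h1; rewrite -[leRHS]mul1r distrC; apply: ler_wpM2r => //.
rewrite e2 opprD addNKr normrN normrM ger0_norm // distrC.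
apply: le_lt_trans h2; rewrite -[leRHS]mul1r distrC; apply: ler_wpM2r => //.
Qed.

Lemma on_chain1 p q z : on_chain p [:: q] z -> on_seg p q z.
Proof. by case=> e; rewrite inE => /eqP ->. Qed.

Lemma on_chain_cat u P Q z :
  on_chain u (P ++ Q) z -> on_chain u P z \/ on_chain (last u P) Q z.
Proof.
elim: P u => [|v P IH] u /=; first by right.
case=> e; rewrite inE => /predU1P[->|eP] ez.
  by left; exists (u, v); rewrite // inE eqxx.
have [|[d dP dz]|h] := IH v; first by exists e.
  by left; exists d; rewrite // inE dP orbT.
by right.
Qed.

Lemma on_chain_node u P p : P != [::] -> p \in u :: P -> on_chain u P p.
Proof.
elim: P u => // v P IH u _; rewrite inE => /predU1P[->|pP].
  by exists (u, v); [rewrite inE eqxx|apply: on_segl].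
case: (altP (P =P [::])) => [P0|Pn].
  move: pP; rewrite P0 inE => /eqP ->.
  by exists (u, v); [rewrite inE eqxx|apply: on_segr].
by have [e eP ez] := IH v Pn pP; exists e; rewrite // inE eP orbT.
Qed.

Lemma on_chain_compact u P : compact (on_chain u P).
Proof.
elim: P u => [|v P IH] u.
  rewrite (_ : on_chain u [::] = set0); first exact: compact0.
  by apply/seteqP; split=> z; case.
have -> : on_chain u (v :: P) = on_seg u v `|` on_chain v P.
  apply/seteqP; split=> z.
    by move=> /(@on_chain_cat u [:: v] P)[/on_chain1|]; [left|right].
  case=> [uvz|[e eP ez]]; first by exists (u, v); rewrite // inE eqxx.
  by exists e; rewrite // inE eP orbT.
apply: compactU => //.
pose g (a : R) : pt := (u.1 + a * (v.1 - u.1), u.2 + a * (v.2 - u.2)).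
have -> : on_seg u v = g @` `[0, 1].
  apply/seteqP; split=> z.
    case=> a [a0 a1 e1 e2]; exists a; first by rewrite /= in_itv /= a0.
    by apply: injective_projections.
  by case=> a; rewrite /= in_itv /= => /andP[a0 a1] <-; exists a.
apply: continuous_compact; last exact: segment_compact.
apply: continuous_subspaceT; apply: continuous_pair => a.
  by apply: cvgD; [exact: cvg_cst|apply: cvgM; [exact: cvg_id|exact: cvg_cst]].
by apply: cvgD; [exact: cvg_cst|apply: cvgM; [exact: cvg_id|exact: cvg_cst]].
Qed.

Lemma open_chain (O F : set pt) : open O -> connected F -> F `<=` O ->
  forall x y, F x -> F y ->
    exists2 P, last x P = y & on_chain x P `<=` O.
Proof.
move=> Oo Fc FO; apply: (connected_related Fc).
  move=> x y z [P Py PO] [Q Qz QO]; exists (P ++ Q); first by rewrite last_cat Py.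
  by move=> w /on_chain_cat[/PO|]; rewrite ?Py => // /QO.
move=> y Fy; have [r /= r0 hr] := (nbhs_ballP _ _).1 (open_nbhs_nbhs (conj Oo (FO y Fy))).
near=> z => Fz; have yz : ball y r z by near: z; exact: nbhsx_ballx.
split; [exists [:: z] => // w /on_chain1 h|exists [:: y] => // w /on_chain1 /on_segC h].
  by apply: hr; apply: ball_seg h.
by apply: hr; apply: ball_seg h.
Unshelve. all: by end_near. Qed.

(** The chain steps straight between points of [A] that are less than [d] apart; only connectedness
    of the curve matters, not its parametrization. *)
Lemma thin_chain (A : set pt) (d : R) : 0 < d -> connected A ->
  forall x y, A x -> A y -> exists2 P, last x P = y &
    forall z, on_chain x P z -> exists2 w, A w & ball w d z.
Proof.
move=> d0 Ac; apply: (connected_related Ac).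
  move=> x y z [P Py PA] [Q Qz QA]; exists (P ++ Q); first by rewrite last_cat Py.
  by move=> w /on_chain_cat[/PA|]; rewrite ?Py => // /QA.
move=> y Ay; near=> z => Az.
have yz : ball y d z by near: z; exact: nbhsx_ballx.
split; [exists [:: z] => // w /on_chain1 h|exists [:: y] => // w /on_chain1 /on_segC h].
  by exists y => //; apply: ball_seg h.
by exists y => //; apply: ball_seg h.
Unshelve. all: by end_near. Qed.

End PlaneChains.

(** * From arcs to polygonal drawings of minors *)

Section Drawing.
Variables (R : realType) (G : sgraph).
Notation pt := (R * R)%type.

Lemma chains_apartC (u : pt) P w Q : chains_apart u P w Q -> chains_apart w Q u P.
Proof.
case=> h1 h2; split=> [p q hp hq|z hp hq]; last exact: h2 hq hp.
by rewrite eq_sym; apply: h1.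
Qed.

Lemma chains_apart_on (u : pt) P w Q : P != [::] -> Q != [::] ->
  (forall z, on_chain u P z -> on_chain w Q z -> False) -> chains_apart u P w Q.
Proof.
move=> P0 Q0 h; split=> // p q hp hq; apply/eqP => pq; apply: (h p).
  exact: on_chain_node.
by rewrite pq; apply: on_chain_node.
Qed.

Lemma edgesP (E : {set G}) : E \in edges G -> exists u v, adj u v /\ E = [set u; v]%SET.
Proof. by case/imsetP => -[u v]; rewrite inE /= => uv ->; exists u, v. Qed.

Lemma edge_in (u v : G) : adj u v -> [set u; v]%SET \in edges G.
Proof. by move=> uv; apply/imsetP; exists (u, v); rewrite ?inE. Qed.

Variables (pos : G -> pt) (arc : {set G} -> R -> pt).
Hypothesis emb : plane_embedding pos arc.

Definition curve (E : {set G}) : set pt := arc E @` `[0, 1].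

Lemma curve_compact E : E \in edges G -> compact (curve E).
Proof.
by move=> EG; apply: continuous_compact; [exact: arc_continuous emb _ EG|exact: segment_compact].
Qed.

Lemma curve_connected E : E \in edges G -> connected (curve E).
Proof.
move=> EG; apply: connected_continuous_connected; last exact: arc_continuous emb _ EG.
exact: segment_connected.
Qed.

Lemma curve_pos E v : E \in edges G -> v \in E -> curve E (pos v).
Proof.
move=> EG vE; have : (pos @` [set` E]) (pos v) by exists v.
rewrite -(arc_ends emb EG) => -[->|->]; [exists 0|exists 1] => //=;
by rewrite in_itv /= ler01 lexx.
Qed.

Lemma curve_cases E z : E \in edges G -> curve E z ->
  (exists2 v, v \in E & z = pos v) \/ (arc E @` `]0, 1[) z.
Proof.
move=> EG [t]; rewrite /= in_itv /= => /andP[t0 t1] <-.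
have endp s : s = 0 \/ s = 1 -> exists2 v, v \in E & arc E s = pos v.
  move=> h; have : (pos @` [set` E]) (arc E s).
    by rewrite -(arc_ends emb EG); case: h => ->; [left|right].
  by case=> v vE <-; exists v.
have [->|tn0] := eqVneq t 0; first by left; apply: endp; left.
have [->|tn1] := eqVneq t 1; first by left; apply: endp; right.
by right; exists t => //=; rewrite in_itv /= !lt_neqAle tn1 t1 t0 eq_sym tn0.
Qed.

Lemma curve_vertex E v : E \in edges G -> curve E (pos v) -> v \in E.
Proof.
move=> EG /(curve_cases EG)[[w wE /(pos_inj emb) -> //]|h].
have : (arc E @` `]0, 1[ `&` range pos) (pos v) by split=> //; exists v.
by rewrite (arc_avoids_vertices emb EG).
Qed.

Lemma curves_disjoint E E' : E \in edges G -> E' \in edges G ->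
  (forall v, v \in E -> v \in E' -> False) -> curve E `&` curve E' = set0.
Proof.
move=> EG EG' dis; apply/seteqP; split=> // z [zE zE'].
have [[v vE zv]|h] := curve_cases EG zE.
  have vE' : v \in E' by apply: curve_vertex => //; rewrite -zv.
  by case: (dis v).
have [[v vE' zv]|h'] := curve_cases EG' zE'.
  have vE : v \in E by apply: curve_vertex => //; rewrite -zv.
  by case: (dis v).
have EE' : E != E'.
  apply/eqP => EE'; have [u [v [_ Euv]]] := edgesP EG.
  have uE : u \in E by rewrite Euv !inE eqxx.
  by apply: (dis u) => //; rewrite -EE'.
by rewrite -(arcs_disjoint emb EG EG' EE').
Qed.

Definition off_curves : set pt := [set x | forall E, E \in edges G -> ~ curve E x].

Lemma off_curves_near (P : {set G} -> Prop) x :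
  (forall E, E \in edges G -> P E -> ~ curve E x) ->
  \forall y \near x, forall E, E \in edges G -> P E -> ~ curve E y.
Proof.
move=> h; apply: (@filter_forall _ {set G}
  (fun E y => E \in edges G -> P E -> ~ curve E y) (nbhs x) (nbhs_filter x)) => E.
have [EG|nEG] := boolP (E \in edges G); last by apply: filterE.
have [PE|nPE] := pselect (P E); last by apply: filterE.
have : nbhs x (~` curve E).
  apply: open_nbhs_nbhs; split; last exact: h.
  apply: closed_openC; apply: compact_closed (curve_compact EG).
  exact: norm_hausdorff.
by apply: filterS.
Qed.

Lemma off_curves_open : open off_curves.
Proof.
rewrite openE => x hx; have := @off_curves_near (fun=> True) x.
move=> /(_ (fun E EG _ => hx E EG)); apply: filterS => y h E EG.
exact: h.
Qed.

(** The chain stays off all curves until it is so close to [pos v] that a last straight step can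
    meet only curves of edges at [v]. Those meetings are harmless, as only edges without common
    endpoint are compared. *)
Lemma spoke_chain F f v : connected F -> F `<=` off_curves -> F f ->
  closure F (pos v) ->
  exists P, [/\ P != [::], last f P = pos v &
    forall E, E \in edges G -> v \notin E -> on_chain f P `&` curve E = set0].
Proof.
move=> Fc FO Ff clF.
have [E EG vE|r /= r0 hr] := (nbhs_ballP _ _).1 (@off_curves_near (fun E => v \notin E) (pos v) _).
  by move=> /(curve_vertex EG); apply/negP.
have [w [Fw vw]] := clF _ (nbhsx_ballx (pos v) r r0).
have [P Pw PO] := open_chain off_curves_open Fc FO Ff Fw.
exists (P ++ [:: pos v]); split; [by case: (P)|by rewrite last_cat|].
move=> E EG vE; apply/seteqP; split=> // z [] /on_chain_cat[/PO/(_ E EG)//|].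
rewrite Pw => /on_chain1/on_segC h; apply: hr EG vE.
exact: ball_seg h.
Qed.

Lemma path_chain (X : {set G}) (d : R) x p : 0 < d ->
  path (inner (@adj G) X) x p -> p != [::] ->
  exists P, [/\ P != [::], last (pos x) P = pos (last x p) &
    forall z, on_chain (pos x) P z -> exists E, [/\ E \in edges G, E \subset X
      & exists2 w, curve E w & ball w d z]].
Proof.
move=> d0; elim: p x => // y p IH x /= /andP[/and3P[xy xX yX] yp] _.
have EG := edge_in xy.
have [P Py PE] : exists2 P, last (pos x) P = pos y & forall z, on_chain (pos x) P z ->
    exists2 w, curve [set x; y]%SET w & ball w d z.
  apply: thin_chain => //; first exact: curve_connected.
    by apply: curve_pos => //; rewrite !inE eqxx.
  by apply: curve_pos => //; rewrite !inE eqxx orbT.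
have P0 : P != [::].
  apply/eqP => P0; move: Py; rewrite P0 /= => /(pos_inj emb) xy'.
  by move: xy; rewrite xy' adj_irr.
have PX z : on_chain (pos x) P z -> exists E, [/\ E \in edges G, E \subset X
      & exists2 w, curve E w & ball w d z].
  move=> /PE h; exists [set x; y]%SET; split=> //.
  by apply/fintype.subsetP => u; rewrite !inE => /orP[]/eqP->.
have [p0|p0] := eqVneq p [::].
  by exists P; split=> //; rewrite p0.
have [Q [Q0 Qy QX]] := IH y yp p0.
exists (P ++ Q); split; first by case: (P) P0.
  by rewrite last_cat Py.
by move=> z /on_chain_cat[/PX//|]; rewrite Py => /QX.
Qed.

(** Index 0 is the point [f] of the face, any other index a branch set represented by one of its
    vertices. Edges from 0 are spokes; the others follow paths inside the union of two branch sets,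
    so independent ones use edges of [G] without common endpoints. *)
Lemma outer_drawing (F : set pt) f (B : nat -> {set G}) (Es : seq (nat * nat)) :
  connected F -> F `<=` off_curves -> F f -> (forall v, closure F (pos v)) ->
  (forall i j v, i != j -> v \in B i -> v \in B j -> False) ->
  (forall e, e \in Es -> (0 < e.2)%N /\ linked (@adj G) (B e.2)) ->
  (forall e, e \in Es -> (0 < e.1)%N ->
     [/\ e.1 != e.2, linked (@adj G) (B e.1) & touch (@adj G) (B e.1) (B e.2)]) ->
  exists (c : nat -> pt) (ch : nat * nat -> seq pt),
    (forall e, e \in Es -> last (c e.1) (ch e) = c e.2) /\
    (forall e f, e \in Es -> f \in Es -> indep e f ->
     chains_apart (c e.1) (ch e) (c f.1) (ch f)).
Proof.
move=> Fc FO Ff clF disB hB2 hB1.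
have [Gam GamP] := boolp.choice (fun v => spoke_chain Fc FO Ff (clF v)).
(* [d] bounds from below the distance of a spoke from the curves it avoids and that of the curves of
   two edges without common endpoint. *)
have : \forall d \near (0 : R)^'+, (forall v E x y, E \in edges G -> v \notin E ->
      on_chain f (Gam v) x -> curve E y -> ~ ball x d y) /\
    (forall E E' x y, E \in edges G -> E' \in edges G ->
      (forall v, v \in E -> v \in E' -> False) ->
      curve E x -> curve E' y -> ~ ball x d y).
  have closed_curve E : E \in edges G -> closed (curve E).
    by move=> EG; apply: compact_closed (curve_compact EG); exact: norm_hausdorff.
  near=> d; split.
    move=> v E x y EG vE.
    suff : forall v E, E \in edges G -> v \notin E ->
      forall x y, on_chain f (Gam v) x -> curve E y -> ~ ball x d y by apply.
    near: d.
    apply: (@filter_forall _ G) => {}v; apply: (@filter_forall _ {set G}) => {}E.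
    have [EG'|] := boolP (E \in edges G); last by move=> _; apply: filterE.
    have [vE'|] := boolP (v \notin E); last by move=> _; apply: filterE.
    have := compact_apart (@on_chain_compact R f (Gam v)) (closed_curve E EG').
    have [_ _ h] := GamP v; move=> /(_ (h E EG' vE')).
    by apply: filterS => x hx _ _; exact: hx.
  move=> E E' x y EG EG' dis.
  suff : forall E E', E \in edges G -> E' \in edges G ->
    (forall v, v \in E -> v \in E' -> False) ->
    forall x y, curve E x -> curve E' y -> ~ ball x d y by apply.
  near: d.
  apply: (@filter_forall _ {set G}) => {}E; apply: (@filter_forall _ {set G}) => {}E'.
  have [{}EG|] := boolP (E \in edges G); last by move=> _; apply: filterE.
  have [{}EG'|] := boolP (E' \in edges G); last by move=> _; apply: filterE.
  have [{}dis|nd] := pselect (forall v, v \in E -> v \in E' -> False); last by apply: filterE.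
  have := compact_apart (curve_compact EG) (closed_curve E' EG') (curves_disjoint EG EG' dis).
  by apply: filterS => x hx _ _ _; exact: hx.
move=> /(filterI (nbhs_right_gt 0)) /filter_ex[d [/= d0 [sepv sepe]]].
(* A point within [d / 2] of two curves would bring these closer than [d]. *)
have d20 : 0 < d / 2 by rewrite divr_gt0.
have hv0 : exists v0 : nat -> option G, forall i, linked (@adj G) (B i) ->
    exists2 v, v0 i = Some v & v \in B i.
  exists (fun i => [pick v in B i]) => i [/set0Pn[v vB] _].
  by case: pickP => [w wB|/(_ v)]; [exists w|rewrite vB].
have [v0 v0P] := hv0.
pose c i := if i == 0%N then f else if v0 i is Some v then pos v else f.
have hch e : exists P : seq pt, e \in Es -> [/\ P != [::], last (c e.1) P = c e.2 &
    if e.1 == 0%N then exists v, [/\ v \in B e.2, c e.1 = f & P = Gam v]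
    else forall z, on_chain (c e.1) P z -> exists E,
      [/\ E \in edges G, E \subset B e.1 :|: B e.2 & exists2 w, curve E w & ball w (d / 2) z]].
  have [eE|neE] := boolP (e \in Es); last by exists [::].
  have [e20 l2] := hB2 e eE; have [v2 cv2 v2B] := v0P _ l2.
  have ce2 : c e.2 = pos v2 by rewrite /c gtn_eqF // cv2.
  have [e10|e10] := eqVneq e.1 0%N.
    exists (Gam v2) => _; have [G0 Gl _] := GamP v2.
    by rewrite ce2 {1}/c e10 eqxx; split=> //; exists v2; split=> //; rewrite /c.
  have [e12 l1 t12] := hB1 e eE ltac:(by rewrite lt0n).
  have [v1 cv1 v1B] := v0P _ l1.
  have ce1 : c e.1 = pos v1 by rewrite /c (negPf e10) cv1.
  have [_ lU] := linkedU (@adj_sym G) l1 l2 t12.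
  have /connectP[p pp pl] := lU v1 v2 ltac:(by rewrite inE v1B) ltac:(by rewrite inE v2B orbT).
  have p0 : p != [::].
    by apply/eqP => p0; apply: (disB _ _ v1 e12 v1B); rewrite p0 in pl; rewrite -[v1]pl.
  have [P [P0 Pl PX]] := path_chain d20 pp p0.
  by exists P => _; rewrite ce1 ce2 pl.
have [ch chP] := boolp.choice hch.
exists c, ch; split=> [e /chP[] //|].
have spoke_apart e g : e \in Es -> g \in Es -> indep e g -> e.1 = 0%N ->
    chains_apart (c e.1) (ch e) (c g.1) (ch g).
  move=> eE gE /and4P[eg1 eg2 eg3 eg4] e0.
  have [P0 _] := chP e eE; rewrite {1}e0 eqxx => -[v [vB cf Pv]].
  have g0 : g.1 != 0%N by rewrite -e0 eq_sym.
  have [Q0 _] := chP g gE; rewrite (negPf g0) => QX.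
  apply: chains_apart_on => // z hz /QX[E [EG EB [w wE wz]]].
  apply: (sepv v E z w EG) => //.
  - apply/negP => vE; move/fintype.subsetP: EB => /(_ v vE); rewrite inE => /orP[].
      exact: disB vB.
    exact: disB vB.
  - by rewrite -Pv -cf.
  - apply: ball_sym; apply: le_ball wz; rewrite ler_pdivrMr //.
    by rewrite ler_pMr // ler1n.
move=> e g eE gE eg; have [e0|e0] := eqVneq e.1 0%N; first exact: spoke_apart.
have ge : indep g e.
  by move: eg; rewrite /indep => /and4P[? ? ? ?]; apply/and4P; split; rewrite eq_sym.
have [g0|g0] := eqVneq g.1 0%N; first by apply: chains_apartC; apply: spoke_apart.
move: (chP e eE) (chP g gE); rewrite (negPf e0) (negPf g0) => -[P0 _ PX] [Q0 _ QX].
apply: chains_apart_on => // z /PX[E [EG EB [w wE wz]]] /QX[E' [EG' EB' [w' wE' wz']]].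
apply: (sepe E E' w w' EG EG') => //.
  move=> v /(fintype.subsetP EB) + /(fintype.subsetP EB').
  case/and4P: eg => eg1 eg2 eg3 eg4.
  by rewrite !inE => /orP[]h1 /orP[]; apply: disB h1.
rewrite [d]splitr; apply: ball_triangle wz _; exact: ball_sym.
Unshelve. all: by end_near. Qed.
End Drawing.

Section OuterplanarMinors.
Variables (R : realType) (G : sgraph).
Hypothesis opG : outerplanar R G.

Lemma outerplanar_K4_free : K4_free (@adj G).
Proof.
move: opG => [pos [arc [emb [F [[p pD ->] _] clF]]]] A B C D [lA lB lC lD] dis [tAB tAC tAD] [tBC tBD tCD].
pose Bs := nth finset.set0 [:: finset.set0; A; B; C; D].
pose Es := [:: (0, 1); (0, 2); (0, 3); (0, 4); (1, 2); (1, 3); (1, 4); (2, 3); (2, 4); (3, 4)]%N.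
have [|||||||c [ch [h1 h2]]] := @outer_drawing R G pos arc emb
    (connected_component (~` drawing pos arc) p) p Bs Es.
- exact: component_connected.
- move=> x /connected_component_sub xD E EG xE; apply: xD; right.
  by exists E.
- exact: connected_component_refl.
- by move=> v; have [] := clF v.
- move=> i j v; rewrite /Bs; apply: disj_nth; rewrite pairwise_disj0; exact: dis.
- by move=> e; rewrite !inE; do ![case/orP]; move/eqP=> -> /=.
- by move=> e; rewrite !inE; do ![case/orP]; move/eqP=> -> //=.
exact: K5_not_planar h1 h2.
Qed.

(** The point of the outer face, [A] and [B] are one side of the K33, at indices 0, 1, 2; [X], [Y],
    [Z] are the other. *)
Lemma outerplanar_K23_free : K23_free (@adj G).
Proof.
move: opG => [pos [arc [emb [F [[p pD ->] _] clF]]]] A B X Y Z [lA lB lX lY lZ] dis [tAX tAY tAZ] [tBX tBY tBZ].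
pose Bs := nth finset.set0 [:: finset.set0; A; B; X; Y; Z].
pose Es := [:: (0, 3); (0, 4); (0, 5); (1, 3); (1, 4); (1, 5); (2, 3); (2, 4); (2, 5)]%N.
have [|||||||c [ch [h1 h2]]] := @outer_drawing R G pos arc emb
    (connected_component (~` drawing pos arc) p) p Bs Es.
- exact: component_connected.
- move=> x /connected_component_sub xD E EG xE; apply: xD; right.
  by exists E.
- exact: connected_component_refl.
- by move=> v; have [] := clF v.
- move=> i j v; rewrite /Bs; apply: disj_nth; rewrite pairwise_disj0; exact: dis.
- by move=> e; rewrite !inE; do ![case/orP]; move/eqP=> -> /=.
- by move=> e; rewrite !inE; do ![case/orP]; move/eqP=> -> //=.
exact: K33_not_planar h1 h2.
Qed.

End OuterplanarMinors.

(** * Straight-line drawings on a parabola *)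

Section NatGraph.
Variables (n : nat) (g : rel nat).

Definition nat_adj : rel 'I_n :=
  fun i j => ((i < j)%N && g i j) || ((j < i)%N && g j i).

Lemma nat_adj_sym : symmetric nat_adj.
Proof. by move=> i j; rewrite /nat_adj orbC. Qed.

Lemma nat_adj_irr : irreflexive nat_adj.
Proof. by move=> i; rewrite /nat_adj ltnn. Qed.

Definition nat_graph : sgraph := SGraph nat_adj_sym nat_adj_irr.

Lemma nat_edgesP (E : {set nat_graph}) : E \in edges nat_graph ->
  exists a b : 'I_n, [/\ (a < b)%N, g a b & E = [set a; b]%SET].
Proof.
case/edgesP => u [v [/orP[]/andP[uv ext_edge] ->]]; first by exists u, v.
by exists v, u; split=> //; rewrite finset.setUC.
Qed.
End NatGraph.

Section ParabolaDrawing.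
Variables (R : realType) (n : nat) (g : rel nat).
Hypothesis nocross : forall a b c d : nat, (a < b)%N -> (b < c)%N -> (c < d)%N ->
  (d < n)%N -> g a c -> g b d -> False.
Notation G := (nat_graph n g).
Notation pt := (R * R)%type.

Definition parab (i : nat) : pt := (i%:R, i%:R ^+ 2).

Definition chord (a b : nat) (t : R) : pt :=
  (a%:R + t * (b%:R - a%:R), a%:R ^+ 2 + t * (b%:R ^+ 2 - a%:R ^+ 2)).

(** An edge is an unordered pair, so its ends are recovered as the maximum and the sum minus the
    maximum. *)
Definition hi_end (E : {set 'I_n}) : nat := \max_(i in E) i.
Definition lo_end (E : {set 'I_n}) : nat := (\sum_(i in E) i - hi_end E)%N.

Lemma ends_pair (a b : 'I_n) : (a < b)%N ->
  lo_end [set a; b]%SET = a /\ hi_end [set a; b]%SET = b.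
Proof.
move=> ab; have ne : a \notin [set b]%SET by rewrite !inE -val_eqE /= ltn_eqF.
rewrite /lo_end /hi_end !big_setU1 //= !big_set1 (maxn_idPr (ltnW ab)).
by rewrite addnK.
Qed.

Definition parab_pos (i : G) : pt := parab (i : 'I_n).
Definition parab_arc (E : {set G}) (t : R) : pt := chord (lo_end E) (hi_end E) t.

Lemma parab_arcE (a b : 'I_n) t : (a < b)%N -> parab_arc [set a; b]%SET t = chord a b t.
Proof. by move=> ab; rewrite /parab_arc; have [-> ->] := ends_pair ab. Qed.

Lemma parab_inj : injective parab.
Proof. by move=> i j [/eqP]; rewrite eqr_nat => /eqP. Qed.

(** The height of a chord point above the parabola; its factored form settles both the disjointness
    of chords and their position above the curve. *)
Lemma chord_lift a b t :
  (chord a b t).2 - (chord a b t).1 ^+ 2 =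
  ((chord a b t).1 - a%:R) * (b%:R - (chord a b t).1).
Proof. by rewrite /chord /=; ring. Qed.

Lemma chord_x a b t : (a < b)%N -> 0 < t < 1 -> a%:R < (chord a b t).1 < b%:R.
Proof.
move=> ab /andP[t0 t1]; have : (a%:R : R) < b%:R by rewrite ltr_nat.
rewrite /chord /= => ab'; apply/andP; split; nra.
Qed.

Lemma chord_x_le a b t : (a < b)%N -> 0 <= t <= 1 -> a%:R <= (chord a b t).1 <= b%:R.
Proof.
move=> ab /andP[t0 t1]; have : (a%:R : R) < b%:R by rewrite ltr_nat.
rewrite /chord /= => ab'; apply/andP; split; nra.
Qed.

(** Over a common x two noncrossing chords are nested, and the inner one is strictly lower there by
    the product formula for the height. *)
Lemma chords_disjoint (a b c d : nat) t s : (a < c)%N -> (b < d)%N -> (c < n)%N ->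
  (d < n)%N -> g a c -> g b d -> (a, c) <> (b, d) -> 0 < t < 1 -> 0 < s < 1 ->
  chord a c t = chord b d s -> False.
Proof.
wlog ab : a b c d t s / (a <= b)%N.
  move=> h ac bd cn dn gac gbd ne t01 s01 e.
  case: (leqP a b) => [ab|/ltnW ba]; first exact: (h a b c d t s ab).
  apply: (h b a d c s t ba) => //.
  by move=> [? ?]; apply: ne; congr pair.
move=> ac bd cn dn gac gbd ne t01 s01 e.
have := chord_lift a c t; have := chord_lift b d s; have := chord_x ac t01; have := chord_x bd s01.
rewrite -e; move: (chord a c t).1 (chord a c t).2 => x y /andP[bx xd] /andP[ax xc] -> /eqP.
have [eab|nab] := eqVneq a b.
  rewrite eab -subr_eq0 -mulrBr mulf_eq0 => /orP[/eqP|/eqP]; first by lra.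
  move=> h; apply: ne; rewrite eab; congr pair.
  by apply/eqP; rewrite -(eqr_nat R); apply/eqP; lra.
have {nab}ab : (a < b)%N by rewrite ltn_neqAle nab.
have ab' : (a%:R : R) < b%:R by rewrite ltr_nat.
have bc : (b < c)%N by rewrite -(ltr_nat R); lra.
have dc : (d <= c)%N by rewrite leqNgt; apply/negP => cd; apply: (nocross ab bc cd dn).
have dc' : (d%:R : R) <= c%:R by rewrite ler_nat.
move/eqP; nra.
Qed.

Lemma parab_embedding : plane_embedding parab_pos parab_arc.
Proof.
split.
- by move=> i j /parab_inj /val_inj.
- move=> E _; apply: continuous_subspaceT; apply: continuous_pair => t.
    by apply: cvgD; [exact: cvg_cst|apply: cvgM; [exact: cvg_id|exact: cvg_cst]].
  by apply: cvgD; [exact: cvg_cst|apply: cvgM; [exact: cvg_id|exact: cvg_cst]].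
- move=> E /nat_edgesP[a [b [ab _ ->]]] t s _ _; rewrite !parab_arcE // => -[/addrI + _].
  apply: mulIf; rewrite subr_eq0 eqr_nat; lia.
- move=> E /nat_edgesP[a [b [ab _ ->]]]; rewrite !parab_arcE //.
  have -> : chord a b 0 = parab a by rewrite /chord /parab !mul0r !addr0.
  have -> : chord a b 1 = parab b by rewrite /chord /parab !mul1r !subrKC.
  apply/seteqP; split=> z.
    by case=> ->; [exists a|exists b]; rewrite // /= !inE eqxx ?orbT.
  by case=> w; rewrite /= !inE => /orP[]/eqP-> <-; [left|right].
- move=> E /nat_edgesP[a [b [ab _ ->]]]; apply/seteqP; split=> // z [[t]].
  rewrite /= in_itv /= => t01; rewrite parab_arcE // => <- [v _ ve].
  have /andP[h1 h2] := chord_x ab t01; have := chord_lift a b t.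
  rewrite -ve /parab_pos /parab /= subrr => /esym/eqP; rewrite -ve /= in h1 h2.
  by rewrite mulf_eq0 => /orP[]/eqP; lra.
- move=> E E' /nat_edgesP[a [c [ac gac ->]]] /nat_edgesP[b [d [bd gbd ->]]] ne.
  apply/seteqP; split=> // z [[t]]; rewrite /= in_itv /= => t01.
  rewrite parab_arcE // => <- [s]; rewrite /= in_itv /= => s01.
  rewrite parab_arcE // => e.
  apply: (chords_disjoint bd ac _ _ gbd gac _ s01 t01 e) => // -[eb ed].
  by move: ne; rewrite (val_inj eb) (val_inj ed) eqxx.
Qed.

Definition below : set pt := [set p | p.2 < p.1 ^+ 2].

(** The region is the union of vertical rays, each joined to the line y = -1. *)
Lemma below_connected : connected below.
Proof.
pose V x : set pt := [set (x, y) | y in `]-oo, x ^+ 2[] `|` [set (z, -1) | z in [set: R]].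
have -> : below = \bigcup_(x in [set: R]) V x.
  apply/seteqP; split=> [[x y] /= h|p [x _ []]].
  - by exists x => //; left; exists y => //=; rewrite in_itv.
  - by case=> y /=; rewrite in_itv /= => h <-.
  - by case=> z _ <-; rewrite /below /=; have := sqr_ge0 z; lra.
apply: bigcup_connected.
  by exists (0, -1) => x _; right; exists 0.
move=> x _; apply: connectedU.
- exists (x, -1); split; last by exists x.
  by exists (-1) => //=; rewrite in_itv /=; have := sqr_ge0 x; lra.
- apply: connected_continuous_connected.
    apply/connected_intervalP; exact: interval_is_interval.
  apply: continuous_subspaceT; apply: continuous_pair => y; [exact: cvg_cst|exact: cvg_id].
- apply: connected_continuous_connected.
    by apply/connected_intervalP => ? ? ? ?.
  apply: continuous_subspaceT; apply: continuous_pair => y; [exact: cvg_id|exact: cvg_cst].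
Qed.

Lemma below_off_drawing : below `<=` ~` drawing parab_pos parab_arc.
Proof.
move=> p pb []; first by case=> i _ e; move: pb; rewrite -e /below /= ltxx.
case=> E /= /nat_edgesP[a [b [ab _ ->]]] [t]; rewrite /= in_itv /= => t01.
rewrite parab_arcE // => e; have /andP[h1 h2] := chord_x_le ab t01.
have : 0 <= ((chord a b t).1 - a%:R) * (b%:R - (chord a b t).1).
  by rewrite mulr_ge0 // subr_ge0.
by rewrite -chord_lift e subr_ge0 leNgt => /negP; apply.
Qed.

Lemma nat_graph_outerplanar : outerplanar R G.
Proof.
exists parab_pos, parab_arc; split; first exact: parab_embedding.
have b0 : below (0, -1) by rewrite /below /= expr0n /=; lra.
have sub : below `<=` connected_component (~` drawing parab_pos parab_arc) (0, -1).
  apply: connected_component_max => //; [exact: below_off_drawing|exact: below_connected].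
exists (connected_component (~` drawing parab_pos parab_arc) (0, -1)).
  split; first by exists (0, -1) => //; apply: below_off_drawing.
  move=> /ex_strict_bound_gt0[M /= M0 hM].
  have := hM (0, - M); rewrite ltNge => /(_ _)/negP; apply.
    by apply: sub; rewrite /below /= expr0n /=; lra.
  by rewrite prod_normE /= normrN le_max ler_norm orbT.
move=> i; split.
  move=> B /nbhs_ballP[r /= r0 hr].
  exists ((parab_pos i).1, (parab_pos i).2 - r / 2); split.
    by apply: sub; rewrite /below /=; lra.
  apply: hr; split => /=; first exact: ballxx.
  by rewrite -ball_normE /= opprB addrC subrK ger0_norm; lra.
by move=> /interior_subset /connected_component_sub; apply; left; exists i.
Qed.

End ParabolaDrawing.

(** * The outerplanar Turan number of cycles *)

Section FinalBounds.
Local Open Scope nat_scope.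

(** Ranks with gaps become the consecutive positions on which the edge count works. *)
Lemma ordered_enum (T : finType) (r : T -> nat) (x0 : T) : injective r ->
  exists v : nat -> T, (forall i j, i < j -> j < #|T| -> r (v i) < r (v j)) /\
    (forall x, exists2 i, i < #|T| & v i = x).
Proof.
move=> inj; pose s := sort (relpre r leq) (enum T).
have sT : size s = #|T| by rewrite size_sort cardE.
have us : uniq s by rewrite sort_uniq enum_uniq.
have ss : sorted (relpre r leq) s by apply: sort_sorted => x y; exact: leq_total.
exists (nth x0 s); split=> [i j ij jT|x]; last first.
  by exists (index x s); rewrite ?nth_index // -?sT ?index_mem // mem_sort mem_enum.
have iT := ltn_trans ij jT; rewrite ltn_neqAle; apply/andP; split.
  by apply/eqP => /inj/eqP; rewrite nth_uniq ?sT // => /eqP; lia.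
have tr : transitive (relpre r leq) by move=> y x z; apply: leq_trans.
by apply: (sorted_leq_nth tr _ x0 ss) => //; rewrite ?inE ?sT ?(ltnW ij) // => x /=.
Qed.

Lemma sum_pairs (n : nat) (P : rel nat) :
  \sum_(i < n) \sum_(j < n) P i j = #|[set p : 'I_n * 'I_n | P p.1 p.2]%SET|.
Proof.
rewrite pair_big /= -sum1_card [RHS]big_mkcond /=.
by apply: eq_bigr => -[i j] _; rewrite inE /=; case: (P i j).
Qed.

Lemma closed_path_contains (G : sgraph) (n k : nat) (v : nat -> G) a p : 2 < k ->
  {in gtn n &, injective v} ->
  path (up (fun i j => adj (v i) (v j))) a p -> last a p < n ->
  adj (v a) (v (last a p)) -> size p = k.-1 -> contains (cycle_graph k) G.
Proof.
move=> k3 inj pp lp al sp.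
have sk : size (a :: p) = k by rewrite /= sp; lia.
have srt : sorted ltn (a :: p) by apply: sub_path pp => x y /andP[].
have mono i j : i < j -> j < k -> nth 0 (a :: p) i < nth 0 (a :: p) j.
  move=> ij jk; apply: (sorted_ltn_nth ltn_trans 0 srt) => //; rewrite inE sk //.
  exact: ltn_trans jk.
have lastE : nth 0 (a :: p) k.-1 = last a p by rewrite -sk /= nth_last.
have bnd i : i < k -> nth 0 (a :: p) i < n.
  move=> ik; have [e|ne] := eqVneq i k.-1; first by rewrite e lastE.
  by apply: ltn_trans lp; rewrite -lastE; apply: mono; lia.
exists (fun i : 'I_k => v (nth 0 (a :: p) i)); split.
  move=> i j /inj e; apply: val_inj; have {e} := e (bnd i (ltn_ord i)) (bnd j (ltn_ord j)).
  by case: (ltngtP i j) => // [/mono|/mono] /(_ (ltn_ord _)) h e; move: h; rewrite e ltnn.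
have step i : i < k -> adj (v (nth 0 (a :: p) i)) (v (nth 0 (a :: p) (i.+1 %% k))).
  move=> ik; have [e|ne] := eqVneq i.+1 k.
    by rewrite e modnn /= adj_sym -lastE in al *; rewrite -e /= in al *.
  have ik1 : i.+1 < k by lia.
  rewrite modn_small //; move/(pathP 0): pp => /(_ i); rewrite sp => /(_ _)/andP[|_ //].
  by lia.
move=> i j /andP[_ /orP[/eqP->|/eqP->]]; first exact: step.
by rewrite adj_sym; apply: step.
Qed.

Lemma num_edges_upper (R : realType) (n k : nat) (G : sgraph) : 2 < k -> k <= n ->
  #|G| = n -> outerplanar R G -> is_free (cycle_graph k) G ->
  (Posz (num_edges G) <= turan_value n k)%R.
Proof.
move=> k3 kn Gn opG freeG.
have [r [rinj rnc]] := noncrossing_order (@adj_sym G)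
  (outerplanar_K4_free opG) (outerplanar_K23_free opG).
have /card_gt0P[x0 _] : 0 < #|G| by lia.
have [v [vmono vsurj]] : exists v : nat -> G,
    (forall i j, i < j -> j < #|G| -> r (v i) < r (v j)) /\
    (forall x, exists2 i, i < #|G| & v i = x).
  by apply: ordered_enum x0 _ => x y; apply: rinj; rewrite !inE.
rewrite Gn in vmono vsurj; pose g i j := adj (v i) (v j).
have vinj : {in gtn n &, injective v}.
  move=> i j; rewrite !inE => iN jN e; case: (ltngtP i j) => // h.
    by have := vmono i j h jN; rewrite e ltnn.
  by have := vmono j i h iN; rewrite e ltnn.
have nocross a b c d : a < b -> b < c -> c < d -> d < n -> g a c -> g b d -> False.
  move=> ab bc cd dn; apply: (rnc (v a) (v b) (v c) (v d)); rewrite ?inE ?vmono //; lia.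
have nocycle a p : path (up g) a p -> last a p < n -> g a (last a p) -> size p <> k.-1.
  by move=> pp lp al sp; apply: freeG; apply: closed_path_contains pp lp al sp.
have n1 : 1 < n by lia.
have [L [B [h1 h2 h3]]] := edge_count_bound k3 nocross nocycle n1.
apply: (turan_upper k3 kn (L := L) (B := B)) => //; apply: leq_trans h1; rewrite leq_add2r.
rewrite /edge_cnt (sum_pairs n (fun i j => [&& 0 <= i, i < j, j <= n.-1 & g i j])).
set P := [set _ | _]%SET.
apply: leq_trans (leq_imset_card (fun p : 'I_n * 'I_n => [set v p.1; v p.2]%SET) (mem P)).
apply: subset_leq_card; apply/fintype.subsetP => E /edgesP[x [y [xy ->]]].
have [i iN ix] := vsurj x; have [j jN jy] := vsurj y.
case: (ltngtP i j) => ij; last by move: xy; rewrite -ix -jy ij adj_irr.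
  apply/imsetP; exists (Ordinal iN, Ordinal jN); rewrite /= ?ix ?jy //.
  by rewrite inE /= ij /g ix jy xy andbT; lia.
apply/imsetP; exists (Ordinal jN, Ordinal iN); rewrite /= ?ix ?jy //; last exact: finset.setUC.
by rewrite inE /= ij /g ix jy adj_sym xy andbT; lia.
Qed.

Lemma construction_free n k : 2 < k -> k <= n ->
  is_free (cycle_graph k) (nat_graph n (ext_edge n k)).
Proof.
move=> k3 kn [f [finj fadj]].
have k0 : 0 < k by lia.
(* The embedded cycle is unrolled to a periodic sequence. *)
pose h i : nat := (f (Ordinal (ltn_pmod i k0)) : 'I_n).
apply: (@no_k_cycle n k k3 kn h).
- by move=> i; rewrite /h; congr (nat_of_ord (f _)); apply: val_inj; rewrite /= modnDr.
- move=> i j ij jk; apply/eqP => /val_inj/finj/(congr1 val) /= e.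
  have : (j - i) %% k = 0 by apply/eqP; rewrite -/(dvdn k (j - i)) -eqn_mod_dvd ?e // ltnW.
  by rewrite modn_small; lia.
- move=> i; apply: fadj; rewrite /= /cycle_adj /=.
  have -> : (i %% k).+1 %% k = i.+1 %% k by rewrite -[in LHS]addn1 modnDml addn1.
  rewrite eqxx /= andbT.
  apply/eqP => /(congr1 val) /= e.
  have : (i.+1 - i) %% k = 0 by apply/eqP; rewrite -/(dvdn k (i.+1 - i)) -eqn_mod_dvd ?e.
  by rewrite modn_small; lia.
- by move=> i; apply: ltn_ord.
Qed.

Lemma construction_edges n k : 2 < k -> k <= n ->
  (turan_value n k <= Posz (num_edges (nat_graph n (ext_edge n k))))%R.
Proof.
move=> k3 kn; have n2 : 2 < n by lia.
have D0 : 0 < k * (k - 2) - 1.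
  by have : 3 * 1 <= k * (k - 2) by [apply: leq_mul; lia]; lia.
apply: (@turan_lower n k k3 kn ((n - 2) %/ (k * (k - 2) - 1)) ((n - 2) %% (k * (k - 2) - 1))).
- exact: divn_eq.
- by rewrite ltn_mod.
apply: (leq_trans (edge_total k3 kn n2)); rewrite !leq_add2r.
have -> : \sum_(j < n) \sum_(i < j) ext_edge n k i j =
    \sum_(j < n) \sum_(i < n) ((i < j) && ext_edge n k i j).
  apply: eq_bigr => j _; rewrite (big_ord_widen n (fun i => ext_edge n k i j : nat) (ltnW (ltn_ord j))).
  by rewrite big_mkcond; apply: eq_bigr => i _; case: (i < j).
rewrite (sum_pairs n (fun j i => (i < j) && ext_edge n k i j)).
set P := [set _ | _]%SET.
pose m (p : 'I_n * 'I_n) : {set nat_graph n (ext_edge n k)} := [set p.2; p.1]%SET.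
rewrite -(card_in_imset (f := m) (D := mem P)).
  apply: subset_leq_card; apply/fintype.subsetP => E /imsetP[[j i]]; rewrite inE /= => ij ->.
  by apply: (@edge_in (nat_graph n (ext_edge n k)) i j); rewrite /= /nat_adj ij.
move=> [j i] [j' i']; rewrite !inE /= => /andP[ij _] /andP[ij' _] e.
have [e1 e2] := ends_pair ij; have [e1' e2'] := ends_pair ij'.
by congr pair; apply: val_inj => /=; [rewrite -e2 -e2'|rewrite -e1 -e1']; congr (_ _); exact: e.
Qed.

(** This keeps the constructed graph below the cut-off in [ex_OP]. *)
Lemma num_edges_max (G : sgraph) : num_edges G <= 'C(#|G|, 2).
Proof.
rewrite -cardsT -cards_draws; apply: subset_leq_card; apply/fintype.subsetP => E.
move=> /edgesP[u [v [uv ->]]]; rewrite inE finset.subsetT cards2.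
by case: (eqVneq u v) => // e; rewrite e adj_irr in uv.
Qed.

End FinalBounds.

Theorem theorem2p1 (R : realType) (n k : nat) (hk : (3 <= k)%N) (hn : (k <= n)%N) :
  Posz (ex_OP R n (cycle_graph k)) = turan_value n k.
Proof.
pose G := nat_graph n (ext_edge n k).
have Gn : #|G| = n by apply: card_ord.
have lower := construction_edges hk hn.
have mG : (num_edges G < 'C(n, 2).+1)%N by rewrite ltnS -[X in 'C(X, _)]Gn; apply: num_edges_max.
have opG : outerplanar R G.
  by apply: nat_graph_outerplanar => a b c d; exact: ext_edge_nocross.
have freeG : is_free (cycle_graph k) G by exact: construction_free.
have upper := num_edges_upper hk hn Gn opG freeG.
have le1 : (num_edges G <= ex_OP R n (cycle_graph k))%N.
  rewrite /ex_OP; apply: (@leq_bigmax_cond _ _ (fun m : 'I_('C(n, 2).+1) => m : nat) (Ordinal mG)).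
  by apply/asboolP; exists G.
have le2 : (ex_OP R n (cycle_graph k) <= `|turan_value n k|)%N.
  apply/bigmax_leqP => m /asboolP[H [Hn opH freeH <-]].
  by have := num_edges_upper hk hn Hn opH freeH; lia.
by move: lower upper le1 le2; rewrite -/G; lia.
Qed.
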